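(* Let $d\ge1$ and fix any ordering $\Pi$ of $\mathbb{Z}^d$. Let $f:\mathbb{T}^d\to[0,1]$ be measurable and let $p,q\in[0,1]$. Then the following three conditions are equivalent: $\mu_p\preccurlyeq\mathbb{P}^f$; $p\le \mathrm{GM}(f)$; $\mu_p\preccurlyeq_{\rm s}\mathbb{P}^f$. Similarly, the following three conditions are equivalent: $\mathbb{P}^f\preccurlyeq\mu_q$; $q\ge 1-\mathrm{GM}(\mathbf{1}-f)$; $\mathbb{P}^f\preccurlyeq_{\rm s}\mu_q$. In addition, for any stationary process on $\{0,1\}^{\mathbb{Z}^d}$ with law $\mu$ that has conditional negative association, and any $p\in[0,1]$, we have $\mu_p\preccurlyeq\mu$ if and only if $\mu_p\preccurlyeq_{\rm s}\mu$.
   Context: $\mathbb{T}^d:=\mathbb{R}^d/\mathbb{Z}^d$ with unit Lebesgue measure $\lambda_d$; $\widehat f(k):=\int_{\mathbb{T}^d} f(x)e^{-2\pi i k\cdot x}\,d\lambda_d(x)$. For measurable $f:\mathbb{T}^d\to[0,1]$, $\mathbb{P}^f$ is the unique Borel probability measure on $\{0,1\}^{\mathbb{Z}^d}$ such that for all $k\ge1$ and all distinct $e_1,\dots,e_k\in\mathbb{Z}^d$, $\mathbb{P}^f[\eta(e_1)=1,\dots,\eta(e_k)=1]=\det[\widehat f(e_j-e_i)]_{1\le i,j\le k}$ (it exists and is translation invariant). $\mathrm{GM}(f):=\exp\int_{\mathbb{T}^d}\log f\,d\lambda_d$ (with $\log 0=-\infty$, $\exp(-\infty)=0$). $\mu_p$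 is the product measure on $\{0,1\}^{\mathbb{Z}^d}$ with density $p$ of 1s. $\mathbf 1$ is the constant function 1. An ordering of $\mathbb{Z}^d$ is given by a set $\Pi\subset\mathbb{Z}^d$ with $\Pi\cup(-\Pi)=\mathbb{Z}^d\setminus\{\mathbf 0\}$, $\Pi\cap(-\Pi)=\emptyset$ and $\Pi+\Pi\subset\Pi$; the associated order is $k\prec l$ iff $l-k\in\Pi$. The past of $\mathbf 0$ is $-\Pi$, and $\mathrm{Past}_\Pi(\mathbf 0)$ is the $\sigma$-field generated by $\eta(j)$, $j\in-\Pi$. Stochastic domination: $\nu\preccurlyeq\mu$ means $\nu(A)\le\mu(A)$ for every increasing (Borel) set $A\subseteq\{0,1\}^{\mathbb{Z}^d}$, where $A$ is increasing if $\eta\in A$ and $\eta\le\delta$ coordinatewise imply $\delta\in A$. Strong domination (with respect to $\Pi$): for a stationary process $\{\eta_n\}_{n\in\mathbb{Z}^d}$ with law $\nu$, $\mu_p\preccurlyeq_{\rm s}\nu$ means $\nu[\eta_{\mathbf 0}=1\mid \mathrm{Past}_\Pi(\mathbf 0)]\ge p$ $\nu$-a.s.; $\nu\preccurlyeq_{\rm s}\mu_p$ is defined with $\ge$ replaced by $\le$. Negative associations: a probability measure on $\{0,1\}^{E}$ has negative associations if any two increasing events that are measurable with respect to the values of $\eta$ on disjoint subsets of $E$ are negatively correlated ($P(A\cap B)\le P(A)P(B)$). $\mu$ has conditional negative association if for every finite $A\subset\mathbb{Z}^d$ and every $\eta_0\in\{0,1\}^A$ (with conditioning event of positive probability), $\mu[\,\cdot\mid\eta\restriction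 A=\eta_0]$ has negative associations. *)

(* Defs.v *)
From HB Require Import structures.
From mathcomp Require Import all_boot all_order all_algebra.
From mathcomp Require Import all_classical all_reals all_analysis.
From mathcomp.real_closed Require Import complex.

Set Implicit Arguments.
Unset Strict Implicit.
Unset Printing Implicit Defensive.

Import Order.TTheory GRing.Theory Num.Theory.
Import numFieldNormedType.Exports.

Local Open Scope classical_set_scope.
Local Open Scope ring_scope.

Notation lattice d := 'rV[int]_d.

(** * The torus

    A function on [T^d = R^d / Z^d] is represented by a [Z^d]-periodic function
    on [R^d], and is integrated over the fundamental domain [[0, 1]^d] (whose
    boundary is negligible). *)

Notation euclid R d := (d.-tuple (measurableTypeR R)).

Section torus.
Variable R : realType.

Definition periodic_fun (d : nat) (f : euclid R d -> R) : Prop :=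
  forall (x : euclid R d) (k : lattice d),
    f [tuple tnth x i + (k ord0 i)%:~R | i < d] = f x.

Definition consT (n : nat) (x : measurableTypeR R * euclid R n) : euclid R n.+1 :=
  [tuple of x.1 :: x.2].

Lemma measurable_consT n : measurable_fun setT (@consT n).
Proof. exact: measurable_cons. Qed.

HB.instance Definition _ n :=
  isMeasurableFun.Build _ _ _ _ (@consT n) (@measurable_consT n).

(** The [d]-fold product of the Lebesgue measure on [[0, 1]]. *)
Fixpoint torus_measure (d : nat) : probability (euclid R d) R :=
  match d with
  | 0 => @dirac _ (euclid R 0) [tuple] R
  | n.+1 => distribution (uniform_prob (@ltr01 R) \x torus_measure n)%E (@consT n)
  end.

Lemma torus_measure_box n (A : 'I_n -> set (measurableTypeR R)) :
  (forall i, measurable (A i)) ->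
  torus_measure n [set x | forall i, A i (tnth x i)]
  = (\prod_(i < n) uniform_prob (@ltr01 R) (A i))%E.
Proof.
elim: n A => [|n IH] A mA.
  rewrite big_ord0 /= /dirac indicE mem_set//. by case.
rewrite big_ord_recl/= -(IH (fun i => A (lift ord0 i)))//.
rewrite /distribution /pushforward /=.
rewrite (_ : _ @^-1` _ = A ord0 `*` [set x | forall i, A (lift ord0 i) (tnth x i)]).
  rewrite product_measure1E//.
  rewrite (_ : [set x | _] = \bigcap_(i in [set: 'I_n]) ((@tnth _ _)^~ i @^-1` A (lift ord0 i))).
    apply: fin_bigcap_measurable => // i _. rewrite -[X in measurable X]setTI. exact: measurable_tnth.
  by apply/seteqP; split => x /= h i; [move=> _|]; exact: h.
apply/seteqP; split => -[x y]/=.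
  move=> h; split; first exact: (h ord0). by move=> i /=; move: (h (lift ord0 i)); rewrite /consT/= tnthS.
move=> [h1 h2] i; case: (unliftP ord0 i) => [j ->|->]//. by rewrite /consT tnthS.
Qed.

Definition dotp (d : nat) (k : lattice d) (x : euclid R d) : R :=
  \sum_(i < d) (k ord0 i)%:~R * tnth x i.

(** [\int f(x) exp(- 2 pi i k.x) dx], by real and imaginary parts. *)
Definition fourier (d : nat) (f : euclid R d -> R) (k : lattice d) : R[i] :=
  ((\int[torus_measure d]_x (f x * cos (2 * pi * dotp k x)))
   +i* - (\int[torus_measure d]_x (f x * sin (2 * pi * dotp k x))))%C.

(** [lne 0 = -oo] and [expeR -oo = 0]. *)
Definition GM (d : nat) (f : euclid R d -> R) : \bar R :=
  expeR (\int[torus_measure d]_x lne (f x)%:E)%E.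

End torus.

(** * Configurations *)

(** [<<s occupied E >>] is the sigma-field generated by the coordinates in
    [E]. As [lattice d] is countable, for [E = setT] it is the Borel
    sigma-field of the product topology. *)
Definition occupied (d : nat) (E : set (lattice d)) :
    set (set (lattice d -> bool)) :=
  [set [set eta : lattice d -> bool | eta k] | k in E].

Notation config d := (g_sigma_algebraType (@occupied d setT)).

Definition increasing_event (d : nat) (A : set (config d)) : Prop :=
  forall eta delta : config d,
    (forall k, eta k -> delta k) -> A eta -> A delta.

Definition is_ordering (d : nat) (Pi : set (lattice d)) : Prop :=
  [/\ Pi `|` -%R @` Pi = ~` [set 0],
      Pi `&` -%R @` Pi = set0 &
      forall k l, Pi k -> Pi l -> Pi (k + l)].

(** The past of the origin for the order [k < l] iff [l - k \in Pi]. *)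
Definition past0 (d : nat) (Pi : set (lattice d)) : set (lattice d) :=
  -%R @` Pi.

Definition shift (d : nat) (k : lattice d) (eta : config d) : config d :=
  fun j => eta (j + k).

Section laws.
Variables (R : realType) (d : nat).
Implicit Types (nu mu : probability (config d) R) (p : R).

Definition stationary mu : Prop :=
  forall (k : lattice d) (A : set (config d)),
    measurable A -> mu (shift k @^-1` A) = mu A.

Definition is_product_measure p mu : Prop :=
  forall (n : nat) (e : 'I_n -> lattice d) (b : 'I_n -> bool), injective e ->
    mu [set eta : config d | forall i, eta (e i) = b i]
    = (\prod_(i < n) (if b i then p else 1 - p))%:E.

(** [P] is the measure [P^f]; the identity is one of complex numbers, so it
    also asserts that the determinant is real. *)
Definition is_determinantal (f : euclid R d -> R)
    (P : probability (config d) R) : Prop :=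
  forall (n : nat) (e : 'I_n -> lattice d), (0 < n)%N -> injective e ->
    ((fine (P [set eta : config d | forall i, eta (e i) = true]))%:C)%C
    = \det (\matrix_(i < n, j < n) fourier f (e j - e i)).

Definition stoch_dom nu mu : Prop :=
  forall A : set (config d), measurable A -> increasing_event A ->
    (nu A <= mu A)%E.

(** [g] is a version of [nu(A | F)], where [F] is the sigma-field generated by
    the coordinates in [E]. *)
Definition is_cond_prob nu (E : set (lattice d)) (A : set (config d))
    (g : config d -> R) : Prop :=
  [/\ measurable_fun setT (g : g_sigma_algebraType (occupied E) -> R),
      nu.-integrable setT (EFin \o g) &
      forall B : set (config d), <<s occupied E >> B ->
        \int[nu]_(eta in B) (g eta)%:E = nu (A `&` B)]%E.

Definition occupied0 : set (config d) := [set eta | eta 0].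

(** The product measure of density [p] is strongly dominated by [nu]. *)
Definition strong_dom_ge (Pi : set (lattice d)) p nu : Prop :=
  exists2 g : config d -> R, is_cond_prob nu (past0 Pi) occupied0 g
    & {ae nu, forall eta, p <= g eta}.

(** [nu] is strongly dominated by the product measure of density [p]. *)
Definition strong_dom_le (Pi : set (lattice d)) nu p : Prop :=
  exists2 g : config d -> R, is_cond_prob nu (past0 Pi) occupied0 g
    & {ae nu, forall eta, g eta <= p}.

Definition neg_assoc (P : set (config d) -> \bar R) : Prop :=
  forall (E1 E2 : set (lattice d)) (A B : set (config d)),
    E1 `&` E2 = set0 ->
    <<s occupied E1 >> A -> <<s occupied E2 >> B ->
    increasing_event A -> increasing_event B ->
    (P (A `&` B) <= P A * P B)%E.

(** [mu(. | C)], meaningful when [mu C > 0]. *)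
Definition cond_law mu (C : set (config d)) : set (config d) -> \bar R :=
  fun A => (mu (A `&` C) * ((fine (mu C))^-1)%:E)%E.

Definition cond_neg_assoc mu : Prop :=
  forall (A : set (lattice d)) (eta0 : config d), finite_set A ->
    let C : set (config d) := [set eta | forall k, A k -> eta k = eta0 k] in
    (0 < mu C)%E -> neg_assoc (cond_law mu C).

End laws.

(* Main.v *)
(** Call (K) the bound [p * P(1 on A) <= P(1 on A and at 0)] for all finite [A]
    in the past of 0. For a stationary process whose cylinder probabilities are
    conditionally negatively correlated, (K) is equivalent to both notions of
    domination. Domination gives [p ^ (n ^ d) <= P(1 on the box of side n)],
    while peeling the sites of the box off from the last one bounds this
    probability by [c ^ ((n - r) ^ d)] with [c = P(1 on A and at 0) / P(1 on A)];
    let [n] tend to infinity. Conversely negative correlation turns conditioning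
    ones into zeros, so (K) holds given any past cylinder, hence given the whole
    past by approximation; resampling the sites one after the other then yields
    domination.

    For the determinantal process of [f], conditional negative correlation is
    the Desnanot-Jacobi identity for Hermitian matrices, and [c] is a Schur
    complement, namely the least value of [\int |1 + T|^2 f] over trigonometric
    polynomials [T] with spectrum in [A]. It remains to see that the infimum over
    all [T] with spectrum in the past is [GM f]. For a weight [exp phi] with
    [phi = c + 2 Re h] a trigonometric polynomial and [h] analytic, use the
    multipliers [(1 - h / N) ^ N] and [(1 + h / N) ^ N], which are analytic with
    constant term 1 and satisfy [|1 + h / N| ^ (2 N) <= exp (2 Re h + M / N)].
    Bounded pointwise limits extend this to bounded [phi], and truncation to
    [log f]. The upper bound [q] follows by exchanging zeros and ones. *)

From HB Require Import structures.
From mathcomp Require Import all_boot all_order all_algebra.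
From mathcomp Require Import all_classical all_reals all_analysis.
From mathcomp Require Import measurable_realfun.
From mathcomp.real_closed Require Import complex.
From mathcomp Require Import zify ring lra.
Require Import Defs.

Set Implicit Arguments.
Unset Strict Implicit.
Unset Printing Implicit Defensive.

Import Order.TTheory GRing.Theory Num.Theory.
Import numFieldNormedType.Exports.

Local Open Scope classical_set_scope.
Local Open Scope ring_scope.

(** The order on the lattice is not a well-order and the past is infinite, so nothing is proved by
    induction along it: only finite lists of sites are sorted, and statements about the whole past
    become inequalities between probabilities, first on finite cylinders and then on monotone limits
    of local events. For an increasing event the inner, compact approximation is the useful one: it
    need not be increasing, but its upward closure is again a limit of local events, is increasing,
    and stays inside the event. Cylinders may be null and kernel matrices singular, so conditional
    statements are multiplied out, and positivity is drawn from domination itself when [p] is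
    positive. In the geometric mean part the mean of [f * exp (psi - mean psi)] is continuous in
    [psi] for bounded pointwise limits, so that both inequalities reduce to trigonometric
    polynomials [psi]. A single family of multipliers with squared modulus at most about
    [exp (psi - mean psi)] then serves twice: with [psi] a truncation of [log f] it multiplies a
    given trial polynomial, and with the opposite sign it is itself the trial polynomial. *)

Lemma perm_insertl (T : eqType) (x : T) t A B :
  perm_eq (x :: t ++ A ++ B) (t ++ (x :: A) ++ B).
Proof. exact/permPl/(perm_catCA [:: x] t (A ++ B)). Qed.

Lemma perm_insertr (T : eqType) (x : T) t A B :
  perm_eq (x :: t ++ A ++ B) (t ++ A ++ x :: B).
Proof. by have /permPl := perm_catCA [:: x] (t ++ A) B; rewrite -!catA. Qed.

(** * Cylinders, local events and regularity *)

Section local_events.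
Variable d : nat.
Implicit Types (E F : set (config d)) (Q : set (lattice d)) (s : seq (lattice d)).

Definition occ (x : lattice d) : set (config d) := [set eta : config d | eta x].

Definition cyl (A B : seq (lattice d)) : set (config d) :=
  [set eta : config d | all (eta : lattice d -> bool) A && all (fun k => ~~ eta k) B].

Definition upd (x : lattice d) (v : bool) (eta : config d) : config d :=
  fun k => if k == x then v else eta k.

Definition determined_by s E :=
  forall eta zeta : config d, {in s, eta =1 zeta} -> E eta -> E zeta.

Definition local Q E :=
  exists2 s, (forall k, k \in s -> Q k) & determined_by s E.

(** The carrier is that of [config d] with a coarser sigma-field, so one set can be declared
    measurable for either by a type annotation. *)
Definition past_field Q := g_sigma_algebraType (@occupied d Q).

Lemma measurable_occ Q k : Q k ->
  measurable (occ k : set (past_field Q)).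
Proof. by move=> Qk; apply: sub_sigma_algebra; exists k. Qed.

Lemma determined_by_cons x s E v : determined_by (x :: s) E ->
  determined_by s [set eta | E (upd x v eta)].
Proof.
move=> h eta zeta ez /=; apply: h => k; rewrite inE /upd.
by case: eqP => //= _; exact: ez.
Qed.

Lemma upd_id x (eta : config d) : upd x (eta x) eta = eta.
Proof. by apply/funext => k; rewrite /upd; case: eqP => [->|]. Qed.

Lemma determined_by_measurable Q s E : (forall k, k \in s -> Q k) ->
  determined_by s E -> measurable (E : set (past_field Q)).
Proof.
elim: s E => [|x s IH] E sQ dE.
  have [->|/set0P[eta Eeta]] := eqVneq E set0; first exact: measurable0.
  rewrite (_ : E = setT) //; apply/seteqP; split => // zeta _.
  by apply: dE Eeta.
have mx := measurable_occ (sQ x (mem_head _ _)).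
have IH' v := IH _ (fun k ks => sQ k (mem_behead (s := x :: s) ks)) (determined_by_cons (v := v) dE).
rewrite (_ : E = (occ x `&` [set eta | E (upd x true eta)]) `|`
     (~` occ x `&` [set eta | E (upd x false eta)])); last first.
  apply/seteqP; split => eta /=.
    move=> Ee; have := upd_id x eta; case ex : (eta x) => ue; [left|right];
    by rewrite /occ/= ue ex.
  have := upd_id x eta; rewrite /occ/=.
  by case: (eta x) => ue -[] []// _; rewrite ue.
apply: measurableU; apply: measurableI; [exact: mx|exact: IH'| |exact: IH'].
exact: measurableC.
Qed.

Lemma past_field_sub Q Q' E : Q `<=` Q' ->
  measurable (E : set (past_field Q)) -> measurable (E : set (past_field Q')).
Proof.
move=> QQ'; apply: sub_sigma_algebra2.
by move=> _ [k /QQ' Qk <-]; exists k.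
Qed.

Lemma past_field_measurable Q E :
  measurable (E : set (past_field Q)) -> measurable E.
Proof. exact: past_field_sub. Qed.

Lemma local_measurable Q E : local Q E -> measurable (E : set (past_field Q)).
Proof. by move=> [s sQ dE]; exact: determined_by_measurable sQ dE. Qed.

Lemma localC Q E : local Q E -> local Q (~` E).
Proof.
move=> [s sQ dE]; exists s => // eta zeta ez nE Ez; apply: nE.
by apply: dE Ez => k ks; rewrite ez.
Qed.

Lemma localU Q E F : local Q E -> local Q F -> local Q (E `|` F).
Proof.
move=> [s sQ dE] [t tQ dF]; exists (s ++ t).
  by move=> k; rewrite mem_cat => /orP[/sQ|/tQ].
move=> eta zeta ez [Ee|Fe]; [left|right].
- by apply: dE Ee => k ks; apply: ez; rewrite mem_cat ks.
- by apply: dF Fe => k ks; apply: ez; rewrite mem_cat ks orbT.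
Qed.

Lemma determined_by_cyl A B : determined_by (A ++ B) (cyl A B).
Proof.
move=> eta zeta ez /andP[/allP hA /allP hB]; apply/andP; split; apply/allP => k ks.
  by rewrite -ez ?hA// mem_cat ks.
by rewrite -ez ?hB// mem_cat ks orbT.
Qed.

Lemma local_cyl Q A B : (forall k, k \in A ++ B -> Q k) -> local Q (cyl A B).
Proof. by exists (A ++ B) => //; exact: determined_by_cyl. Qed.

Lemma measurable_cyl A B : measurable (cyl A B).
Proof. by apply: local_measurable; exact: local_cyl. Qed.

Lemma measurable_occT x : measurable (occ x).
Proof. exact: (@measurable_occ setT). Qed.

Lemma cyl_consl x A B : cyl (x :: A) B = cyl A B `&` occ x.
Proof.
by apply/seteqP; split => eta; rewrite /cyl /occ /=;
  [case/andP=> /andP[-> ->] ->|case=> /andP[-> ->] ->].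
Qed.

Lemma cyl_consr x A B : cyl A (x :: B) = cyl A B `\` occ x.
Proof.
apply/seteqP; split => eta; rewrite /cyl /occ /=; first by case/and3P=> -> /negP ? ->.
by case=> /andP[-> ->] /negP ->.
Qed.

Section regularity.
Variables (R : realType) (mu : probability (config d) R).

(** Inner regularity by compact sets and outer regularity by open ones, expressed by monotone
    sequences of local events. Complementation exchanges the two families. The outer one carries
    bounds from local events to the past; the inner one feeds the compactness argument for upward
    closures. *)
Definition regular Q E := forall e : R, 0 < e ->
  exists F G : nat -> set (config d),
  [/\ (forall n, local Q (F n)) /\ (forall n, local Q (G n)),
      (forall n, F n.+1 `<=` F n) /\ (forall n, G n `<=` G n.+1),
      \bigcap_n F n `<=` E /\ E `<=` \bigcup_n G n &
      (mu (\bigcup_n G n `\` \bigcap_n F n) <= e%:E)%E].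

Lemma regularC Q E : regular Q E -> regular Q (~` E).
Proof.
move=> rE e e0; have [F [G [[lF lG] [dF iG] [FE EG] le]]] := rE e e0.
exists (fun n => ~` G n), (fun n => ~` F n); split; first by split=> n; exact: localC.
- by split=> n; exact: subsetC.
- rewrite -setC_bigcup -setC_bigcap; split; exact: subsetC.
- by rewrite -setC_bigcup -setC_bigcap setDE setCK setIC -setDE.
Qed.

(** Half of [e] is spread geometrically over the gaps of the sets [E n]; the other half pays for
    keeping only finitely many of the inner sets. *)
Lemma regular_bigcup Q (E : nat -> set (config d)) :
  (forall n, regular Q (E n)) -> regular Q (\bigcup_n E n).
Proof.
move=> rE e e0.
have e2 n : 0 < (e / 2) / (2 ^ n.+1)%:R :> R.
  by rewrite !divr_gt0// ltr0n expn_gt0.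
pose P n (FG : (nat -> set (config d)) * (nat -> set (config d))) :=
  [/\ (forall j, local Q (FG.1 j)) /\ (forall j, local Q (FG.2 j)),
      (forall j, FG.1 j.+1 `<=` FG.1 j) /\ (forall j, FG.2 j `<=` FG.2 j.+1),
      \bigcap_j FG.1 j `<=` E n /\ E n `<=` \bigcup_j FG.2 j &
      (mu (\bigcup_j FG.2 j `\` \bigcap_j FG.1 j) <= ((e / 2) / (2 ^ n.+1)%:R)%:E)%E].
have /choice[FG hFG] : forall n, exists FG, P n FG.
  by move=> n; have [F [G h]] := rE n _ (e2 n); exists (F, G).
pose F n := (FG n).1; pose G n := (FG n).2.
have lF n j : local Q (F n j) by have [[h _] _ _ _] := hFG n; exact: h.
have lG n j : local Q (G n j) by have [[_ h] _ _ _] := hFG n; exact: h.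
have mF n j : measurable (F n j) := past_field_measurable (local_measurable (lF n j)).
have mG n j : measurable (G n j) := past_field_measurable (local_measurable (lG n j)).
pose K n := \bigcap_j F n j; pose O n := \bigcup_j G n j.
have mK n : measurable (K n) by exact: bigcapT_measurable.
have mO n : measurable (O n) by exact: bigcup_measurable.
have KE n : K n `<=` E n by have [_ _ [? ?] _] := hFG n.
have EO n : E n `<=` O n by have [_ _ [? ?] _] := hFG n.
have dF n : {homo F n : i j / (i <= j)%N >-> j `<=` i}.
  apply: (homo_leq (r := fun A B => B `<=` A)) => [?|? ? ? h1 h2|i];
    [exact: subset_refl|exact: subset_trans h2 h1|].
  by have [_ [h _] _ _] := hFG n; exact: h.
have iG n : {homo G n : i j / (i <= j)%N >-> i `<=` j}.
  apply: homo_leq => [?|? ? ? h1 h2|i]; [exact: subset_refl|exact: subset_trans h1 h2|].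
  by have [_ [_ h] _ _] := hFG n; exact: h.
pose KK := \bigcup_n K n; pose OO := \bigcup_n O n.
have mKK : measurable KK by exact: bigcup_measurable.
have mOO : measurable OO by exact: bigcup_measurable.
have le1 : (mu (OO `\` KK) <= (e / 2)%:E)%E.
  apply: (@le_trans _ _ (\sum_(n <oo) mu (O n `\` K n))%E).
    apply: measure_sigma_subadditive => [n||].
    - exact: measurableD.
    - exact: measurableD.
    - by move=> eta [[n _ One] nK]; exists n => //; split => // Kn; apply: nK; exists n.
  apply: le_trans (epsilon_trick0 xpredT _); last by rewrite divr_ge0// ltW.
  apply: lee_nneseries => // n _; by have [_ _ _ ?] := hFG n.
pose KM M := \bigcup_(n < M) K n.
have mKM M : measurable (KM M) by exact: bigcup_measurable.
(* The countable union [KK] of the inner sets need not be compact. Continuity from above lets a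
   finite union replace it. *)
have [M leM] : exists M, (mu (KK `\` KM M) <= (e / 2)%:E)%E.
  apply: contrapT => /forallNP h.
  have cap0 : \bigcap_M (KK `\` KM M) = set0.
    apply/seteqP; split => // eta hm; have [[n _ Kn] _] := hm 0%N I.
    by have [_] := hm n.+1 I; apply; exists n => /=.
  have cvg0 : (mu \o (fun M => KK `\` KM M)) x @[x --> \oo] --> mu (\bigcap_M (KK `\` KM M)).
    apply: nonincreasing_cvg_mu.
    - by rewrite (le_lt_trans (probability_le1 _ _)) ?ltry//; exact: measurableD.
    - by move=> M; exact: measurableD.
    - by rewrite cap0.
    - move=> a b ab; apply/subsetPset; apply: setDS => eta [n /= na Kn].
      by exists n => //=; exact: leq_trans na ab.
  have : ((e / 2)%:E <= lim ((mu \o (fun M => KK `\` KM M)) x @[x --> \oo]))%E.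
    apply: lime_ge; first exact: cvgP cvg0.
    by near=> a => /=; have /negP := h a; rewrite -ltNge => /ltW.
  by rewrite (cvg_lim _ cvg0)// cap0 measure0 lee_fin; lra.
exists (fun j => \bigcup_(n < M) F n j), (fun j => \bigcup_(n < j) G n j).
have lU (H : nat -> set (config d)) m : (forall n, local Q (H n)) -> local Q (\bigcup_(n < m) H n).
  move=> lH; elim: m => [|m IH]; last first.
    rewrite (_ : \bigcup_(n < m.+1) H n = (\bigcup_(n < m) H n) `|` H m); first exact: localU.
    apply/seteqP; split => eta; first move=> [n /=].
      by rewrite ltnS leq_eqVlt => /predU1P[-> Hm|nm Hn]; [right|left; exists n].
    by move=> [[n /= nm Hn]|Hm]; [exists n => //=; exact: ltnW|exists m => /=].
  rewrite (_ : \bigcup_(_ < _) _ = set0); first by exists [::].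
  by apply/seteqP; split => // ? [].
(* Finite unions commute with decreasing intersections: past the largest of the [M] indices at which
   a point leaves the [F n], it is in none of them. *)
have FKM : \bigcap_j \bigcup_(n < M) F n j = KM M.
  apply/seteqP; split => eta; last first.
    by move=> [n nM Kn] j _; exists n => //; exact: Kn.
  move=> h; apply: contrapT => nKM.
  have : forall n, exists j, (n < M)%N -> ~ F n j eta.
    move=> n; have [nM|nM] := ltnP n M; last by exists 0%N.
    apply: contrapT => /forallNP h'; apply: nKM; exists n => // j _.
    by have /not_implyP[_ /contrapT] := h' j.
  move=> /choice[jn hj]; have [n /= nM Fn] := h (\max_(n < M) jn n)%N I.
  apply: (hj n nM); apply: dF Fn.
  exact: (leq_bigmax (Ordinal nM) (F := fun i : 'I_M => jn i)).
have GOO : \bigcup_j \bigcup_(n < j) G n j = OO.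
  apply/seteqP; split => eta; first by move=> [j _ [n nj Gn]]; exists n => //; exists j.
  move=> [n _ [j _ Gn]]; exists (maxn n.+1 j) => //; exists n; first by rewrite /= leq_maxl.
  by apply: iG Gn; rewrite leq_maxr.
split.
- by split => j; exact: lU.
- split => j eta; first by move=> [n nM Fn]; exists n => //; exact: dF Fn.
  by move=> [n nj Gn]; exists n; [exact: leqW|exact: iG Gn].
- split; first by rewrite FKM => eta [n _ /KE En]; exists n.
  by rewrite GOO => eta [n _ /EO On]; exists n.
- rewrite FKM GOO; apply: (@le_trans _ _ (mu ((OO `\` KK) `|` (KK `\` KM M)))).
    apply: le_measure; rewrite ?inE; [exact: measurableD|by apply: measurableU; exact: measurableD|].
    by move=> eta [Oe nK]; have [Ke|nKe] := pselect (KK eta); [right|left].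
  apply: le_trans (measureU2 _ _ _) _; [exact: measurableD|exact: measurableD|].
  by rewrite [e in leRHS]splitr EFinD leeD.
Unshelve. all: end_near. Qed.

Lemma regular_local Q E : local Q E -> regular Q E.
Proof.
move=> lE e e0; exists (fun=> E), (fun=> E).
have cup : \bigcup_(_ in [set: nat]) E = E by rewrite bigcup_const//; exists 0%N.
have cap : \bigcap_(_ in [set: nat]) E = E by rewrite bigcap_const//; exists 0%N.
rewrite cup cap setDv measure0 lee_fin ltW//.
split=> //; first by split=> n; exact: subset_refl.
by split; exact: subset_refl.
Qed.

Lemma regular_past Q E : measurable (E : set (past_field Q)) -> regular Q E.
Proof.
apply: smallest_sub; last first.
  move=> _ [k Qk <-].
  have lk : local Q (occ k).
    exists [:: k]; first by move=> j; rewrite inE => /eqP ->.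
    by move=> eta zeta ez; rewrite /occ/= ez ?inE.
  apply: regular_local => //.
split.
- by apply: regular_local; exists [::].
- by move=> A rA; rewrite setTD; exact: regularC.
- exact: regular_bigcup.
Qed.

End regularity.
End local_events.

(** * From cylinders to all events of the past *)

Section domination.
Variables (R : realType) (d : nat).
Implicit Types (mu : probability (config d) R) (Q : set (lattice d)).
Implicit Types (E F : set (config d)) (A B : seq (lattice d)) (p : R).

Definition pr mu E : R := fine (mu E).

Lemma prE mu E : measurable E -> mu E = (pr mu E)%:E.
Proof. by move=> mE; rewrite /pr fineK// fin_num_measure. Qed.

Lemma pr_ge0 mu E : 0 <= pr mu E.
Proof. exact: fine_ge0 (measure_ge0 _ _). Qed.

Lemma pr0 mu : pr mu set0 = 0.
Proof. by rewrite /pr measure0. Qed.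

Lemma cyl_nil : cyl [::] [::] = [set: config d].
Proof. by apply/seteqP; split. Qed.

Lemma pr_cyl_nil mu : pr mu (cyl [::] [::]) = 1.
Proof. by rewrite cyl_nil /pr probability_setT. Qed.

Lemma le_pr mu E F : measurable E -> measurable F -> E `<=` F ->
  pr mu E <= pr mu F.
Proof.
by move=> mE mF EF; rewrite -lee_fin -!prE// le_measure// inE.
Qed.

Lemma pr_split mu E F : measurable E -> measurable F ->
  pr mu E = pr mu (E `&` F) + pr mu (E `\` F).
Proof.
move=> mE mF; have mEF := measurableI _ _ mE mF; have mEDF := measurableD mE mF.
apply: EFin_inj; rewrite EFinD -!prE// addeC.
exact: measureDI.
Qed.

Lemma pr_cyl_split mu A B x :
  pr mu (cyl A B) = pr mu (cyl (x :: A) B) + pr mu (cyl A (x :: B)).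
Proof.
rewrite cyl_consl cyl_consr -pr_split//; [exact: measurable_cyl|].
exact: measurable_occT.
Qed.

Lemma cyl_perm A A' B B' : A =i A' -> B =i B' -> cyl A B = cyl A' B'.
Proof.
by move=> AA' BB'; rewrite /cyl; apply/seteqP; split => eta /=;
  rewrite (eq_all_r AA') (eq_all_r BB').
Qed.

Definition cyl_stationary mu := forall k A B,
  pr mu (cyl (map (+%R^~ k) A) (map (+%R^~ k) B)) = pr mu (cyl A B).

(** Negative correlation of two sites given a cylinder, multiplied out so that null cylinders cause
    no trouble. *)
Definition neg_corr mu := forall x y A B, uniq (x :: y :: A ++ B) ->
  pr mu (cyl (x :: y :: A) B) * pr mu (cyl A B)
  <= pr mu (cyl (x :: A) B) * pr mu (cyl (y :: A) B).

Definition ones_bound Q mu p := forall A, uniq A -> (forall k, k \in A -> Q k) ->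
  p * pr mu (cyl A [::]) <= pr mu (cyl (0 :: A) [::]).

Lemma ones_bound_cyl Q mu p A B : ~ Q 0 -> neg_corr mu -> ones_bound Q mu p ->
  uniq (A ++ B) -> (forall k, k \in A ++ B -> Q k) ->
  p * pr mu (cyl A B) <= pr mu (cyl (0 :: A) B).
Proof.
move=> Q0 nc kp; elim: B => [|b B IH] uAB QAB.
  by move: uAB QAB; rewrite cats0; exact: kp.
have perm : perm_eq (A ++ b :: B) (b :: A ++ B) by rewrite -cat1s perm_catCA.
have {}uAB : uniq (b :: A ++ B) by rewrite -(perm_uniq perm).
have {}QAB : forall k, k \in b :: A ++ B -> Q k.
  by move=> k; rewrite -(perm_mem perm); exact: QAB.
have Qb : Q b by apply: QAB; rewrite mem_head.
have /IH {}IH : uniq (A ++ B) by move: uAB => /andP[].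
have {}IH := IH (fun k h => QAB k (mem_behead (s := b :: _) h)).
have u0 : uniq (0 :: b :: A ++ B).
  by rewrite cons_uniq uAB andbT; apply/negP => /QAB.
have := nc _ _ _ _ u0.
have := pr_cyl_split mu A B b; have := pr_cyl_split mu (0 :: A) B b.
rewrite (@cyl_perm [:: b, 0 & A] [:: 0, b & A] B B)//; last first.
  by move=> k; rewrite !inE orbCA.
have := pr_ge0 mu (cyl A B); have := pr_ge0 mu (cyl A (b :: B)).
have := pr_ge0 mu (cyl (b :: A) B); have := pr_ge0 mu (cyl (0 :: A) (b :: B)).
move: IH.
move: (pr _ (cyl A B)) (pr _ (cyl A (b :: B))) (pr _ (cyl (b :: A) B))
  (pr _ (cyl (0 :: A) (b :: B))) (pr _ (cyl (0 :: A) B)) (pr _ (cyl [:: 0, b & A] B)).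
move=> c cb b1 s a ab IH s0 b10 cb0 c0 ea ec h.
have [c_eq0|c_neq0] := eqVneq c 0; first by rewrite (_ : cb = 0) ?mulr0//; lra.
have cgt0 : 0 < c by rewrite lt_def c_neq0.
(* Substituting the two splits turns [ab * c <= a * b1] into [a * cb <= s * c]. With [p * c <= a]
   this gives [p * cb * c <= s * c], and [c] cancels. *)
have := ler_wpM2r cb0 IH; rewrite -(ler_pM2l cgt0); nra.
Qed.

Definition cyl_bound Q mu p := forall A B, uniq (A ++ B) ->
  (forall k, k \in A ++ B -> Q k) ->
  p * pr mu (cyl A B) <= pr mu (cyl (0 :: A) B).

(** The sites on which [E] depends are decided one at a time; once all are decided, the cylinder is
    either contained in [E] or disjoint from it. *)
Lemma local_bound Q mu p E : cyl_bound Q mu p -> local Q E ->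
  p * pr mu E <= pr mu (occ 0 `&` E).
Proof.
move=> cb [s sQ dE].
have main t A B : uniq (t ++ A ++ B) -> (forall k, k \in t ++ A ++ B -> Q k) ->
    (determined_by (t ++ A ++ B) E) ->
    p * pr mu (cyl A B `&` E) <= pr mu (cyl (0 :: A) B `&` E).
  move=> {sQ dE s}; elim: t A B => [|x t IH] A B uAB QAB dE.
    have [->|/set0P[eta [ABe Ee]]] := eqVneq (cyl A B `&` E) set0.
      by rewrite pr0 mulr0 pr_ge0.
    have sub : cyl A B `<=` E.
      move=> zeta ABz; apply: dE Ee => k; rewrite /= mem_cat.
      move: ABz ABe => /andP[/allP zA /allP zB] /andP[/allP eA /allP eB].
      case/orP => [kA|kB]; first by rewrite eA// zA.
      by rewrite (negbTE (eB _ kB)) (negbTE (zB _ kB)).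
    rewrite !setIidl//; first exact: cb.
    by move=> zeta; rewrite cyl_consl => -[/sub].
  have mx : measurable (occ x) by exact: measurable_occT.
  have lE : measurable E.
    by apply: past_field_measurable; apply: determined_by_measurable dE.
  have mAB A' B' : measurable (cyl A' B' `&` E).
    by apply: measurableI => //; exact: measurable_cyl.
  rewrite (pr_split _ (mAB A B) mx) (pr_split _ (mAB (0 :: A) B) mx) mulrDr.
  have p1 := perm_insertl x t A B; have p2 := perm_insertr x t A B.
  have sD X : (X `&` E) `\` occ x = (X `\` occ x) `&` E by rewrite !setDE setIAC.
  rewrite !sD !(setIAC _ E) -cyl_consl -cyl_consr.
  rewrite (_ : cyl (0 :: A) B `&` occ x = cyl (0 :: x :: A) B); last first.
    by rewrite -cyl_consl; apply: cyl_perm => // k; rewrite !inE orbCA.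
  rewrite -cyl_consr lerD//.
    apply: IH; first by rewrite -(perm_uniq p1).
      by move=> k; rewrite -(perm_mem p1); exact: QAB.
    by move=> eta zeta ez; apply: dE => k; rewrite (perm_mem p1); exact: ez.
  apply: IH; first by rewrite -(perm_uniq p2).
    by move=> k; rewrite -(perm_mem p2); exact: QAB.
  by move=> eta zeta ez; apply: dE => k; rewrite (perm_mem p2); exact: ez.
have := main (undup s) [::] [::].
rewrite cyl_consl cyl_nil !setTI; apply; rewrite ?cats0 ?undup_uniq//.
  by move=> k; rewrite mem_undup; exact: sQ.
by move=> eta zeta ez; apply: dE => k ks; apply: ez; rewrite mem_undup.
Qed.

(** The bound passes to increasing limits of local events, and an outer approximation of [E] of this
    kind costs at most [e]. *)
Lemma past_bound Q mu p E : 0 <= p -> cyl_bound Q mu p ->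
  measurable (E : set (past_field Q)) ->
  p * pr mu E <= pr mu (occ 0 `&` E).
Proof.
move=> p0 cb mE; apply/ler_addgt0Pr => e e0.
have [F [G [[lF lG] [dF iG] [FE EG] le]]] := regular_past mu mE e0.
have mG n := past_field_measurable (local_measurable (lG n)).
have mF n := past_field_measurable (local_measurable (lF n)).
have mGG : measurable (\bigcup_n G n) by exact: bigcup_measurable.
have mFF : measurable (\bigcap_n F n) by exact: bigcapT_measurable.
have m0 : measurable (occ 0 : set (config d)) by exact: measurable_occT.
have {}mE := past_field_measurable mE.
have hG : p * pr mu (\bigcup_n G n) <= pr mu (occ 0 `&` \bigcup_n G n).
  have cvgG : (mu \o G) x @[x --> \oo] --> mu (\bigcup_n G n).
    apply: nondecreasing_cvg_mu => //.
    by apply/nondecreasing_seqP => n; exact/subsetPset.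
  rewrite -lee_fin EFinM -prE//.
  have cvgpG : (p%:E * (mu \o G) x)%E @[x --> \oo] --> (p%:E * mu (\bigcup_n G n))%E.
    exact: cvgeZl.
  rewrite -(cvg_lim _ cvgpG)//; apply: lime_le; first exact: cvgP cvgpG.
  apply: nearW => n /=; rewrite prE// -EFinM lee_fin.
  apply: le_trans (local_bound cb (lG n)) _; apply: le_pr => //; try exact: measurableI.
  by apply: setIS; exact: bigcup_sup.
apply: (@le_trans _ _ (p * pr mu (\bigcup_n G n))).
  by rewrite ler_wpM2l// le_pr.
apply: le_trans hG _.
rewrite (pr_split mu (measurableI _ _ m0 mGG) mE) lerD//.
  by apply: le_pr => //; try apply: measurableI => //; [exact: measurableI|move=> eta [[]]].
rewrite -lee_fin -prE; last by apply: measurableD => //; exact: measurableI.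
apply: le_trans le; rewrite le_measure// ?inE; last first.
- by move=> eta [[_ Ge] nE]; split => // /FE.
- exact: measurableD.
- by apply: measurableD => //; exact: measurableI.
Qed.

End domination.

(** * Conditional probabilities given the past *)

Section conditional_probability.
Variables (R : realType) (d : nat) (mu : probability (config d) R).
Variable Q : set (lattice d).
Implicit Types (E : set (config d)) (g h : config d -> R) (p : R).

Definition past_measurable g := measurable_fun setT (g : past_field Q -> R).

(** Since [h] is measurable for the past, the sets where it is at most [- 1 / (n + 1)] are
    admissible test events; each is null, and together they exhaust the set where [h] is
    negative. *)
Lemma ae_ge0_Rintegral h : past_measurable h ->
  mu.-integrable setT (EFin \o h) ->
  {ae mu, forall eta, 0 <= h eta} <->
  (forall E, measurable (E : set (past_field Q)) -> 0 <= \int[mu]_(eta in E) h eta).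
Proof.
move=> mh ih; pose N r := [set eta : config d | h eta <= r].
have mN r : measurable (N r : set (past_field Q)).
  rewrite (_ : N r = setT `&` (h : past_field Q -> R) @^-1` `]-oo, r]%classic); first exact: mh.
  by rewrite setTI; apply/seteqP; split => eta /=; rewrite in_itv.
have ihE E : measurable E -> mu.-integrable E (EFin \o h).
  by move=> mE; apply: integrableS ih.
split.
- move=> [M [mM M0 sub]] E /past_field_measurable mE.
  rewrite /Rintegral (@negligible_integral _ _ _ mu E M)//; last exact: ihE.
  apply: fine_ge0; apply: integral_ge0 => eta [_ nM].
  by rewrite lee_fin; apply: contrapT => nh; apply: nM; apply: sub.
- move=> hE.
  have N0 n : mu (N (- n.+1%:R^-1)) = 0%E.
    have mN' := past_field_measurable (mN (- n.+1%:R^-1)).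
    have := hE _ (mN (- n.+1%:R^-1)).
    have : \int[mu]_(eta in N (- n.+1%:R^-1)) h eta <= \int[mu]_(eta in N (- n.+1%:R^-1)) (- n.+1%:R^-1).
      apply: le_Rintegral => //; first exact: ihE.
      exact: finite_measure_integrable_cst.
    rewrite Rintegral_cst// -/(pr _ _) prE//; have := pr_ge0 mu (N (- n.+1%:R^-1)).
    have n0 : 0 < n.+1%:R^-1 :> R by rewrite invr_gt0.
    move: (pr _ _) => x x0 h1 h2; congr EFin; apply/eqP; rewrite eq_le x0 andbT.
    by rewrite -(ler_pM2l n0) mulr0 -oppr_ge0 -mulNr (le_trans h2 h1).
  change (mu.-negligible (~` [set eta | 0 <= h eta])).
  apply: (negligibleS (A := \bigcup_n N (- n.+1%:R^-1))).
    move=> eta /= /negP; rewrite -ltNge => h0.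
    have [n hn] := ltr_add_invr h0.
    by exists n => //; rewrite /N/= -subr_le0 opprK ltW.
  apply: negligible_bigcup => n.
  have mn := past_field_measurable (mN (- n.+1%:R^-1)).
  by exists (N (- n.+1%:R^-1)); split => //; exact: N0.
Qed.

Lemma cond_prob_bound_ge p g : is_cond_prob mu Q (@occupied0 d) g ->
  {ae mu, forall eta, p <= g eta} <->
  (forall E, measurable (E : set (past_field Q)) ->
     p * pr mu E <= pr mu (occ 0 `&` E)).
Proof.
move=> [mg ig gE].
have -> : {ae mu, forall eta, p <= g eta} <-> {ae mu, forall eta, 0 <= (g eta - p)}.
  by split; apply: filterS => eta; rewrite subr_ge0.
rewrite ae_ge0_Rintegral//; first last.
- rewrite (_ : _ \o _ = (EFin \o g) \- cst p%:E)%E//.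
  by apply: integrableB => //; exact: finite_measure_integrable_cst.
- exact: measurable_funB.
have occ_prE E : measurable (E : set (past_field Q)) ->
    (0 <= \int[mu]_(eta in E) (g eta - p)) = (p * pr mu E <= pr mu (occ 0 `&` E)).
  move=> mE; have mE' := past_field_measurable mE.
  rewrite RintegralB//; last exact: finite_measure_integrable_cst.
    by rewrite subr_ge0 Rintegral_cst// /Rintegral gE.
  exact: integrableS ig.
by split=> h E mE; [rewrite -occ_prE//; exact: h|rewrite occ_prE//; exact: h].
Qed.

Lemma cond_prob_bound_le p g : is_cond_prob mu Q (@occupied0 d) g ->
  {ae mu, forall eta, g eta <= p} <->
  (forall E, measurable (E : set (past_field Q)) ->
     pr mu (occ 0 `&` E) <= p * pr mu E).
Proof.
move=> [mg ig gE].
have -> : {ae mu, forall eta, g eta <= p} <-> {ae mu, forall eta, 0 <= (p - g eta)}.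
  by split; apply: filterS => eta; rewrite subr_ge0.
rewrite ae_ge0_Rintegral//; first last.
- rewrite (_ : _ \o _ = cst p%:E \- (EFin \o g))%E//.
  by apply: integrableB => //; exact: finite_measure_integrable_cst.
- exact: measurable_funB.
have occ_prE E : measurable (E : set (past_field Q)) ->
    (0 <= \int[mu]_(eta in E) (p - g eta)) = (pr mu (occ 0 `&` E) <= p * pr mu E).
  move=> mE; have mE' := past_field_measurable mE.
  rewrite RintegralB//; last exact: integrableS ig.
    by rewrite subr_ge0 Rintegral_cst// /Rintegral gE.
  exact: finite_measure_integrable_cst.
by split=> h E mE; [rewrite -occ_prE//; exact: h|rewrite occ_prE//; exact: h].
Qed.

(** The identity, seen as a measurable map to the coarser space: pushing forward along it restricts
    a measure to the past. *)
Definition to_past (eta : config d) : past_field Q := eta.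

Lemma measurable_to_past : measurable_fun setT to_past.
Proof. by move=> _ Y mY; rewrite setTI; exact: past_field_measurable mY. Qed.

HB.instance Definition _ :=
  isMeasurableFun.Build _ _ _ _ to_past measurable_to_past.

(** The measure sending a past event [E] to the probability of [E] together with a one at the
    origin. Its density with respect to the restriction of [mu] is the conditional probability. *)
Definition occupied_past : set (past_field Q) -> \bar R :=
  pushforward (mrestr mu (@measurable_occT d 0)) to_past.

Let occupied_past0 : occupied_past set0 = 0%E.
Proof. by rewrite /occupied_past /pushforward preimage_set0 measure0. Qed.

Let occupied_past_ge0 E : (0 <= occupied_past E)%E.
Proof. exact: (measure_ge0 (mrestr mu (@measurable_occT d 0))). Qed.

Let occupied_past_sigma_additive : semi_sigma_additive occupied_past.
Proof.
move=> F mF tF mUF.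
exact: (@measure_semi_sigma_additive _ _ _ (mrestr mu (@measurable_occT d 0)) F
  (fun i => past_field_measurable (mF i)) tF (past_field_measurable mUF)).
Qed.

HB.instance Definition _ := isMeasure.Build _ _ _ occupied_past
  occupied_past0 occupied_past_ge0 occupied_past_sigma_additive.

Let occupied_past_fin : fin_num_fun occupied_past.
Proof.
move=> A mA; rewrite /occupied_past /pushforward /mrestr fin_num_measure//.
by apply: measurableI; [exact: past_field_measurable mA|exact: measurable_occT].
Qed.

HB.instance Definition _ :=
  Measure_isFinite.Build _ _ _ occupied_past occupied_past_fin.

(** Radon-Nikodym on the past. Strong domination asks for some version of the conditional
    probability, so one must be produced before inequalities on past events can imply it. *)
Lemma cond_prob_exists : exists g, is_cond_prob mu Q (@occupied0 d) g.
Proof.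
pose P := distribution mu to_past.
have dom : occupied_past `<< P.
  apply/null_content_dominatesP => A mA PA0.
  apply/eqP; rewrite eq_le measure_ge0 andbT -PA0.
  rewrite /occupied_past /P /distribution /pushforward /mrestr le_measure ?inE//.
    by apply: measurableI; [exact: past_field_measurable mA|exact: measurable_occT].
  exact: past_field_measurable mA.
have [f [f0 ffin intf nuE]] := radon_nikodym_sigma_finite dom.
have mf : measurable_fun setT f := measurable_int _ intf.
have fE x : f x = (fine (f x))%:E by rewrite fineK.
have intfX : mu.-integrable setT (f \o to_past).
  apply/integrableP; split; first by apply: measurableT_comp.
  move/integrableP : intf => [_]; rewrite /P ge0_integral_distribution//.
  by apply: measurableT_comp.
exists (fine \o f); split.
- by apply: measurableT_comp.
- by apply: eq_integrable intfX => // x _ /=; rewrite fineK.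
- move=> B mB; rewrite setIC.
  transitivity (occupied_past B); last by [].
  rewrite nuE//.
  rewrite /P /distribution integral_pushforward//.
    by apply: eq_integral => x _ /=; rewrite fineK.
  by apply: integrableS intfX => //; exact: past_field_measurable mB.
Qed.

End conditional_probability.

Section strong_domination.
Variables (R : realType) (d : nat) (mu : probability (config d) R).
Variables (Pi : set (lattice d)) (p : R).

Lemma strong_dom_geP : strong_dom_ge Pi p mu <->
  (forall E, measurable (E : set (past_field (past0 Pi))) ->
     p * pr mu E <= pr mu (occ 0 `&` E)).
Proof.
split; first by move=> [g hg]; rewrite (cond_prob_bound_ge _ hg).
have [g hg] := cond_prob_exists mu (past0 Pi).
by rewrite -(cond_prob_bound_ge _ hg); exists g.
Qed.

Lemma strong_dom_leP : strong_dom_le Pi mu p <->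
  (forall E, measurable (E : set (past_field (past0 Pi))) ->
     pr mu (occ 0 `&` E) <= p * pr mu E).
Proof.
split; first by move=> [g hg]; rewrite (cond_prob_bound_le _ hg).
have [g hg] := cond_prob_exists mu (past0 Pi).
by rewrite -(cond_prob_bound_le _ hg); exists g.
Qed.

End strong_domination.

(** * Orderings of the lattice *)

Section ordering.
Variables (d : nat) (Pi : set (lattice d)).
Hypothesis hPi : is_ordering Pi.
Local Notation Q := (past0 Pi).

Lemma past_neq0 : ~ Q 0.
Proof.
have [cupPi capPi _] := hPi => -[k Pik k0].
have : (Pi `|` -%R @` Pi) k by left.
by rewrite cupPi; apply; apply: oppr_inj; rewrite k0 oppr0.
Qed.

Lemma pastD k l : Q k -> Q l -> Q (k + l).
Proof.
have [_ _ addPi] := hPi => -[x Px <-] [y Py <-].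
by exists (x + y); [exact: addPi|rewrite opprD].
Qed.

Lemma past_total k : k != 0 -> Q k \/ Q (- k).
Proof.
have [cupPi _ _] := hPi => /eqP k0.
have : (Pi `|` -%R @` Pi) k by rewrite cupPi.
by case=> [Pk|Qk]; [right; exists k|left].
Qed.

Lemma past_asym k : Q k -> ~ Q (- k).
Proof. by move=> Qk QNk; apply: past_neq0; rewrite -(subrr k); exact: pastD. Qed.

Definition before : rel (lattice d) := fun k l => `[< Q (k - l) >].

Lemma before_total_sort (s : seq (lattice d)) : uniq s ->
  exists2 t, perm_eq t s & pairwise before t.
Proof.
move=> us; pose le k l := (k == l) || before k l.
have le_total : total le.
  move=> k l; rewrite /le; have [//|kl /=] := eqVneq k l.
  have /past_total[Qkl|Qlk] : k - l != 0 by rewrite subr_eq0.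
    by rewrite /before (asboolT Qkl).
  by apply/orP; right; apply/asboolP; rewrite -[l - k]opprB.
have le_trans : transitive le.
  move=> k j l; rewrite /le => /predU1P[->//|/asboolP jk] /predU1P[<-|/asboolP kl].
    by apply/orP; right; apply/asboolP.
  apply/orP; right; apply/asboolP;
  rewrite (_ : j - l = (j - k) + (k - l)); last by rewrite addrA subrK.
  exact: pastD.
exists (sort le s); first by rewrite perm_sort.
have : pairwise le (sort le s) by rewrite -sorted_pairwise// sort_sorted.
have : uniq (sort le s) by rewrite sort_uniq.
elim: (sort le s) => //= x t IH /andP[xt ut] /andP[/allP lext pt].
rewrite IH// andbT; apply/allP => y yt; have := lext y yt.
by rewrite /le => /predU1P[xy|//]; rewrite xy yt in xt.
Qed.

End ordering.

(** * Resampling finitely many sites *)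

Section finite_dimensional.
Variables (R : realType) (d : nat) (p : R).
Implicit Types (E F : set (config d)) (w : config d) (r : seq (lattice d)).

(* The expected value of [phi] after resampling the sites in [r] independently
   with density [p]. *)
Fixpoint resample (r : seq (lattice d)) (phi : config d -> R) w : R :=
  if r is x :: r' then
    p * resample r' phi (upd x true w) + (1 - p) * resample r' phi (upd x false w)
  else phi w.

Lemma resample_mono r E w w' : 0 <= p <= 1 -> increasing_event E ->
  (forall k, w k -> w' k) ->
  resample r (\1_E : config d -> R) w <= resample r (\1_E : config d -> R) w'.
Proof.
move=> /andP[p0 p1] iE; elim: r w w' => [|x r IH] w w' ww' /=.
  rewrite !indicE; have [/set_mem Ew|_] := boolP (w \in E); last by rewrite ler0n.
  by rewrite (mem_set (iE _ _ ww' Ew)).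
have uu b k : upd x b w k -> upd x b w' k.
  by rewrite /upd; case: eqP => // _; exact: ww'.
by apply: lerD; rewrite ler_wpM2l ?subr_ge0//; apply: IH; exact: uu.
Qed.

Lemma cyl_upd_true x A B w : x \notin A ++ B -> cyl A B w ->
  cyl (x :: A) B (upd x true w).
Proof.
rewrite mem_cat negb_or => /andP[xA xB] /andP[/allP wA /allP wB].
apply/andP; split; apply/allP => k.
  by rewrite inE /upd => /predU1P[->|kA]; rewrite ?eqxx//; case: eqP => // _; exact: wA.
by move=> kB; rewrite /upd; case: eqP => [kx|_]; [rewrite -kx kB in xB|exact: wB].
Qed.

Lemma cyl_upd_false x A B w : x \notin A ++ B -> cyl A B w ->
  cyl A (x :: B) (upd x false w).
Proof.
rewrite mem_cat negb_or => /andP[xA xB] /andP[/allP wA /allP wB].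
apply/andP; split; apply/allP => k.
  by move=> kA; rewrite /upd; case: eqP => [kx|_]; [rewrite -kx kA in xA|exact: wA].
by rewrite inE /upd => /predU1P[->|kB]; rewrite ?eqxx//; case: eqP => // _; exact: wB.
Qed.

Lemma cyl_determined A B E w : determined_by (A ++ B) E -> cyl A B w ->
  cyl A B `&` E = if w \in E then cyl A B else set0.
Proof.
move=> dE ABw.
have agree zeta : cyl A B zeta -> {in A ++ B, w =1 zeta}.
  move: ABw => /andP[/allP wA /allP wB] /andP[/allP zA /allP zB] k.
  rewrite mem_cat => /orP[kA|kB]; first by rewrite wA// zA.
  by rewrite (negbTE (wB _ kB)) (negbTE (zB _ kB)).
case: ifPn => [/set_mem Ew|/negP nEw].
  by apply/setIidl => zeta ABz; apply: dE Ew; exact: agree.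
rewrite -subset0 => zeta [ABz Ez]; apply: nEw; apply/mem_set; apply: dE Ez => k ks.
by rewrite -(agree _ ABz).
Qed.

Section step.
Variables (mu : probability (config d) R) (A B : seq (lattice d)).
Variables (x : lattice d) (E : set (config d)).

Lemma pr_cylI_split : measurable E ->
  pr mu (cyl A B `&` E) = pr mu (cyl (x :: A) B `&` E) + pr mu (cyl A (x :: B) `&` E).
Proof.
move=> mE; rewrite (@pr_split _ _ _ _ (occ x)).
- by rewrite cyl_consl cyl_consr !setDE !(setIAC _ E).
- by apply: measurableI => //; exact: measurable_cyl.
- exact: measurable_occT.
Qed.

End step.

Lemma pr_cyl_resample (mu : probability (config d) R) r A B E w :
  (forall x A B, uniq (x :: A ++ B) ->
     pr mu (cyl (x :: A) B) = p * pr mu (cyl A B)) ->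
  uniq (r ++ A ++ B) -> determined_by (r ++ A ++ B) E -> cyl A B w ->
  pr mu (cyl A B `&` E) = pr mu (cyl A B) * resample r (\1_E : config d -> R) w.
Proof.
move=> hmu; elim: r A B w => [|x r IH] A B w uAB dE ABw.
  rewrite (@cyl_determined A B _ _ dE ABw) /= indicE; case: ifP => _; first by rewrite mulr1.
  by rewrite pr0 mulr0.
have mE : measurable E.
  by apply: past_field_measurable; apply: determined_by_measurable dE.
have p1 := perm_insertl x r A B; have p2 := perm_insertr x r A B.
have [xAB xr] : x \notin A ++ B /\ x \notin r.
  by move: uAB => /= /andP[]; rewrite mem_cat negb_or => /andP[].
rewrite (pr_cylI_split _ _ _ x mE) /=.
rewrite (IH (x :: A) B (upd x true w)); first last.
- exact: cyl_upd_true.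
- by move=> eta zeta ez; apply: dE => k; rewrite (perm_mem p1); exact: ez.
- by rewrite -(perm_uniq p1).
rewrite (IH A (x :: B) (upd x false w)); first last.
- exact: cyl_upd_false.
- by move=> eta zeta ez; apply: dE => k; rewrite (perm_mem p2); exact: ez.
- by rewrite -(perm_uniq p2).
have := pr_cyl_split mu A B x; rewrite hmu; last first.
  by move: uAB => /= /andP[_]; rewrite cat_uniq xAB => /and3P[].
by move=> h; rewrite (_ : pr mu (cyl A (x :: B)) = (1 - p) * pr mu (cyl A B)); [ring|lra].
Qed.

(** Sites are revealed in increasing order, so those already fixed in [A ++ B] all precede the next
    one and the hypothesis on [mu] applies to it. Monotonicity of [E] makes a larger chance of a one
    favourable. *)
Lemma pr_cyl_resample_ge (lt : rel (lattice d)) (mu : probability (config d) R) r A B E w :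
  0 <= p <= 1 -> increasing_event E ->
  (forall x A B, uniq (x :: A ++ B) -> all (lt^~ x) (A ++ B) ->
     p * pr mu (cyl A B) <= pr mu (cyl (x :: A) B)) ->
  uniq (r ++ A ++ B) -> allrel lt (A ++ B) r -> pairwise lt r ->
  determined_by (r ++ A ++ B) E -> cyl A B w ->
  pr mu (cyl A B) * resample r (\1_E : config d -> R) w <= pr mu (cyl A B `&` E).
Proof.
move=> p01 iE hmu; elim: r A B w => [|x r IH] A B w uAB ltAB ltr dE ABw.
  rewrite (@cyl_determined A B _ _ dE ABw) /= indicE; case: ifP => _; first by rewrite mulr1.
  by rewrite pr0 mulr0.
have mE : measurable E.
  by apply: past_field_measurable; apply: determined_by_measurable dE.
have p1 := perm_insertl x r A B; have p2 := perm_insertr x r A B.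
have [xAB xr] : x \notin A ++ B /\ x \notin r.
  by move: uAB => /= /andP[]; rewrite mem_cat negb_or => /andP[].
move: ltr; rewrite pairwise_cons => /andP[ltxr ltr].
move: ltAB; rewrite allrel_consr => /andP[ltABx ltAB].
rewrite (pr_cylI_split _ _ _ x mE) /=.
have h1 : pr mu (cyl (x :: A) B) * resample r (\1_E : config d -> R) (upd x true w)
    <= pr mu (cyl (x :: A) B `&` E).
  apply: IH => //.
  - by rewrite -(perm_uniq p1).
  - by rewrite /= allrel_consl ltAB andbT.
  - by move=> eta zeta ez; apply: dE => k; rewrite (perm_mem p1); exact: ez.
  - exact: cyl_upd_true.
have h2 : pr mu (cyl A (x :: B)) * resample r (\1_E : config d -> R) (upd x false w)
    <= pr mu (cyl A (x :: B) `&` E).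
  apply: IH => //.
  - by rewrite -(perm_uniq p2).
  - by move: ltAB; rewrite !allrel_catl allrel_consl ltxr.
  - by move=> eta zeta ez; apply: dE => k; rewrite (perm_mem p2); exact: ez.
  - exact: cyl_upd_false.
have h3 : resample r (\1_E : config d -> R) (upd x false w)
    <= resample r (\1_E : config d -> R) (upd x true w).
  by apply: resample_mono => // k; rewrite /upd; case: eqP.
have uxAB : uniq (x :: A ++ B).
  by move: uAB => /= /andP[_]; rewrite cat_uniq xAB => /and3P[].
have := hmu x A B uxAB ltABx.
have := pr_cyl_split mu A B x.
move: h1 h2 h3; move: (pr _ (cyl A B)) (pr _ (cyl (x :: A) B)) (pr _ (cyl A (x :: B)))
  (pr _ (cyl (x :: A) B `&` E)) (pr _ (cyl A (x :: B) `&` E))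
  (resample r _ (upd x true w)) (resample r _ (upd x false w)).
move=> c c1 c0 e1 e0 a1 a0 h1 h2 h3 ec hc.
apply: le_trans (lerD h1 h2).
(* As [c = c1 + c0], this product is exactly [c1 * a1 + c0 * a0 - c * (p * a1 + (1 - p) * a0)]. *)
have : 0 <= (c1 - p * c) * (a1 - a0) by rewrite mulr_ge0 ?subr_ge0.
nra.
Qed.

End finite_dimensional.

(** * Upward closures of events *)

Section increasing_closure.
Variable d : nat.
Implicit Types (E F : set (config d)) (s : seq (lattice d)).

Definition up F : set (config d) :=
  [set delta : config d | exists2 eta : config d, F eta & forall k, eta k -> delta k].

Lemma up_increasing F : increasing_event (up F).
Proof. by move=> eta delta ed [z Fz ze]; exists z => // k /ze/ed. Qed.

Lemma sub_up F : F `<=` up F.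
Proof. by move=> eta Fe; exists eta. Qed.

Lemma up_sub F E : increasing_event E -> F `<=` E -> up F `<=` E.
Proof. by move=> iE FE delta [eta /FE Ee ed]; exact: iE ed Ee. Qed.

Lemma up_mono F E : F `<=` E -> up F `<=` up E.
Proof. by move=> FE delta [eta /FE Ee ed]; exists eta. Qed.

Lemma up_local Q F : local Q F -> local Q (up F).
Proof.
move=> [s sQ dF]; exists s => // delta delta' dd [eta Fe ed].
(* Erasing the ones of [eta] outside [s] keeps it in [F] and leaves only sites where [delta] and
   [delta'] agree to be compared. *)
exists (fun k => (k \in s) && eta k); last first.
  by move=> k /andP[ks]; rewrite -dd//; exact: ed.
by apply: dF Fe => k ks; rewrite ks.
Qed.

(* Compactness of the configuration space, through an ultrafilter limit. *)
Lemma up_bigcap Q (F : nat -> set (config d)) :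
  (forall n, local Q (F n)) -> (forall n, F n.+1 `<=` F n) ->
  \bigcap_n up (F n) `<=` up (\bigcap_n F n).
Proof.
move=> lF dF delta hd.
have /choice[eta heta] : forall n, exists eta : config d, F n eta /\ forall k, eta k -> delta k.
  by move=> n; have [z ? ?] := hd n I; exists z.
have [U [UU subU]] := ultraFilterLemma (@eventually_filter).
have FU : ProperFilter U := ultra_proper.
have FU' : Filter U by exact: filter_filter.
have dF' : {homo F : i j / (i <= j)%N >-> j `<=` i}.
  apply: (homo_leq (r := fun A B => B `<=` A)) => [?|? ? ? h1 h2|i];
    [exact: subset_refl|exact: subset_trans h2 h1|exact: dF].
(* The limit of [eta n] along [U], coordinate by coordinate. On any finite set of sites, [eta n]
   equals [z] for [U]-many [n], which suffices for local events. *)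
pose z : config d := fun k => `[< U [set n | eta n k] >].
have zE s : U [set n | {in s, eta n =1 z}].
  elim: s => [|k s IH]; first by apply: filterS filterT => n _ k; rewrite in_nil.
  have zk : U [set n | eta n k = z k].
    have [h|h] := in_ultra_setVsetC [set n | eta n k] UU.
      by apply: (filterS _ h) => n /=; rewrite /z (asboolT h).
    have nz : z k = false.
      apply/negbTE/negP => /asboolP h'.
      by have /filter_ex[n []] := @filterI _ U FU' _ _ h h'.
    by rewrite nz; apply: filterS h => n /negP/negbTE.
  apply: filterS (@filterI _ U FU' _ _ zk IH) => n [/= zn ns] j.
  by rewrite inE => /predU1P[->|/ns].
exists z.
  move=> n _; have [s sQ dFn] := lF n.
  have gen : U [set m | (n <= m)%N] by apply: subU; exists n.
  have /filter_ex[m [/= nm ms]] := @filterI _ U FU' _ _ gen (zE s).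
  by apply: dFn ms _; apply: dF' nm _ _; exact: (heta m).1.
move=> k /asboolP /filter_ex[n /= ek].
exact: (heta n).2.
Qed.

End increasing_closure.

Section product_measure.
Variables (R : realType) (d : nat) (p : R) (mup : probability (config d) R).
Hypothesis hmup : is_product_measure p mup.

Lemma pr_cyl_product (A B : seq (lattice d)) : uniq (A ++ B) ->
  pr mup (cyl A B) = p ^+ size A * (1 - p) ^+ size B.
Proof.
move=> u; pose e := tnth (in_tuple (A ++ B)).
have ei : injective e by apply/tuple_uniqP.
have := hmup (fun i => e i \in A) ei.
rewrite (_ : [set eta | _] = cyl A B); last first.
  apply/seteqP; split => eta /=.
    move=> h; have h' k : k \in A ++ B -> eta k = (k \in A).
      by move=> kAB; have /tnthP[i ->] : k \in in_tuple (A ++ B) by []; exact: h.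
    apply/andP; split; apply/allP => k kA; rewrite h' ?mem_cat ?kA ?orbT//.
    apply/negP => kA'; move: u; rewrite cat_uniq => /and3P[_ /hasP h'' _].
    by apply: h''; exists k.
  move=> /andP[/allP hA /allP hB] i; case: (boolP (e i \in A)) => [/hA->//|nA].
  have : e i \in A ++ B by exact: mem_tnth.
  by rewrite mem_cat (negbTE nA) /= => /hB/negbTE.
rewrite /pr /e => -> /=.
rewrite -(big_tnth _ _ (A ++ B) xpredT (fun k => if k \in A then p else 1 - p)).
rewrite big_cat /= big_seq (eq_bigr (fun=> p)); last by move=> k ->.
rewrite -big_seq big_const_seq count_predT iter_mulr_1; congr (_ * _).
rewrite big_seq (eq_bigr (fun=> 1 - p)); last first.
  move=> k kB; rewrite ifF//; apply/negP => kA.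
  by move: u; rewrite cat_uniq => /and3P[_ /hasP h _]; apply: h; exists k.
by rewrite -big_seq big_const_seq count_predT iter_mulr_1.
Qed.

Lemma pr_cyl_product_cons x (A B : seq (lattice d)) : uniq (x :: A ++ B) ->
  pr mup (cyl (x :: A) B) = p * pr mup (cyl A B).
Proof.
by move=> u; rewrite !pr_cyl_product ?exprS ?mulrA//; move: u => /andP[].
Qed.

End product_measure.

(** * From the cylinder bound to stochastic domination *)

Section strong_domination_dominates.
Variables (R : realType) (d : nat) (Pi : set (lattice d)) (p : R).
Hypothesis hPi : is_ordering Pi.
Hypothesis p01 : 0 <= p <= 1.
Variables (mu mup : probability (config d) R).
Hypothesis hmup : is_product_measure p mup.
Local Notation Q := (past0 Pi).

Lemma strong_dom_cyl_bound : strong_dom_ge Pi p mu -> cyl_bound Q mu p.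
Proof.
move=> /strong_dom_geP h A B _ QAB.
by rewrite cyl_consl setIC; apply: h; apply: local_measurable; exact: local_cyl.
Qed.

Lemma cyl_bound_shift x A B : cyl_stationary mu -> cyl_bound Q mu p ->
  uniq (A ++ B) -> (forall k, k \in A ++ B -> Q (k - x)) ->
  p * pr mu (cyl A B) <= pr mu (cyl (x :: A) B).
Proof.
move=> st cb u QAB; rewrite -(st (- x) A B) -(st (- x) (x :: A) B) /= subrr.
have ishift : injective (+%R^~ (- x) : lattice d -> lattice d) by exact: addIr.
apply: cb; rewrite -map_cat; first by rewrite map_inj_uniq.
by move=> k /mapP[j /QAB Qj ->].
Qed.

Lemma cyl_bound_dom_local E : cyl_stationary mu -> cyl_bound Q mu p ->
  local setT E -> increasing_event E -> pr mup E <= pr mu E.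
Proof.
move=> st cb [s _ dE] iE.
have [t ts lt] := before_total_sort hPi (undup_uniq s).
have ut : uniq (t ++ [::] ++ [::] : seq (lattice d)).
  by rewrite !cats0 (perm_uniq ts) undup_uniq.
have dE' : determined_by (t ++ [::] ++ [::]) E.
  by move=> eta zeta ez; apply: dE => k ks; apply: ez; rewrite !cats0 (perm_mem ts) mem_undup.
(* Any configuration would do: all the sites that determine [E] are resampled. *)
have w : config d := fun=> true.
have wT : cyl [::] [::] w by [].
have := pr_cyl_resample (pr_cyl_product_cons hmup) ut dE' wT.
rewrite pr_cyl_nil mul1r cyl_nil setTI => ->.
suff : pr mu (cyl [::] [::]) * resample p t (\1_E : config d -> R) w
    <= pr mu (cyl [::] [::] `&` E).
  by rewrite pr_cyl_nil mul1r cyl_nil setTI.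
apply: pr_cyl_resample_ge lt dE' wT => //.
move=> x A B /= /andP[_ uAB] /allP ltx; apply: cyl_bound_shift => // k kAB.
exact/asboolP/ltx.
Qed.

(** The inner approximation is taken for [mup]. The sets [up (F n)] are local and increasing, so the
    local case compares them, and by compactness their intersection lies in the upward closure of
    the intersection of the [F n], hence in [E]. *)
Lemma cyl_bound_dom : cyl_stationary mu -> cyl_bound Q mu p -> stoch_dom mup mu.
Proof.
move=> st cb E mE iE; rewrite !prE// lee_fin; apply/ler_addgt0Pr => e e0.
have [F [G [[lF lG] [dF iG] [FE EG] le]]] := regular_past mup mE e0.
have mF n := past_field_measurable (local_measurable (lF n)).
have mG n := past_field_measurable (local_measurable (lG n)).
have lU n := up_local (lF n).
have mU n := past_field_measurable (local_measurable (lU n)).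
have mFF : measurable (\bigcap_n F n) by exact: bigcapT_measurable.
have mGG : measurable (\bigcup_n G n) by exact: bigcup_measurable.
have mUU : measurable (\bigcap_n up (F n)) by exact: bigcapT_measurable.
have hU : pr mup (\bigcap_n F n) <= pr mu (\bigcap_n up (F n)).
  have cvgU : (mu \o (fun n => up (F n))) x @[x --> \oo] --> mu (\bigcap_n up (F n)).
    apply: nonincreasing_cvg_mu => //.
      by rewrite (le_lt_trans (probability_le1 _ _)) ?ltry.
    by apply/nonincreasing_seqP => n; apply/subsetPset; apply: up_mono.
  rewrite -lee_fin -!prE// -(cvg_lim _ cvgU)//.
  apply: lime_ge; first exact: cvgP cvgU.
  apply: nearW => n /=; rewrite !prE// lee_fin.
  apply: le_trans (cyl_bound_dom_local st cb (lU n) (@up_increasing _ _)).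
  by apply: le_pr => // eta h; apply: sub_up; exact: h.
have UE : \bigcap_n up (F n) `<=` E.
  by apply: subset_trans (up_bigcap lF dF) _; exact: up_sub.
rewrite (pr_split mup mE mFF) lerD//.
  apply: le_trans (le_pr mu mUU mE UE); apply: le_trans hU.
  by apply: le_pr => //; exact: measurableI.
rewrite -lee_fin -prE; last exact: measurableD.
apply: le_trans le; rewrite le_measure// ?inE; [exact: measurableD|exact: measurableD|].
exact: setSD.
Qed.

End strong_domination_dominates.

(** * Counting in boxes *)

Section boxes.
Variable d : nat.
Implicit Types (n r : nat).

Definition box_site n (f : {ffun 'I_d -> 'I_n}) : lattice d :=
  \row_i (f i : nat)%:Z.

Definition box n : seq (lattice d) := [seq box_site f | f <- enum {ffun 'I_d -> 'I_n}].

Lemma box_site_inj n : injective (@box_site n).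
Proof.
move=> f g /rowP fg; apply/ffunP => i; apply/val_inj/eqP.
by have /eqP := fg i; rewrite !mxE.
Qed.

Lemma box_uniq n : uniq (box n).
Proof. by rewrite map_inj_uniq ?enum_uniq//; exact: box_site_inj. Qed.

Lemma size_box n : size (box n) = (n ^ d)%N.
Proof. by rewrite size_map -cardT card_ffun !card_ord. Qed.

Lemma mem_box n (k : lattice d) :
  (k \in box n) = [forall i, (0 <= k ord0 i) && (k ord0 i < n%:Z)].
Proof.
apply/idP/idP => [/mapP[f _ ->]|/forallP h].
  by apply/forallP => i; rewrite mxE ltz_nat ltn_ord.
have h' i : (`|k ord0 i| < n)%N by have /andP[] := h i; lia.
apply/mapP; exists [ffun i => Ordinal (h' i)]; first by rewrite mem_enum.
by apply/rowP => i; rewrite mxE ffunE /= gez0_abs; [rewrite [ord0]ord1|case/andP: (h i)].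
Qed.

(** With [rad] the largest absolute value of a coordinate in [A], the box of side [n] moved by [rad]
    in every direction keeps a margin [rad] on both sides inside the larger box; hence [r] is twice
    [rad]. *)
Lemma box_count (A : seq (lattice d)) :
  exists r, forall n,
    (n ^ d <= count (fun e : lattice d => all (fun a : lattice d => (a + e)%R \in box (n + r)) A)
    (box (n + r)))%N.
Proof.
pose rad := (\max_(a <- A) \max_(i < d) `|a ord0 i|)%N.
have hrad a i : a \in A -> (`|a ord0 i| <= rad)%N.
  move=> aA; apply: leq_trans (@leq_bigmax_seq _ A xpredT
    (fun a : lattice d => \max_(i < d) `|a ord0 i|)%N a aA isT).
  exact: (@leq_bigmax _ (fun i => `|a ord0 i|%N) i).
exists (rad + rad)%N => n; rewrite -size_filter -size_box.
pose sh (k : lattice d) : lattice d := \row_i (k ord0 i + rad%:Z).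
have shi : injective sh.
  by move=> k l /rowP h; apply/rowP => i; have := h i; rewrite !mxE => /addIr.
rewrite -(size_map sh); apply: uniq_leq_size; first by rewrite map_inj_uniq ?box_uniq.
move=> _ /mapP[k kn ->]; rewrite mem_filter.
move: kn; rewrite mem_box => /forallP kn; apply/andP; split; last first.
  by rewrite mem_box; apply/forallP => i; have := kn i; rewrite mxE; lia.
apply/allP => a aA; rewrite mem_box; apply/forallP => i; have := kn i.
have := hrad a i aA; rewrite !mxE => h1 /andP[h2 h3]; apply/andP; split; move: h1 h2 h3;
  by move: (a ord0 i) (k ord0 i) => x y; clearbody rad; lia.
Qed.

End boxes.

Section bernoulli.
Variable R : realType.

Lemma bernoulli_sub (u : R) n : 0 <= u <= 1 -> 1 - n%:R * u <= (1 - u) ^+ n.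
Proof.
move=> /andP[u0 u1]; elim: n => [|n IH]; first by rewrite mul0r subr0 expr0.
rewrite exprS -natr1; have n0 : 0 <= n%:R * (u * u) :> R by rewrite !mulr_ge0.
have : (1 - u) * (1 - n%:R * u) <= (1 - u) * (1 - u) ^+ n by rewrite ler_wpM2l ?subr_ge0.
nra.
Qed.

(** The two exponents are asymptotically equal, since a boundary layer of width [r] is negligible in
    a large box; the comparison is made on logarithms. *)
Lemma pow_ratio_le (p c : R) (d r : nat) : 0 < p <= 1 -> 0 <= c -> c <= 1 ->
  (forall n, p ^+ ((n + r) ^ d) <= c ^+ (n ^ d)) -> p <= c.
Proof.
move=> /andP[p0 p1] c0 c1 h; have [cE|cN0] := eqVneq c 0.
  have := h 1%N; rewrite exp1n cE expr1 => h1.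
  by have := exprn_gt0 ((1 + r) ^ d) p0; rewrite ltNge h1.
have cgt0 : 0 < c by rewrite lt_def cN0.
have [//|cp] := leP p c; exfalso.
pose x := - ln p; pose y := - ln c.
have x0 : 0 <= x by rewrite /x oppr_ge0 ln_le0.
have xy : x < y by rewrite ltrN2 ltr_ln ?posrE.
have hxy n : (n ^ d)%:R * y <= ((n + r) ^ d)%:R * x.
  have := h n; rewrite -ler_ln ?posrE ?exprn_gt0// !lnXn//.
  by rewrite /x /y !mulrN lerN2 !mulr_natl.
have y0 : 0 < y by exact: le_lt_trans xy.
(* Take [n = (r + 1) * t], so that [n + r <= (r + 1) * (t + 1)]. The powers of [r + 1] cancel, and
   Bernoulli's inequality bounds [(t / (t + 1)) ^ d] from below. *)
have ht t : y * (1 - d%:R * t.+1%:R^-1) <= x.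
  have := hxy (r.+1 * t)%N.
  have le1 : ((r.+1 * t + r) ^ d)%:R * x <= ((r.+1 * t.+1) ^ d)%:R * x :> R.
    rewrite ler_wpM2r// ler_nat; case: (posnP d) => [->|d0]; first by rewrite !expn0.
    by rewrite leq_exp2r//; lia.
  move=> /le_trans /(_ le1); rewrite !expnMn !natrM -!mulrA ler_pM2l; last first.
    by rewrite ltr0n expn_gt0.
  move=> le2; have b := @bernoulli_sub (t.+1%:R^-1) d.
  have tt : 1 - t.+1%:R^-1 = t%:R / t.+1%:R :> R.
    by rewrite (_ : t%:R = t.+1%:R - 1) ?mulrBl ?divff ?mul1r// -natr1 addrK.
  have t0 : 0 < (t.+1 ^ d)%:R :> R by rewrite ltr0n expn_gt0.
  rewrite -(ler_pM2l t0); apply: le_trans le2; rewrite mulrCA [leRHS]mulrC ler_pM2l//.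
  have /b : 0 <= (t.+1%:R^-1 : R) <= 1 by rewrite invr_ge0 ler0n/= invf_le1 ?ler1n.
  move=> b'; apply: le_trans (ler_wpM2l (ltW t0) b') _.
  by rewrite tt expr_div_n !natrX mulrCA divff ?mulr1// expf_neq0.
(* Using [d + 1] keeps the denominator positive even for [d = 0]. The resulting [t] makes
   [y * d / (t + 1)] smaller than [y - x], against [ht]. *)
have := @ltr_add_invr R 0 ((y - x) / (y * d.+1%:R)).
case; first by rewrite divr_gt0 ?subr_gt0// mulr_gt0.
move=> t; rewrite add0r ltr_pdivlMr ?mulr_gt0//.
have := ht t; rewrite -[d.+1%:R]natr1.
have t0 : 0 < t.+1%:R^-1 :> R by rewrite invr_gt0.
have := mulr_gt0 t0 y0; move: (t.+1%:R^-1 : R) (d%:R : R) => u v; nra.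
Qed.

End bernoulli.

(** * From stochastic domination to the bound on ones *)

Section domination_key.
Variables (R : realType) (d : nat) (Pi : set (lattice d)) (p : R).
Hypothesis hPi : is_ordering Pi.
Hypothesis p01 : 0 <= p <= 1.
Variables (mu mup : probability (config d) R).
Hypothesis hmup : is_product_measure p mup.
Hypotheses (st : cyl_stationary mu) (nc : neg_corr mu).
Local Notation Q := (past0 Pi).

Lemma stoch_dom_ones (S : seq (lattice d)) : stoch_dom mup mu -> uniq S ->
  p ^+ size S <= pr mu (cyl S [::]).
Proof.
move=> dom uS; have mS := measurable_cyl S [::].
have := dom _ mS; rewrite !prE// lee_fin (pr_cyl_product hmup) ?cats0//.
rewrite expr0 mulr1; apply=> eta delta ed /andP[/allP h _].
by apply/andP; split => //; apply/allP => k /h /ed.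
Qed.

(** Conditioning on additional ones lowers the chance of a one at [x]. The sites of [T] are added
    singly by [nc], and positivity allows the intermediate factor to be cancelled. *)
Lemma ones_ratio_mono x (T S : seq (lattice d)) :
  (forall S', uniq S' -> 0 < pr mu (cyl S' [::])) -> uniq (x :: T ++ S) ->
  pr mu (cyl (x :: T ++ S) [::]) * pr mu (cyl S [::])
  <= pr mu (cyl (x :: S) [::]) * pr mu (cyl (T ++ S) [::]).
Proof.
move=> pos; elim: T => [|b T IH] uTS; first by rewrite mulrC.
have u1 : uniq (x :: T ++ S).
  by move: uTS; rewrite /= inE negb_or => /andP[/andP[_ ->] /andP[_ ->]].
have := @nc x b (T ++ S) [::]; rewrite cats0 => /(_ uTS) h1; have {IH}h2 := IH u1.
have p1 := pos (T ++ S) _; have {p1}p1 : 0 < pr mu (cyl (T ++ S) [::]).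
  by apply: p1; move: u1 => /andP[].
have u2 : uniq S by move: u1; rewrite /= cat_uniq => /andP[_ /and3P[]].
have := pos S u2; have := pr_ge0 mu (cyl ((b :: T) ++ S) [::]).
rewrite /= in h1 h2 *; move: p1 h1 h2.
move: (pr _ (cyl [:: x, b & T ++ S] _)) (pr _ (cyl (T ++ S) _)) (pr _ (cyl (x :: T ++ S) _))
  (pr _ (cyl (b :: T ++ S) _)) (pr _ (cyl S _)) (pr _ (cyl (x :: S) _)).
move=> a t xt bt s xs t0 h1 h2 bt0 s0.
rewrite -(ler_pM2l t0).
have := ler_wpM2r (ltW s0) h1; have := ler_wpM2l bt0 h2; nra.
Qed.

Lemma dom_ones_bound : stoch_dom mup mu -> ones_bound Q mu p.
Proof.
move=> dom A uA QA.
have [p0 p1] := andP p01.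
have [pE|pN0] := eqVneq p 0; first by rewrite pE mul0r pr_ge0.
have pgt0 : 0 < p by rewrite lt_def pN0.
have pos S : uniq S -> 0 < pr mu (cyl S [::]).
  by move=> uS; apply: lt_le_trans (stoch_dom_ones dom uS); rewrite exprn_gt0.
have u0A : uniq (0 :: A) by rewrite /= uA andbT; apply/negP => /QA; exact: past_neq0.
pose c := pr mu (cyl (0 :: A) [::]) / pr mu (cyl A [::]).
rewrite -ler_pdivlMr ?pos// -/c.
have c0 : 0 <= c by rewrite divr_ge0// pr_ge0.
have c1 : c <= 1.
  rewrite ler_pdivrMr ?pos// mul1r; apply: le_pr; try exact: measurable_cyl.
  by move=> eta; rewrite cyl_consl => -[].
have [r hr] := box_count A.
apply: (@pow_ratio_le _ p c d r) => //; first by rewrite pgt0.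
move=> n; pose B := box d (n + r).
have [L LB ltL] := before_total_sort hPi (box_uniq d (n + r)).
pose good e := all (fun a => (a + e) \in B) A.
(* Peel the sites of [s] off from the last one in the order: by negative
   correlation each site [e] with [A + e] inside the box costs a factor [c]. *)
have main s : uniq s -> pairwise (fun x y => before Pi y x) s ->
    (forall e k, e \in s -> k \in B -> Q (k - e) -> k \in s) ->
    pr mu (cyl s [::]) <= c ^+ count good s.
  elim: s => [_ _ _|e s IH us]; first by rewrite expr0 pr_cyl_nil.
  rewrite pairwise_cons => /andP[/allP lte lts] down.
  have Qs k : k \in s -> Q (k - e) by move=> /lte /asboolP.
  have {}IH : pr mu (cyl s [::]) <= c ^+ count good s.
    apply: IH => //; first by move: us => /andP[].
    move=> e' k e's kB Qk; have := down e' k; rewrite !inE e's orbT => /(_ isT kB Qk).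
    case/predU1P => // ke; rewrite ke in Qk; exfalso.
    by apply: (past_asym hPi Qk); rewrite opprB; exact: Qs.
  have -> : count good (e :: s) = (good e + count good s)%N by [].
  have [ge|nge] := boolP (good e); last first.
    rewrite -[nat_of_bool false]/0%N add0n; apply: le_trans IH.
    apply: le_pr; try exact: measurable_cyl.
    by move=> eta; rewrite cyl_consl => -[].
  rewrite -[nat_of_bool true]/1%N add1n exprS; apply: le_trans (ler_wpM2l c0 IH).
  pose A' := map (+%R^~ e) A.
  have uA' : uniq A' by rewrite map_inj_uniq//; exact: addIr.
  (* By [down], the list [s] contains every site of the box that precedes [e]. As [A] lies in the
     past of the origin, its translate by [e] precedes [e], and [ge] puts it in the box. *)
  have A's : {subset A' <= s}.
    move=> _ /mapP[a aA ->]; have Qa := QA a aA.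
    have := down e (a + e); rewrite mem_head addrK !inE => /(_ isT _ Qa).
    move: ge => /allP /(_ a aA) aeB /(_ aeB) /predU1P[h|//].
    exfalso; apply: (past_neq0 hPi); rewrite (_ : 0 = a)//.
    by apply: (@addIr _ e); rewrite add0r.
  pose T := [seq x <- s | x \notin A'].
  have Ts : perm_eq (T ++ A') s.
    apply: uniq_perm.
    - rewrite cat_uniq filter_uniq ?uA' ?andbT/=; last by move: us => /andP[].
      by apply/hasPn => x xA'; rewrite mem_filter xA'.
    - by move: us => /andP[].
    - move=> x; rewrite mem_cat mem_filter; case: (boolP (x \in A')) => //= xA'.
        by rewrite A's.
      by rewrite orbF.
  have uTA : uniq (e :: T ++ A') by rewrite /= (perm_mem Ts) (perm_uniq Ts).
  have cE : pr mu (cyl (e :: A') [::]) = c * pr mu (cyl A' [::]).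
    have := st e (0 :: A) [::]; rewrite /= add0r => ->.
    by have := st e A [::]; rewrite /= => ->; rewrite /c divfK// gt_eqF// pos.
  have := ones_ratio_mono pos uTA; rewrite cE.
  rewrite (@cyl_perm _ (e :: T ++ A') (e :: s) [::] [::])//; last first.
    by move=> x; rewrite !inE (perm_mem Ts).
  rewrite (@cyl_perm _ (T ++ A') s [::] [::])//; last exact: perm_mem.
  by rewrite -mulrA [_ * pr mu (cyl s _)]mulrC mulrA ler_pM2r// pos.
(* The list is reversed because [main] peels off its head, which has to be the last site. *)
have revL : perm_eq (rev L) B by apply: perm_trans LB; rewrite perm_rev.
have := main (rev L); rewrite rev_uniq (perm_uniq LB) box_uniq => /(_ isT).
have -> : pairwise (fun x y => before Pi y x) (rev L).
  elim: L ltL {LB main revL} => //= x s IH /andP[ltx lts].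
  by rewrite rev_cons pairwise_rcons all_rev ltx IH.
rewrite (permP revL) => /(_ isT) h.
have {}h : pr mu (cyl (rev L) [::]) <= c ^+ count good B.
  by apply: h => e k _ kB _; rewrite (perm_mem revL).
apply: (le_trans _ (le_trans h _)).
  have := stoch_dom_ones (S := rev L) dom; rewrite rev_uniq (perm_uniq LB) box_uniq.
  by rewrite (perm_size revL) size_box => /(_ isT).
by apply: ler_wiXn2l => //; exact: hr.
Qed.

End domination_key.

Lemma dom_strong_ones_bound (R : realType) (d : nat) (Pi : set (lattice d)) (p : R)
    (mu mup : probability (config d) R) :
  is_ordering Pi -> 0 <= p <= 1 -> is_product_measure p mup ->
  cyl_stationary mu -> neg_corr mu ->
  (stoch_dom mup mu <-> ones_bound (past0 Pi) mu p) /\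
  (strong_dom_ge Pi p mu <-> ones_bound (past0 Pi) mu p).
Proof.
move=> hPi p01 hmup st nc.
have dk := dom_ones_bound hPi p01 hmup st nc.
have ks : ones_bound (past0 Pi) mu p -> cyl_bound (past0 Pi) mu p.
  by move=> k A B; apply: ones_bound_cyl => //; exact: past_neq0.
have sd : cyl_bound (past0 Pi) mu p -> stoch_dom mup mu.
  exact: cyl_bound_dom.
split; split => //.
- by move=> /ks/sd.
- by move=> /strong_dom_cyl_bound/sd/dk.
- move=> /ks cb; apply/strong_dom_geP => E mE; apply: (past_bound _ cb mE).
  by case/andP: p01.
Qed.

Section process_hypotheses.
Variables (R : realType) (d : nat) (mu : probability (config d) R).

Lemma stationary_cyl : stationary mu -> cyl_stationary mu.
Proof.
move=> st k A B; rewrite /pr -(st k _ (measurable_cyl A B)).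
congr (fine (mu _)); apply/seteqP.
by split => eta; rewrite /cyl /shift /= !all_map.
Qed.

(** Negative association is applied to the one-site events at [x] and [y] under the law conditioned
    on the cylinder; null cylinders satisfy the product form trivially. *)
Lemma cond_neg_assoc_neg_corr : cond_neg_assoc mu -> neg_corr mu.
Proof.
move=> na x y A B uAB.
have [->|c0] := eqVneq (pr mu (cyl A B)) 0.
  by rewrite mulr0 mulr_ge0// pr_ge0.
have cgt0 : 0 < pr mu (cyl A B) by rewrite lt_def c0 pr_ge0.
have [xy yAB uAB'] : [/\ x != y, y \notin A ++ B & uniq (A ++ B)].
  by move: uAB => /= /and3P[]; rewrite inE negb_or => /andP[? ?] ? ?.
pose S : set (lattice d) := [set k | k \in A ++ B].
pose eta0 : config d := fun k => k \in A.
have finS : finite_set S by exact: finite_seq.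
have CE : [set eta : config d | forall k, S k -> eta k = eta0 k] = cyl A B.
  apply/seteqP; split => eta /=.
    move=> h; apply/andP; split; apply/allP => k kA.
      by rewrite h /S/= ?mem_cat ?kA.
    rewrite h /S/= ?mem_cat ?kA ?orbT//; apply/negP => kA'.
    by move: uAB'; rewrite cat_uniq => /and3P[_ /hasP h' _]; apply: h'; exists k.
  move=> /andP[/allP hA /allP hB] k; rewrite /S/= mem_cat /eta0.
  by case: (boolP (k \in A)) => [/hA->//|_ /= /hB/negbTE].
have := na S eta0 finS; rewrite /= CE prE; last exact: measurable_cyl.
rewrite lte_fin => /(_ cgt0) /(_ [set x] [set y] (occ x) (occ y)).
have mo (z : lattice d) : measurable (occ z : set (past_field [set z])) by apply: measurable_occ.
have io z : increasing_event (occ z : set (config d)).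
  by move=> eta delta ed; exact: ed.
have dxy : [set x] `&` [set y] = set0.
  by apply/seteqP; split => // z [-> /= xy']; rewrite xy' eqxx in xy.
move=> /(_ dxy (mo x) (mo y) (io x) (io y)).
have mc (z : lattice d) : measurable (occ z `&` cyl A B).
  by apply: measurableI; [exact: measurable_occT|exact: measurable_cyl].
rewrite /cond_law -setIA !prE//; last first.
- by apply: measurableI => //; exact: measurable_occT.
- exact: measurable_cyl.
rewrite /= -!EFinM lee_fin.
rewrite [occ y `&` _]setIC -cyl_consl [occ x `&` cyl A B]setIC -cyl_consl.
rewrite [occ x `&` _]setIC -cyl_consl.
move: cgt0; move: (pr _ (cyl A B)) (pr _ (cyl (x :: y :: A) B))
  (pr _ (cyl (x :: A) B)) (pr _ (cyl (y :: A) B)) => c xyc xc yc c0'.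
have cn0 : c != 0 by rewrite gt_eqF.
move=> /(ler_wpM2r (ltW (mulr_gt0 c0' c0'))).
rewrite (_ : xyc / c * (c * c) = xyc * c); last by field.
by rewrite (_ : xc / c * (yc / c) * (c * c) = xc * yc); last by field.
Qed.

End process_hypotheses.

(** * Means over the torus *)

Section bounded_functions.
Context (disp : measure_display) (T : measurableType disp) (R : realType).
Implicit Types (f g : T -> R) (M c : R).

(** On a probability space this class is integrable and stable under the ring operations and [expR],
    so integrability follows from the shape of the function. *)
Definition bmf f := measurable_fun setT f /\ exists M, forall x, `|f x| <= M.

Lemma bmf_bound f : bmf f -> exists2 M, 0 < M & forall x, `|f x| <= M.
Proof.
move=> [_ [M hM]]; exists (`|M| + 1); first by rewrite ltr_wpDl.
by move=> x; apply: le_trans (hM x) _; rewrite ler_wpDr// ler_norm.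
Qed.

Lemma bmf_cst c : bmf (fun=> c).
Proof. by split; [exact: measurable_cst|exists `|c|]. Qed.

Lemma bmfD f g : bmf f -> bmf g -> bmf (fun x => f x + g x).
Proof.
move=> [mf [M hM]] [mg [N hN]]; split; first exact: measurable_funD.
by exists (M + N) => x; apply: le_trans (ler_normD _ _) (lerD (hM x) (hN x)).
Qed.

Lemma bmfM f g : bmf f -> bmf g -> bmf (fun x => f x * g x).
Proof.
move=> [mf [M hM]] [mg [N hN]]; split; first exact: measurable_funM.
by exists (M * N) => x; rewrite normrM ler_pM.
Qed.

Lemma bmfZ c f : bmf f -> bmf (fun x => c * f x).
Proof. exact: bmfM (bmf_cst c). Qed.

Lemma bmfN f : bmf f -> bmf (fun x => - f x).
Proof.
move=> [mf [M hM]]; split; last by exists M => x; rewrite normrN.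
exact: measurableT_comp.
Qed.

Lemma bmfB f g : bmf f -> bmf g -> bmf (fun x => f x - g x).
Proof. by move=> bf bg; apply: bmfD => //; exact: bmfN. Qed.

Lemma bmfX f n : bmf f -> bmf (fun x => f x ^+ n).
Proof.
move=> bf; elim: n => [|n IH]; first exact: bmf_cst.
by under eq_fun do rewrite exprS; exact: bmfM.
Qed.

Lemma bmf_sum (I : Type) (s : seq I) (F : I -> T -> R) :
  (forall i, bmf (F i)) -> bmf (fun x => \sum_(i <- s) F i x).
Proof.
move=> bF; elim: s => [|i s IH].
  by under eq_fun do rewrite big_nil; exact: bmf_cst.
by under eq_fun do rewrite big_cons; exact: bmfD.
Qed.

Lemma bmf_expR f : bmf f -> bmf (fun x => expR (f x)).
Proof.
move=> [mf [M hM]]; split; first exact: measurableT_comp.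
exists (expR M) => x; rewrite ger0_norm ?expR_ge0// ler_expR.
by apply: le_trans (hM x); exact: ler_norm.
Qed.

Lemma bmf_itv f a b : measurable_fun setT f -> (forall x, a <= f x <= b) -> bmf f.
Proof.
move=> mf h; split => //; exists (`|a| + `|b|) => x.
have /andP[ha hb] := h x; rewrite ler_norml.
have := ler_norm b; have := ler_norm (- a); rewrite normrN.
have := normr_ge0 a; have := normr_ge0 b; lra.
Qed.

Section mean.
Variable mu : probability T R.

Definition mean f : R := \int[mu]_x f x.

Lemma bmf_integrable f : bmf f -> mu.-integrable setT (EFin \o f).
Proof.
move=> [mf [M hM]]; apply: measurable_bounded_integrable => //.
  by rewrite (le_lt_trans (probability_le1 _ _)) ?ltry.
exists M; split; first exact: num_real.
by move=> N MN x _ /=; apply: le_trans (hM x) (ltW MN).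
Qed.

Lemma meanE f : bmf f -> (\int[mu]_x (f x)%:E)%E = (mean f)%:E.
Proof.
by move=> bf; rewrite /mean /Rintegral fineK// integrable_fin_num// bmf_integrable.
Qed.

Lemma mean_cst c : mean (fun=> c) = c.
Proof.
rewrite /mean Rintegral_cst// (_ : fine _ = 1) ?mulr1//.
transitivity (fine (1%E : \bar R)) => //; congr fine; exact: probability_setT.
Qed.

Lemma meanD f g : bmf f -> bmf g -> mean (fun x => f x + g x) = mean f + mean g.
Proof. by move=> bf bg; rewrite /mean RintegralD//; exact: bmf_integrable. Qed.

Lemma meanZ c f : bmf f -> mean (fun x => c * f x) = c * mean f.
Proof. by move=> bf; rewrite /mean RintegralZl//; exact: bmf_integrable. Qed.

Lemma meanN f : bmf f -> mean (fun x => - f x) = - mean f.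
Proof.
by move=> bf; under eq_fun do rewrite -mulN1r; rewrite meanZ// mulN1r.
Qed.

Lemma meanB f g : bmf f -> bmf g -> mean (fun x => f x - g x) = mean f - mean g.
Proof. by move=> bf bg; rewrite meanD ?meanN//; exact: bmfN. Qed.

Lemma mean_sum (I : Type) (s : seq I) (F : I -> T -> R) :
  (forall i, bmf (F i)) ->
  mean (fun x => \sum_(i <- s) F i x) = \sum_(i <- s) mean (F i).
Proof.
move=> bF; elim: s => [|i s IH].
  by under eq_fun do rewrite big_nil; rewrite mean_cst big_nil.
under eq_fun do rewrite big_cons.
by rewrite meanD ?IH ?big_cons//; exact: bmf_sum.
Qed.

Lemma le_mean f g : bmf f -> bmf g -> (forall x, f x <= g x) -> mean f <= mean g.
Proof. by move=> bf bg fg; apply: le_Rintegral => //; exact: bmf_integrable. Qed.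

Lemma mean_ge0 f : (forall x, 0 <= f x) -> 0 <= mean f.
Proof. by move=> f0; exact: Rintegral_ge0. Qed.

Lemma sqr_mean_le f : bmf f -> mean f ^+ 2 <= mean (fun x => f x ^+ 2).
Proof.
move=> bf; pose m := mean f.
have bf2 := bmfX 2 bf.
(* The variance of [f], expanded. *)
have : 0 <= mean (fun x => (f x ^+ 2 - (2 * m) * f x) + m ^+ 2).
  by apply: mean_ge0 => x; rewrite (_ : _ + _ = (f x - m) ^+ 2) ?sqr_ge0//; ring.
have bm : bmf (fun x => 2 * m * f x) by exact: bmfZ.
have b1 : bmf (fun x => f x ^+ 2 - 2 * m * f x) by exact: bmfB.
have b2 := bmf_cst (m ^+ 2).
by rewrite meanD// meanB// meanZ// mean_cst -/m; lra.
Qed.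

Lemma mean_cvg (D : set T) (F : nat -> T -> R) f M : measurable D -> mu D = 1%E ->
  (forall n, measurable_fun setT (F n)) -> (forall n x, `|F n x| <= M) -> bmf f ->
  (forall x, D x -> F n x @[n --> \oo] --> f x) ->
  mean (F n) @[n --> \oo] --> mean f.
Proof.
move=> mD D1 mF hM bf Ff.
have bF n : bmf (F n) by split => //; exists M.
have [_ _ h] : [/\ mu.-integrable setT (EFin \o f),
    (\int[mu]_x `|(F n x)%:E - (f x)%:E|)%E @[n --> \oo] --> 0%E &
    (\int[mu]_x (F n x)%:E)%E @[n --> \oo] --> (\int[mu]_x (f x)%:E)%E].
  apply: (@dominated_convergence _ _ _ mu setT measurableT (fun n x => (F n x)%:E)
    (fun x => (f x)%:E) (fun=> M%:E)).
  - by move=> n; apply/measurable_EFinP.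
  - by apply/measurable_EFinP; case: bf.
  - exists (~` D); split; first exact: measurableC.
      transitivity (1 - mu D)%E; first exact: probability_setC.
      by rewrite D1 subee.
    move=> x /= nx Dx; apply: nx => _.
    by apply: cvg_EFin; [exact: nearW|exact: Ff].
  - exact: finite_measure_integrable_cst.
  - by apply: aeW => x n _; rewrite lee_fin.
by rewrite meanE// in h; exact: fine_cvg h.
Qed.

End mean.
End bounded_functions.

(** * Vanishing means of nonconstant characters *)

Section circle.
Variable R : realType.
Implicit Types (a c : R).

Lemma Rintegral_derive01 (F f : R -> R) :
  (forall x : R, is_derive x 1 F (f x)) -> continuous f ->
  (\int[lebesgue_measure]_(x in `[0%R, 1%R]) (f x)%:E = (F 1 - F 0)%:E)%E.
Proof.
move=> dF cf.
have cF : continuous F.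
  move=> x; apply: differentiable_continuous; apply/derivable1_diffP.
  by case: (dF x).
rewrite (@continuous_FTC2 _ _ F)//.
- exact: continuous_subspaceT.
- split; first by move=> x _; case: (dF x).
  + exact/cvg_at_right_filter/cF.
  + exact/cvg_at_left_filter/cF.
- by move=> x _; rewrite derive1E; apply: derive_val.
Qed.

Lemma mean_cos_lin a c : a != 0 -> sin (a + c) = sin c ->
  mean (uniform_prob (@ltr01 R)) (fun x => cos (a * x + c)) = 0.
Proof.
move=> a0 sac.
have dlin (x : R) : is_derive x 1 (fun x : R => a * x + c) a.
  have -> : (fun x : R => a * x + c) = (a *: id) + cst c by [].
  by apply: is_derive_eq; rewrite addr0 /GRing.scale/= mulr1.
(* An antiderivative of the nonnegative function [1 + cos (a * x + c)]. The hypothesis on [sin]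
   cancels the oscillating boundary terms, which leaves 1. *)
pose F := id + (a^-1 *: (@sin R \o (fun x : R => a * x + c))).
have dF (x : R) : is_derive x 1 F (1 + cos (a * x + c)).
  have dc : is_derive x 1 (@sin R \o (fun x : R => a * x + c)) (a * cos (a * x + c)).
    by rewrite mulrC; apply: is_derive1_comp.
  have dz : is_derive x 1 (a^-1 *: (@sin R \o (fun x : R => a * x + c)))
      (a^-1 *: (a * cos (a * x + c))) by exact: is_deriveZ.
  rewrite (_ : 1 + _ = 1 + a^-1 *: (a * cos (a * x + c))).
    exact: is_deriveD.
  by rewrite /GRing.scale/= mulKf.
have clin : continuous (fun x : R => a * x + c).
  by move=> x; apply: differentiable_continuous; apply/derivable1_diffP; case: (dlin x).
have ccos : continuous (fun x : R => cos (a * x + c)).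
  by move=> x; apply: continuous_comp; [exact: clin|exact: continuous_cos].
have cf : continuous (fun x : R => 1 + cos (a * x + c)).
  by move=> x; apply: cvgD; [exact: cvg_cst|exact: ccos].
have mf : measurable_fun setT (fun x : measurableTypeR R => cos (a * x + c)).
  exact: continuous_measurable_fun.
have bf : bmf (fun x : measurableTypeR R => cos (a * x + c)).
  by apply: (@bmf_itv _ _ _ _ (-1) 1) => // x; rewrite cos_geN1 cos_le1.
have b1 := bmfD (bmf_cst _ 1) bf.
have : mean (uniform_prob (@ltr01 R)) (fun x => 1 + cos (a * x + c)) = 1.
  rewrite /mean /Rintegral integral_uniform//=; first last.
    by have [mb _] := b1; exact/measurable_EFinP.
  rewrite (Rintegral_derive01 dF)// subr0 invr1 mul1e /F /=.
  rewrite !fctE /= /GRing.scale/= mulr1 mulr0 add0r sac.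
  by rewrite add0r addrK.
by rewrite meanD ?mean_cst//; last exact: bmf_cst; lra.
Qed.

Lemma sinDpi2k (k : int) c : sin (2 * pi * k%:~R + c) = sin c :> R.
Proof.
have h n x : sin (2 * pi * n%:R + x) = sin x :> R.
  by rewrite addrC mulr_natr mulr_natl (periodicn (@sinD2pi R)).
case: k => n; first exact: h.
have := h n.+1 (2 * pi * (Negz n)%:~R + c).
by rewrite NegzE mulrNz addrA -mulrDr subrr mulr0 add0r.
Qed.

End circle.

Section torus_mean.
Variable R : realType.
Implicit Types (n : nat) (c : R).

Local Notation U := (uniform_prob (@ltr01 R)).
Local Notation tor n := (torus_measure R n).

Lemma bmf_consT n (f : euclid R n.+1 -> R) : bmf f -> bmf (f \o @consT R n).
Proof.
move=> [mf [M hM]]; split; last by exists M => x; exact: hM.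
by apply: measurableT_comp => //; exact: measurable_consT.
Qed.

Lemma mean_torusE n (f : euclid R n.+1 -> R) : bmf f ->
  (mean (tor n.+1) f)%:E = (\int[U \x tor n]_z (f (consT z))%:E)%E.
Proof.
move=> bf; rewrite -meanE//= integral_distribution//.
  by apply/measurable_EFinP; case: bf.
by apply: (@bmf_integrable _ _ _ (U \x tor n)%E); exact: bmf_consT.
Qed.

Lemma mean_torus12 n (f : euclid R n.+1 -> R) : bmf f ->
  (forall x, mean (tor n) (fun y => f (consT (x, y))) = 0) -> mean (tor n.+1) f = 0.
Proof.
move=> bf h; apply: EFin_inj; rewrite mean_torusE//.
have bf' := bmf_consT bf.
rewrite -(@integral12_prod_meas1 _ _ _ _ R U (tor n) (fun z => (f (consT z))%:E)); last first.
  exact: (@bmf_integrable _ _ _ (U \x tor n)%E).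
apply: integral0_eq => x _; rewrite /fubini_F meanE ?h//.
have [mf [M hM]] := bf'; split; last by exists M => y; exact: hM.
exact: (measurableT_comp mf (measurable_pair1 x)).
Qed.

Lemma mean_torus21 n (f : euclid R n.+1 -> R) : bmf f ->
  (forall y, mean U (fun x => f (consT (x, y))) = 0) -> mean (tor n.+1) f = 0.
Proof.
move=> bf h; apply: EFin_inj; rewrite mean_torusE//.
have bf' := bmf_consT bf.
rewrite -(@integral21_prod_meas1 _ _ _ _ R U (tor n) (fun z => (f (consT z))%:E)); last first.
  exact: (@bmf_integrable _ _ _ (U \x tor n)%E).
apply: integral0_eq => y _; rewrite /fubini_G meanE ?h//.
have [mf [M hM]] := bf'; split; last by exists M => x; exact: hM.
exact: (measurableT_comp mf (measurable_pair2 y)).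
Qed.

Lemma measurable_dotp n (k : lattice n) : measurable_fun setT (@dotp R n k).
Proof.
apply: measurable_sum => i; apply: measurable_funM => //.
exact: measurable_tnth.
Qed.

Lemma bmf_cos n (k : lattice n) c :
  bmf (fun x : euclid R n => cos (2 * pi * dotp k x + c)).
Proof.
apply: (@bmf_itv _ _ _ _ (-1) 1); last by move=> x; rewrite cos_geN1 cos_le1.
apply: (measurableT_comp (f := @cos R)).
  by apply: continuous_measurable_fun; exact: continuous_cos.
apply: measurable_funD; last exact: measurable_cst.
apply: measurable_funM; first exact: measurable_cst.
exact: measurable_dotp.
Qed.

(** If the first coordinate of [k] vanishes, the inner integral over the other coordinates is zero
    by induction; otherwise the integral over the first coordinate is zero. The phase [c] absorbs
    the coordinates held fixed and also covers the sine. *)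
Lemma mean_cos n (k : lattice n) c : k != 0 ->
  mean (tor n) (fun x => cos (2 * pi * dotp k x + c)) = 0.
Proof.
elim: n k c => [|n IH] k c k0; first by rewrite thinmx0 eqxx in k0.
pose k' : lattice n := \row_i k ord0 (lift ord0 i).
have dotpE x y : dotp k (consT (x, y)) = (k ord0 ord0)%:~R * x + dotp k' y :> R.
  rewrite /dotp big_ord_recl; congr (_ + _).
  by apply: eq_bigr => i _; rewrite /consT tnthS mxE.
have [k00|k00] := eqVneq (k ord0 ord0) 0.
  have k'0 : k' != 0.
    apply: contra k0 => /eqP/rowP k'0; apply/eqP/matrixP => i0 i; rewrite (ord1 i0) mxE.
    case: (unliftP ord0 i) => [j ->|->]; last exact: k00.
    by have := k'0 j; rewrite !mxE.
  apply: mean_torus12; first exact: bmf_cos.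
  move=> x; rewrite -[RHS](IH k' c k'0); congr mean; apply/funext => y.
  by rewrite dotpE k00 mul0r add0r.
apply: mean_torus21; first exact: bmf_cos.
move=> y; rewrite -[RHS](@mean_cos_lin R (2 * pi * (k ord0 ord0)%:~R) (2 * pi * dotp k' y + c)).
- congr mean; apply/funext => x.
  by rewrite dotpE mulrDr !mulrA addrA.
- apply: mulf_neq0; last by rewrite intr_eq0.
  by apply: mulf_neq0; rewrite gt_eqF// pi_gt0.
- by rewrite sinDpi2k.
Qed.

Definition cube n : set (euclid R n) := [set x | forall i, 0 < tnth x i < 1].

Lemma measurable_cube n : measurable (@cube n).
Proof.
rewrite (_ : @cube n = \bigcap_(i in [set: 'I_n]) ((@tnth _ _)^~ i @^-1` `]0, 1[)).
  apply: fin_bigcap_measurable => // i _; rewrite -[X in measurable X]setTI.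
  exact: measurable_tnth.
apply/seteqP; split => x /= h i; first by move=> _; rewrite /= in_itv/=; exact: h.
by have := h i I; rewrite /= in_itv.
Qed.

Lemma torus_measure_cube n : tor n (@cube n) = 1%E.
Proof.
have := @torus_measure_box R n (fun=> `]0, 1[%classic) (fun=> measurable_itv _).
rewrite (_ : [set x | _] = @cube n); last first.
  by apply/seteqP; split => x /= h i; have := h i; rewrite /= in_itv.
move=> ->; rewrite big1// => i _.
rewrite /uniform_prob (eq_integral (cst 1%E)).
  by rewrite integral_cst//= mul1e lebesgue_measure_itv/= lte_fin ltr01 sube0.
move=> x; rewrite inE/= in_itv/= => /andP[x0 x1].
by rewrite /uniform_pdf (ltW x0) (ltW x1) subr0 invr1.
Qed.

End torus_mean.

Local Notation Re := complex.Re.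
Local Notation Im := complex.Im.

(** * Characters and trigonometric sums *)

Section characters.
Variables (R : realType) (d : nat).
Implicit Types (k l : lattice d) (x : euclid R d) (z w : R[i]).
Implicit Types (s t : seq (R[i] * lattice d)).

Local Notation Tor := (torus_measure R d).

Lemma dotpD k l x : dotp (k + l) x = dotp k x + dotp l x.
Proof.
by rewrite /dotp -big_split; apply: eq_bigr => i _; rewrite mxE intrD mulrDl.
Qed.

Lemma dotpN k x : dotp (- k) x = - dotp k x.
Proof. by rewrite /dotp -sumrN; apply: eq_bigr => i _; rewrite mxE mulrNz mulNr. Qed.

Lemma dotp0 x : dotp 0 x = 0.
Proof. by rewrite /dotp big1// => i _; rewrite mxE mul0r. Qed.

Definition chi k x : R[i] :=
  (cos (2 * pi * dotp k x) +i* sin (2 * pi * dotp k x))%C.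

Lemma chiD k l x : chi (k + l) x = chi k x * chi l x.
Proof.
by rewrite /chi dotpD mulrDr cosD sinD [X in (_ +i* X)%C]addrC.
Qed.

Lemma chi0 x : chi 0 x = 1.
Proof. by rewrite /chi dotp0 mulr0 cos0 sin0. Qed.

Lemma chiN k x : chi (- k) x = conjc (chi k x).
Proof. by rewrite /chi dotpN mulrN cosN sinN. Qed.

(** The squared modulus with values in [R], so that it can be integrated directly. *)
Definition nsq z : R := Re z ^+ 2 + Im z ^+ 2.

Lemma nsq_ge0 z : 0 <= nsq z.
Proof. by rewrite addr_ge0 ?sqr_ge0. Qed.

Lemma nsqM z w : nsq (z * w) = nsq z * nsq w.
Proof. by case: z w => [a b] [a' b']; rewrite /nsq /=; ring. Qed.

Lemma nsqX z n : nsq (z ^+ n) = nsq z ^+ n.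
Proof.
elim: n => [|n IH]; last by rewrite !exprS nsqM IH.
by rewrite !expr0 /nsq /= expr1n expr0n addr0.
Qed.

Lemma Re_add z w : Re (z + w) = Re z + Re w.
Proof. by case: z w => [a b] [a' b']. Qed.

Lemma Im_add z w : Im (z + w) = Im z + Im w.
Proof. by case: z w => [a b] [a' b']. Qed.

Lemma Re_mul z w : Re (z * w) = Re z * Re w - Im z * Im w.
Proof. by case: z w => [a b] [a' b']. Qed.

Lemma Im_mul z w : Im (z * w) = Re z * Im w + Im z * Re w.
Proof. by case: z w => [a b] [a' b'] /=; rewrite addrC [b * a']mulrC addrC. Qed.

Lemma Re_conj z : Re (conjc z) = Re z. Proof. by case: z. Qed.

(** Frequencies may repeat in the list: addition is concatenation and multiplication is [allpairs],
    without collecting terms. *)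
Definition tsum s x : R[i] := \sum_(p <- s) p.1 * chi p.2 x.

Lemma tsum_cat s t x : tsum (s ++ t) x = tsum s x + tsum t x.
Proof. by rewrite /tsum big_cat. Qed.

Lemma tsum_mul s t x : tsum s x * tsum t x =
  tsum [seq (p.1 * q.1, p.2 + q.2) | p <- s, q <- t] x.
Proof.
rewrite /tsum big_allpairs_dep big_distrlr /=; apply: eq_bigr => p _.
by apply: eq_bigr => q _; rewrite chiD mulrACA.
Qed.

Lemma tsum_scale c s x : c * tsum s x = tsum [seq (c * p.1, p.2) | p <- s] x.
Proof. by rewrite /tsum big_map mulr_sumr; apply: eq_bigr => p _; rewrite mulrA. Qed.

Lemma tsum_conj s x : conjc (tsum s x) = tsum [seq (conjc p.1, - p.2) | p <- s] x.
Proof.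
rewrite /tsum big_map rmorph_sum; apply: eq_bigr => p _.
by rewrite rmorphM/= chiN.
Qed.

Lemma bmf_cosk k : bmf (fun x => cos (2 * pi * dotp k x) : R).
Proof. by have := bmf_cos k (0 : R); under eq_fun do rewrite addr0. Qed.

Lemma sin_cos (u : R) : sin u = cos (u + - (pi / 2)).
Proof. by rewrite cosD cosN sinN cos_pihalf sin_pihalf mulr0 mulrN1 add0r opprK. Qed.

Lemma bmf_sink k : bmf (fun x => sin (2 * pi * dotp k x) : R).
Proof. by under eq_fun do rewrite sin_cos; exact: bmf_cos. Qed.

Lemma Re_tsum s x : Re (tsum s x) = \sum_(p <- s)
  (Re p.1 * cos (2 * pi * dotp p.2 x) - Im p.1 * sin (2 * pi * dotp p.2 x)).
Proof.
elim: s => [|p s IH]; first by rewrite /tsum !big_nil.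
by rewrite /tsum !big_cons Re_add Re_mul -IH.
Qed.

Lemma Im_tsum s x : Im (tsum s x) = \sum_(p <- s)
  (Re p.1 * sin (2 * pi * dotp p.2 x) + Im p.1 * cos (2 * pi * dotp p.2 x)).
Proof.
elim: s => [|p s IH]; first by rewrite /tsum !big_nil.
by rewrite /tsum !big_cons Im_add Im_mul -IH.
Qed.

Lemma bmf_Re_tsum s : bmf (fun x => Re (tsum s x)).
Proof.
under eq_fun do rewrite Re_tsum; apply: bmf_sum => p.
by apply: bmfB; apply: bmfZ; [exact: bmf_cosk|exact: bmf_sink].
Qed.

Lemma bmf_Im_tsum s : bmf (fun x => Im (tsum s x)).
Proof.
under eq_fun do rewrite Im_tsum; apply: bmf_sum => p.
by apply: bmfD; apply: bmfZ; [exact: bmf_sink|exact: bmf_cosk].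
Qed.

Lemma mean_Re_tsum s : (forall p, p \in s -> p.2 != 0) ->
  mean Tor (fun x => Re (tsum s x)) = 0.
Proof.
move=> s0; under eq_fun do rewrite Re_tsum.
rewrite mean_sum; last first.
  by move=> p; apply: bmfB; apply: bmfZ; [exact: bmf_cosk|exact: bmf_sink].
rewrite big_seq big1// => p /s0 p0.
rewrite meanB; [|by apply: bmfZ; exact: bmf_cosk|by apply: bmfZ; exact: bmf_sink].
rewrite !meanZ; [|exact: bmf_sink|exact: bmf_cosk].
have := mean_cos (0 : R) p0; under eq_fun do rewrite addr0; move=> ->.
under eq_fun do rewrite sin_cos.
by rewrite (mean_cos _ p0) !mulr0 subr0.
Qed.

End characters.

(** * Analytic polynomials and the geometric mean *)

Section analytic_polynomials.
Variables (R : realType) (d : nat) (Pi : set (lattice d)).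
Hypothesis hPi : is_ordering Pi.
Implicit Types (x : euclid R d) (s t : seq (R[i] * lattice d)).
Implicit Types (P : euclid R d -> R[i]) (phi psi : euclid R d -> R).
Local Notation Q := (past0 Pi).
Local Notation Tor := (torus_measure R d).

(** The trial functions of the infimum. They are closed under products because the past is closed
    under addition. *)
Definition past_poly P :=
  exists2 s, (forall p, p \in s -> Q p.2) & forall x, P x = 1 + tsum s x.

Lemma past_poly1 : past_poly (fun=> 1).
Proof. by exists [::] => // x; rewrite /tsum big_nil addr0. Qed.

Lemma past_polyM P P' : past_poly P -> past_poly P' -> past_poly (fun x => P x * P' x).
Proof.
move=> [s Qs Ps] [t Qt Pt].
exists (s ++ t ++ [seq (p.1 * q.1, p.2 + q.2) | p <- s, q <- t]).
  move=> p; rewrite !mem_cat => /or3P[/Qs//|/Qt//|].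
  by case/allpairsP => -[u v] /= [us vt ->] /=; apply: (pastD hPi); [exact: Qs|exact: Qt].
by move=> x; rewrite Ps Pt !tsum_cat -tsum_mul; ring.
Qed.

Lemma past_polyX P n : past_poly P -> past_poly (fun x => P x ^+ n).
Proof.
move=> hP; elim: n => [|n IH]; first exact: past_poly1.
by under eq_fun do rewrite exprS; exact: past_polyM.
Qed.

Lemma past_poly_bmf P : past_poly P ->
  bmf (fun x => Re (P x)) /\ bmf (fun x => Im (P x)).
Proof.
move=> [s Qs Ps]; split.
  under eq_fun do rewrite Ps Re_add.
  by apply: bmfD; [exact: bmf_cst|exact: bmf_Re_tsum].
under eq_fun do rewrite Ps Im_add.
by apply: bmfD; [exact: bmf_cst|exact: bmf_Im_tsum].
Qed.

Lemma past_poly_nsq_bmf P : past_poly P -> bmf (fun x => nsq (P x)).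
Proof. by move=> /past_poly_bmf[bR bI]; apply: bmfD; exact: bmfX. Qed.

Lemma past_poly_mean P : past_poly P -> mean Tor (fun x => Re (P x)) = 1.
Proof.
move=> [s Qs Ps]; under eq_fun do rewrite Ps Re_add /=.
rewrite meanD ?mean_cst ?mean_Re_tsum ?addr0//; last 2 first.
- exact: bmf_cst.
- exact: bmf_Re_tsum.
by move=> p /Qs Qp; apply/eqP => p0; apply: (past_neq0 hPi); rewrite -p0.
Qed.

(** The mean of the real part is the constant term 1, and the square of a mean is at most the mean
    of the square. *)
Lemma past_poly_nsq_mean P : past_poly P -> 1 <= mean Tor (fun x => nsq (P x)).
Proof.
move=> hP; have [bR bI] := past_poly_bmf hP.
rewrite -[leLHS](expr1n _ 2) -{1}(past_poly_mean hP).
apply: le_trans (sqr_mean_le _ bR) _; apply: le_mean.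
- exact: bmfX.
- exact: past_poly_nsq_bmf.
- by move=> x; rewrite lerDl sqr_ge0.
Qed.

Definition trig phi := exists s, forall x, phi x = Re (tsum s x).

Lemma trig_bmf phi : trig phi -> bmf phi.
Proof. by move=> [s hs]; rewrite (funext hs); exact: bmf_Re_tsum. Qed.

Lemma trig_cst (c : R) : trig (fun=> c).
Proof.
exists [:: (c%:C%C, 0)] => x.
by rewrite /tsum big_seq1 [(_, _).1]/= [(_, _).2]/= chi0 mulr1.
Qed.

Lemma trig_cos k : trig (fun x => cos (2 * pi * dotp k x)).
Proof. by exists [:: (1, k)] => x; rewrite /tsum big_seq1 [(_, _).1]/= mul1r. Qed.

Lemma trig_sin k : trig (fun x => sin (2 * pi * dotp k x)).
Proof.
exists [:: ((0 -i* 1)%C, k)] => x; rewrite /tsum big_seq1 Re_mul /=.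
by rewrite mul0r mulN1r opprK add0r.
Qed.

Lemma trigD phi psi : trig phi -> trig psi -> trig (fun x => phi x + psi x).
Proof.
by move=> [s hs] [t ht]; exists (s ++ t) => x; rewrite tsum_cat Re_add hs ht.
Qed.

Lemma trigM phi psi : trig phi -> trig psi -> trig (fun x => phi x * psi x).
Proof.
move=> [s hs] [t ht].
(* [t'] represents the conjugate of [tsum t], and [Re z * Re w] is the real part of
   [z * (w + conjc w) / 2]. *)
pose t' := [seq (conjc p.1, - p.2) | p <- t].
exists [seq ((1 / 2)%:C%C * p.1, p.2) | p <- [seq (p.1 * q.1, p.2 + q.2) | p <- s, q <- t ++ t']].
move=> x; rewrite -tsum_scale -tsum_mul tsum_cat -tsum_conj hs ht.
case: (tsum s x) (tsum t x) => [a b] [a' b'] /=.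
by rewrite subrr mul0r subr0 mulr0 subr0; field.
Qed.

(** Every nonzero frequency [k] or its opposite lies in the past, and [Re (a * chi k)] equals
    [Re (conjc a * chi (- k))]; all nonconstant terms can thus be moved into the past. *)
Lemma trig_mean phi : trig phi -> exists2 s, (forall p, p \in s -> Q p.2) &
  forall x, phi x - mean Tor phi = 2 * Re (tsum s x).
Proof.
move=> [s hs].
have [c [t [Qt ht]]] : exists (c : R) t, (forall p, p \in t -> Q p.2) /\
    forall x, phi x = c + 2 * Re (tsum t x).
  have : forall x, phi x = Re (tsum s x) by [].
  move: (phi) => f {phi hs}; elim: s f => [|[a k] s IH] f hf.
    by exists 0, [::]; split=> // x; rewrite hf /tsum !big_nil /= mulr0 addr0.
  have [c [t [Qt ht]]] := IH (fun x => Re (tsum s x)) (fun x => erefl).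
  have fE x : f x = Re (a * chi k x) + Re (tsum s x).
    by rewrite hf /tsum big_cons Re_add.
  have [k0|k0] := eqVneq k 0.
    exists (Re a + c), t; split=> // x.
    by rewrite fE ht k0 chi0 mulr1 addrA.
  pose b : R[i] := (1 / 2)%:C%C.
  have Rb z : 2 * Re (b * z) = Re z.
    by rewrite Re_mul /= mul0r subr0; field.
  have [Qk|Qk] := past_total hPi k0.
    exists c, ((b * a, k) :: t); split; first by move=> p; rewrite inE => /predU1P[->|/Qt].
    move=> x; rewrite fE ht /tsum big_cons Re_add mulrDr -mulrA Rb.
    by rewrite addrCA.
  exists c, ((b * conjc a, - k) :: t); split; first by move=> p; rewrite inE => /predU1P[->|/Qt].
  move=> x; rewrite fE ht /tsum big_cons Re_add mulrDr -mulrA Rb chiN -rmorphM.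
  by rewrite Re_conj addrCA.
exists t => // x.
have bt : bmf (fun x => Re (tsum t x)) by exact: bmf_Re_tsum.
have -> : mean Tor phi = c.
  rewrite (funext ht).
  rewrite meanD; [|exact: bmf_cst|exact: bmfZ].
  rewrite mean_cst meanZ// mean_Re_tsum ?mulr0 ?addr0//.
  by move=> p /Qt Qp; apply/eqP => p0; apply: (past_neq0 hPi); rewrite -p0.
by rewrite ht addrAC subrr add0r.
Qed.

(* [(1 + h / N) ^ N] approximates [exp h]; only the upper bound is needed. *)
Lemma trig_exp_approx phi : trig phi -> exists M : R, forall N, exists2 P, past_poly P &
  forall x, nsq (P x) <= expR (phi x - mean Tor phi + M / N.+1%:R).
Proof.
move=> /trig_mean[s Qs hs].
have : bmf (fun x => nsq (tsum s x)).
  by apply: bmfD; apply: bmfX; [exact: bmf_Re_tsum|exact: bmf_Im_tsum].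
move=> /bmf_bound[M M0 hM]; exists M => N.
pose r : R := N.+1%:R^-1.
have r0 : 0 < r by rewrite invr_gt0.
pose P x := 1 + r%:C%C * tsum s x.
have hP : past_poly P.
  exists [seq (r%:C%C * p.1, p.2) | p <- s]; last by move=> x; rewrite -tsum_scale.
  by move=> _ /mapP[p ps ->] /=; exact: Qs.
exists (fun x => P x ^+ N.+1); first exact: past_polyX.
move=> x; rewrite nsqX.
have -> : expR (phi x - mean Tor phi + M / N.+1%:R) =
    expR (r * (phi x - mean Tor phi) + r * (r * M)) ^+ N.+1.
  rewrite -expRM_natl; congr expR; rewrite mulrDr !mulrA divff// !mul1r.
  by rewrite [r * M]mulrC.
rewrite lerXn2r ?nnegrE ?nsq_ge0 ?expR_ge0//.
(* With [h = tsum s x], the squared modulus of [1 + r * h] is [1 + 2 * r * Re h + r ^ 2 * nsq h],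
   and [M] bounds [nsq h]. *)
apply: le_trans (expR_ge1Dx _); rewrite hs.
have : nsq (tsum s x) <= M by apply: le_trans (hM x); exact: ler_norm.
rewrite /P /nsq; case: (tsum s x) => [a b] /= hab.
have : r ^+ 2 * (a ^+ 2 + b ^+ 2) <= r ^+ 2 * M by rewrite ler_wpM2l ?sqr_ge0.
by rewrite !mul0r !subr0 !addr0 !add0r; nra.
Qed.

End analytic_polynomials.

(** * Bounded pointwise limits of trigonometric polynomials *)

Section trig_limits.
Variables (R : realType) (d : nat).
Implicit Types (x : euclid R d) (phi psi : euclid R d -> R) (A : set (euclid R d)).

(* Convergence is only asked on the open cube, a set of full measure on which
   [coord] below recovers the coordinates from the characters. *)
Inductive trig_limit : (euclid R d -> R) -> Prop :=
| trig_limit_trig phi : trig phi -> trig_limit phi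
| trig_limit_lim (F : nat -> euclid R d -> R) phi (M : R) :
    (forall n, trig_limit (F n)) -> (forall n x, `|F n x| <= M) -> bmf phi ->
    (forall x, cube x -> F n x @[n --> \oo] --> phi x) -> trig_limit phi.

Lemma trig_limit_bmf phi : trig_limit phi -> bmf phi.
Proof. by case=> // psi; exact: trig_bmf. Qed.

Lemma trig_limit_cst (c : R) : trig_limit (fun=> c).
Proof. by apply: trig_limit_trig; exact: trig_cst. Qed.

Lemma trig_limit_eq phi psi : trig_limit phi -> bmf psi ->
  (forall x, cube x -> phi x = psi x) -> trig_limit psi.
Proof.
move=> Lphi bpsi e; have [_ [M hM]] := trig_limit_bmf Lphi.
apply: (@trig_limit_lim (fun=> phi) psi M) => // x cx; rewrite e//; exact: cvg_cst.
Qed.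

(** Induction on both closures: a limit in one argument is carried through while the other, being
    bounded, stays fixed. *)
Lemma trig_limitD phi psi : trig_limit phi -> trig_limit psi ->
  trig_limit (fun x => phi x + psi x).
Proof.
move=> Lphi; elim: Lphi psi => [{}phi tphi psi|F {}phi M LF IH hM bphi Fphi psi Lpsi].
  elim=> [{}psi tpsi|F {}psi M LF IH hM bpsi Fpsi]; first exact/trig_limit_trig/trigD.
  have [_ [N hN]] := trig_bmf tphi.
  apply: (@trig_limit_lim (fun n x => phi x + F n x) _ (N + M)).
  - exact: IH.
  - by move=> n x; apply: le_trans (ler_normD _ _) _; rewrite lerD.
  - by apply: bmfD => //; exact: trig_bmf.
  - by move=> x cx; apply: cvgD; [exact: cvg_cst|exact: Fpsi].
have [_ [N hN]] := trig_limit_bmf Lpsi.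
apply: (@trig_limit_lim (fun n x => F n x + psi x) _ (M + N)).
- by move=> n; exact: IH.
- by move=> n x; apply: le_trans (ler_normD _ _) _; rewrite lerD.
- by apply: bmfD => //; exact: trig_limit_bmf.
- by move=> x cx; apply: cvgD; [exact: Fphi|exact: cvg_cst].
Qed.

Lemma trig_limitM phi psi : trig_limit phi -> trig_limit psi ->
  trig_limit (fun x => phi x * psi x).
Proof.
move=> Lphi; elim: Lphi psi => [{}phi tphi psi|F {}phi M LF IH hM bphi Fphi psi Lpsi].
  elim=> [{}psi tpsi|F {}psi M LF IH hM bpsi Fpsi]; first exact/trig_limit_trig/trigM.
  have [_ [N hN]] := trig_bmf tphi.
  apply: (@trig_limit_lim (fun n x => phi x * F n x) _ (N * M)).
  - exact: IH.
  - by move=> n x; rewrite normrM ler_pM.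
  - by apply: bmfM => //; exact: trig_bmf.
  - by move=> x cx; apply: cvgM; [exact: cvg_cst|exact: Fpsi].
have [_ [N hN]] := trig_limit_bmf Lpsi.
apply: (@trig_limit_lim (fun n x => F n x * psi x) _ (M * N)).
- by move=> n; exact: IH.
- by move=> n x; rewrite normrM ler_pM.
- by apply: bmfM => //; exact: trig_limit_bmf.
- by move=> x cx; apply: cvgM; [exact: Fphi|exact: cvg_cst].
Qed.

Lemma trig_limitZ (c : R) phi : trig_limit phi -> trig_limit (fun x => c * phi x).
Proof. exact: trig_limitM (trig_limit_cst c). Qed.

Lemma trig_limitB phi psi : trig_limit phi -> trig_limit psi ->
  trig_limit (fun x => phi x - psi x).
Proof.
move=> Lphi Lpsi; under eq_fun do rewrite -mulN1r.
by apply: trig_limitD => //; exact: trig_limitZ.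
Qed.

Lemma trig_limitX phi n : trig_limit phi -> trig_limit (fun x => phi x ^+ n).
Proof.
move=> Lphi; elim: n => [|n IH]; first exact: trig_limit_cst.
by under eq_fun do rewrite exprS; exact: trig_limitM.
Qed.

Lemma trig_limit_sum (I : Type) (s : seq I) (F : I -> euclid R d -> R) :
  (forall i, trig_limit (F i)) -> trig_limit (fun x => \sum_(i <- s) F i x).
Proof.
move=> LF; elim: s => [|i s IH].
  by under eq_fun do rewrite big_nil; exact: trig_limit_cst.
by under eq_fun do rewrite big_cons; exact: trig_limitD.
Qed.

End trig_limits.

Section threshold.
Variable R : realType.
Implicit Types y z : R.

Lemma cvg_natX z : 0 <= z < 1 -> n%:R * z ^+ n @[n --> \oo] --> (0 : R).
Proof.
move=> /andP[z0 z1]; have [->|zN0] := eqVneq z 0.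
  apply: cvg_near_cst; near=> n; rewrite expr0n.
  have n0 : (0 < n)%N by near: n; exists 1%N.
  by rewrite gtn_eqF// mulr0.
have zgt0 : 0 < z by rewrite lt_def zN0.
(* Splitting [z ^ n] as [w ^ n * w ^ n], one factor keeps [n * w ^ n] bounded by Bernoulli's
   inequality and the other tends to 0. *)
pose w := Num.sqrt z.
have w0 : 0 < w by rewrite sqrtr_gt0.
have w1 : w < 1 by rewrite -[ltRHS]sqrtr1 ltr_sqrt.
have zw : z = w * w by rewrite -expr2 sqr_sqrtr// ltW.
pose h := w^-1 - 1.
have h0 : 0 < h by rewrite subr_gt0 invf_gt1.
have bern n : 1 + n%:R * h <= (1 + h) ^+ n.
  elim: n => [|n IH]; first by rewrite mul0r addr0 expr0.
  rewrite exprS -natr1; have n0 : 0 <= n%:R * (h * h) by rewrite !mulr_ge0// ltW.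
  have : (1 + h) * (1 + n%:R * h) <= (1 + h) * (1 + h) ^+ n.
    by rewrite ler_wpM2l// addr_ge0// ltW.
  nra.
have hn n : n%:R * w ^+ n <= h^-1.
  have wn : 0 < w ^+ n by rewrite exprn_gt0.
  rewrite -(ler_pM2r h0) mulVf ?gt_eqF// mulrAC.
  rewrite -[leRHS](@mulVf _ (w ^+ n)) ?gt_eqF// ler_pM2r// -exprVn.
  have -> : w^-1 = 1 + h by rewrite /h addrC subrK.
  by apply: le_trans (bern n); rewrite lerDr.
apply: (@squeeze_cvgr _ _ _ _ (fun=> 0) (fun n => h^-1 * w ^+ n)).
- apply: nearW => n; apply/andP; split; first by rewrite mulr_ge0 ?exprn_ge0.
  by rewrite zw exprMn mulrA ler_wpM2r// exprn_ge0// ltW.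
- exact: cvg_cst.
- rewrite -[X in _ --> X](mulr0 h^-1); apply: cvgM; first exact: cvg_cst.
  by apply: cvg_expr; rewrite ger0_norm// ltW.
Unshelve. all: end_near. Qed.

(* The Brosowski-Deutsch polynomials. *)
Lemma cvg_threshold y : 0 <= y <= 1 ->
  (1 - y ^+ n) ^+ (n * 2 ^ n) @[n --> \oo] --> ((y < 1 / 2)%R%:R : R).
Proof.
move=> /andP[y0 y1].
have yn n : 0 <= y ^+ n <= 1 by rewrite exprn_ge0//= exprn_ile1.
have f01 n : 0 <= (1 - y ^+ n) ^+ (n * 2 ^ n) <= 1.
  have /andP[a b] := yn n.
  by rewrite exprn_ge0 ?subr_ge0//= exprn_ile1 ?subr_ge0// gerBl.
case: ltP => hy /=.
(* Below the threshold, Bernoulli's inequality gives the lower bound [1 - n * (2 * y) ^ n], which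
   tends to 1. *)
- have := @cvg_natX (2 * y) _; have -> : 0 <= 2 * y < 1 by apply/andP; split; lra.
  move=> /(_ isT) h.
  apply: (@squeeze_cvgr _ _ _ _ (fun n => 1 - n%:R * (2 * y) ^+ n) (fun=> 1)).
  + apply: nearW => n; have /andP[_ ->] := f01 n; rewrite andbT.
    apply: le_trans (bernoulli_sub _ (yn n)).
    by rewrite lerB// exprMn mulrA natrM natrX.
  + by rewrite -[X in _ --> X]subr0; apply: cvgB => //; exact: cvg_cst.
  + exact: cvg_cst.
(* From the threshold on, [1 - t <= exp (- t)] with [t = y ^ n] bounds the power by
   [exp (- n * (2 * y) ^ n)], where [(2 * y) ^ n] is at least 1. *)
- apply: (@squeeze_cvgr _ _ _ _ (fun=> 0) (fun n => expR (- 1) ^+ n)).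
  + apply: nearW => n; have /andP[-> _] := f01 n; rewrite /=.
    have /andP[a b] := yn n.
    have e1 : 1 - y ^+ n <= expR (- y ^+ n) by rewrite expR_ge1Dx.
    apply: (@le_trans _ _ (expR (- y ^+ n) ^+ (n * 2 ^ n))).
      by rewrite lerXn2r ?nnegrE ?subr_ge0// expR_ge0.
    rewrite -!expRM_natl ler_expR !mulrN lerN2 mulr1 natrM -mulrA ler_peMr//.
    rewrite natrX -exprMn exprn_ege1//; lra.
  + exact: cvg_cst.
  + by apply: cvg_expr; rewrite ger0_norm ?expR_ge0// expR_lt1; lra.
Qed.

End threshold.

Section trig_limit_sets.
Variables (R : realType) (d : nat).
Implicit Types (x : euclid R d) (phi psi u : euclid R d -> R) (A : set (euclid R d)).

Lemma bmf_indic A : measurable A -> bmf (\1_A : euclid R d -> R).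
Proof.
move=> mA; apply: (@bmf_itv _ _ _ _ 0 1); first exact: measurable_indic.
by move=> x; rewrite indicE; case: (_ \in _); rewrite ?lexx ?ler01.
Qed.

Definition trig_sets : set (set (euclid R d)) :=
  [set A | measurable A /\ trig_limit (\1_A : euclid R d -> R)].

Lemma trig_sets_sigma : sigma_algebra setT trig_sets.
Proof.
have compl A : trig_sets A -> trig_sets (~` A).
  move=> [mA LA]; split; first exact: measurableC.
  rewrite (_ : \1_(~` A) = fun x => 1 - \1_A x); last first.
    apply/funext => x; rewrite !indicE in_setC.
    by case: (x \in A); rewrite /= ?subrr ?subr0.
  by apply: trig_limitB => //; exact: trig_limit_cst.
split.
- by split => //; rewrite indic0; exact: trig_limit_cst.
- by move=> A; rewrite setTD; exact: compl.
- move=> A hA; have mA n : measurable (A n) by case: (hA n).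
  have mU : measurable (\bigcup_n A n) by exact: bigcup_measurable.
  split => //.
  pose F n x : R := 1 - \prod_(i < n) (1 - \1_(A i) x).
  have Fin n x : F n x = if [exists i : 'I_n, x \in A i] then 1 else 0.
    rewrite /F; case: existsP => [[i xi]|h].
      by rewrite (bigD1 i)//= indicE xi subrr mul0r subr0.
    rewrite big1 ?subrr// => i _; rewrite indicE; case: (boolP (_ \in _)) => [xi|_].
      by exfalso; apply: h; exists i.
    by rewrite subr0.
  apply: (@trig_limit_lim _ _ F _ 1).
  + move=> n; rewrite /F; apply: trig_limitB; first exact: trig_limit_cst.
    elim: n => [|n IH]; first by under eq_fun do rewrite big_ord0; exact: trig_limit_cst.
    under eq_fun do rewrite big_ord_recr /=.
    apply: trig_limitM => //; apply: trig_limitB; first exact: trig_limit_cst.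
    by case: (hA n).
  + by move=> n x; rewrite Fin; case: ifP; rewrite ?normr1 ?normr0.
  + exact: bmf_indic.
  + move=> x _; apply: cvg_near_cst; rewrite indicE.
    have [/set_mem[m _ xm]|nx] := boolP (x \in _).
      near=> n; rewrite Fin ifT//; apply/existsP.
      have mn : (m < n)%N by near: n; exists m.+1.
      by exists (Ordinal mn); exact/mem_set.
    apply: nearW => n; rewrite Fin ifF//; apply/negbTE; apply: contra nx.
    by move=> /existsP[i /set_mem xi]; apply/mem_set; exists i.
Unshelve. all: end_near. Qed.

(** An affine change sends [u] into the interval from 0 to 1 and the level [t] to [1 / 2]; the
    threshold polynomials in the new function then converge to the indicator. *)
Lemma trig_sets_lt u t : trig_limit u -> trig_sets [set x | u x < t].
Proof.
move=> Lu; have bu := trig_limit_bmf Lu.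
have mut : measurable [set x | u x < t].
  rewrite (_ : [set x | _] = setT `&` u @^-1` `]-oo, t[%classic).
    by case: bu => mu _; exact: mu.
  by rewrite setTI; apply/seteqP; split => x /=; rewrite in_itv.
split=> //.
have bt : bmf (fun x => u x - t) by apply: bmfB => //; exact: bmf_cst.
have [C C0 hC] := bmf_bound bt.
pose y x := (2 * C)^-1 * (u x - t) + 1 / 2.
have Ly : trig_limit y.
  apply: trig_limitD; last exact: trig_limit_cst.
  by apply: trig_limitZ; apply: trig_limitB => //; exact: trig_limit_cst.
have CC : 0 < (2 * C)^-1 by rewrite invr_gt0 mulr_gt0.
have yx x : (2 * C) * (y x - 1 / 2) = u x - t.
  by rewrite /y addrK mulrA divff ?mul1r// gt_eqF// mulr_gt0.
have y01 x : 0 <= y x <= 1.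
  by have := hC x; rewrite -yx ler_norml; move=> /andP[]; nra.
have yt x : (y x < 1 / 2) = (u x < t).
  by rewrite -[RHS]subr_lt0 -yx pmulr_rlt0 ?mulr_gt0// subr_lt0.
apply: (@trig_limit_lim _ _ (fun n x => (1 - y x ^+ n) ^+ (n * 2 ^ n)) _ 1).
- move=> n; apply: trig_limitX; apply: trig_limitB; first exact: trig_limit_cst.
  exact: trig_limitX.
- move=> n x; have /andP[y0 y1] := y01 x.
  have : 0 <= y x ^+ n <= 1 by rewrite exprn_ge0//= exprn_ile1.
  move=> /andP[a b]; rewrite ger0_norm ?exprn_ge0 ?subr_ge0//.
  by rewrite exprn_ile1 ?subr_ge0// gerBl.
- exact: bmf_indic.
- move=> x _; rewrite indicE (_ : (x \in _) = (y x < 1 / 2)); first exact: cvg_threshold.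
  by rewrite yt; apply/idP/idP => [/set_mem//|h]; exact/mem_set.
Qed.

Local Notation trigT := (g_sigma_algebraType trig_sets).

Lemma measurable_trigE A : measurable (A : set trigT) <-> trig_sets A.
Proof.
have -> : measurable (A : set trigT) = <<s trig_sets >> A by [].
by rewrite (sigma_algebra_id trig_sets_sigma).
Qed.

Lemma trig_limit_measurable u : trig_limit u -> measurable_fun setT (u : trigT -> R).
Proof.
move=> Lu mT; apply: (measurability _ (RGenInftyO.measurableE R)) => //.
move=> _ [_ [t ->] <-]; apply/measurable_trigE.
rewrite setTI (_ : _ @^-1` _ = [set x | u x < t]); first exact: trig_sets_lt.
by apply/seteqP; split => x /=; rewrite in_itv.
Qed.

(* [sin (2 * t) / (1 - cos (2 * t)) = cot t = tan (pi / 2 - t)] for [t = pi * y]. *)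
Definition coord (i : 'I_d) x : R :=
  1 / 2 - atan (sin (2 * pi * dotp (delta_mx ord0 i) x)
    / (1 - cos (2 * pi * dotp (delta_mx ord0 i) x))) / pi.

Lemma dotp_delta i x : dotp (delta_mx ord0 i) x = tnth x i.
Proof.
rewrite /dotp (bigD1 i)//= mxE !eqxx mul1r big1 ?addr0// => j ji.
by rewrite mxE eqxx (negbTE ji) mul0r.
Qed.

Lemma coord_cube i x : cube x -> coord i x = tnth x i.
Proof.
move=> /(_ i); rewrite /coord dotp_delta; move: (tnth x i) => y /andP[y0 y1].
have p0 := @pi_gt0 R.
have py : 0 < pi * y by rewrite mulr_gt0.
have py1 : pi * y < pi by rewrite gtr_pMr.
have s0 : 0 < sin (pi * y) by apply: sin_gt0_pi; rewrite py py1.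
have -> : 2 * pi * y = pi * y + pi * y by ring.
rewrite cosD sinD.
have -> : 1 - (cos (pi * y) * cos (pi * y) - sin (pi * y) * sin (pi * y)) =
    2 * sin (pi * y) * sin (pi * y).
  by have := cos2Dsin2 (pi * y); rewrite !expr2; lra.
have -> : (sin (pi * y) * cos (pi * y) + cos (pi * y) * sin (pi * y)) /
    (2 * sin (pi * y) * sin (pi * y)) = tan (pi / 2 - pi * y).
  rewrite /tan sinB cosB sin_pihalf cos_pihalf.
  rewrite !mul0r !mul1r add0r subr0; field.
  by rewrite gt_eqF.
rewrite tanK; last by rewrite in_itv/=; apply/andP; split; lra.
have aux (q : R) : 0 < q -> 1 / 2 - (q / 2 - q * y) / q = y.
  by move=> q0; field; rewrite gt_eqF.
exact: aux.
Qed.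

Lemma measurable_coord i : measurable_fun setT (coord i : trigT -> R).
Proof.
have mc : measurable_fun setT ((fun x => cos (2 * pi * dotp (delta_mx ord0 i) x)) : trigT -> R).
  by apply: trig_limit_measurable; apply: trig_limit_trig; exact: trig_cos.
have ms : measurable_fun setT ((fun x => sin (2 * pi * dotp (delta_mx ord0 i) x)) : trigT -> R).
  by apply: trig_limit_measurable; apply: trig_limit_trig; exact: trig_sin.
apply: measurable_funB; first exact: measurable_cst.
apply: measurable_funM; last exact: measurable_cst.
apply: (measurableT_comp (f := @atan R)).
  by apply: continuous_measurable_fun => y; exact: continuous_atan.
apply: measurable_funM => //.
(* The denominator is nonnegative and may vanish; there the inverse and the power [-1] have the same
   default value 0. *)
under eq_fun do rewrite -powR_inv1 ?subr_ge0 ?cos_le1//.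
apply: (measurableT_comp (f := @powR R ^~ (-1))); first exact: measurable_powR.
by apply: measurable_funB => //; exact: measurable_cst.
Qed.

(** The Borel sets are generated by the coordinates. On the open cube these coincide with the
    functions [coord i], which are measurable for [trig_sets], and [trig_limit] only sees the
    cube. *)
Lemma trig_sets_measurable A : measurable A -> trig_sets A.
Proof.
apply: smallest_sub; first exact: trig_sets_sigma.
move=> B; rewrite -bigcup_seq => -[i _ [C mC <-]].
have mB : measurable (setT `&` (@tnth _ _)^~ i @^-1` C : set (euclid R d)).
  exact: measurable_tnth.
split=> //.
have /measurable_trigE[mC' LC] : measurable (setT `&` (coord i : trigT -> R) @^-1` C).
  exact: measurable_coord.
apply: trig_limit_eq LC _ _; first exact: bmf_indic.
move=> x cx; rewrite !indicE; congr (_%:R); congr (nat_of_bool _).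
by apply/idP/idP => /set_mem[_ h]; apply/mem_set; split => //;
  move: h; rewrite /= coord_cube.
Qed.

Import HBNNSimple.

(** After adding a constant the function is nonnegative, hence an increasing limit of simple
    functions, which are combinations of indicators already reached. *)
Lemma bmf_trig_limit phi : bmf phi -> trig_limit phi.
Proof.
move=> bphi; have [M M0 hM] := bmf_bound bphi.
suff : trig_limit (fun x => phi x + M).
  move=> L; have := trig_limitB L (trig_limit_cst _ M).
  by under eq_fun do rewrite addrK.
have bM : bmf (fun x => phi x + M) by apply: bmfD => //; exact: bmf_cst.
have M1 x : 0 <= phi x + M <= 2 * M by have := hM x; rewrite ler_norml => /andP[]; lra.
have mf : measurable_fun setT (fun x => (phi x + M)%:E).
  by apply/measurable_EFinP; case: bM.
pose h := nnsfun_approx measurableT mf.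
have f0 x : setT x -> (0 <= (phi x + M)%:E)%E by move=> _; rewrite lee_fin; case/andP: (M1 x).
pose F (n : nat) : euclid R d -> R := h n.
have F0 n x : 0 <= F n x by [].
have FM n x : F n x <= phi x + M.
  by rewrite -lee_fin /F /h nnsfun_approxE; exact: (le_approx _ f0).
apply: (trig_limit_lim (F := F) (M := 2 * M)) bM _.
- move=> n.
  have -> : F n = fun x =>
      \sum_(y <- finmap.enum_fset (fset_set (range (h n)))) y * \1_(h n @^-1` [set y]) x.
    by apply/funext => x; rewrite /F [LHS]fimfunE fsbig_finite.
  apply: trig_limit_sum => y; apply: trig_limitZ.
  by have [] := trig_sets_measurable (measurable_sfunP (h n) (measurable_set1 y)).
- move=> n x; rewrite ger0_norm//.
  by have /andP[_ le2] := M1 x; exact: le_trans (FM n x) le2.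
- move=> x _; have := cvg_nnsfun_approx measurableT mf f0 (x := x) I.
  by move=> /fine_cvg; exact.
Qed.

End trig_limit_sets.

(** * The geometric mean as an infimum over analytic polynomials *)

Section weights.
Variables (R : realType) (d : nat) (Pi : set (lattice d)).
Hypothesis hPi : is_ordering Pi.
Implicit Types (x : euclid R d) (P : euclid R d -> R[i]) (phi psi f : euclid R d -> R).
Local Notation Tor := (torus_measure R d).
Local Notation past_poly := (@past_poly R d Pi).

Lemma le_expR_lim (a M X : R) :
  (forall n, a <= expR (M / n.+1%:R) * X) -> a <= X.
Proof.
move=> h; have c : expR (M / n.+1%:R) * X @[n --> \oo] --> X.
  have c0 : M / n.+1%:R @[n --> \oo] --> (0 : R).
    rewrite -[X in _ --> X](mulr0 M); apply: cvgM; first exact: cvg_cst.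
    exact: (@cvg_harmonic R).
  have c1 : expR (M / n.+1%:R) @[n --> \oo] --> expR (0 : R).
    by apply: continuous_cvg => //; exact: continuous_expR.
  by rewrite expR0 in c1; rewrite -[X in _ --> X]mul1r; apply: cvgM => //; exact: cvg_cst.
by apply: cvgr_to_ge c _; exact: nearW.
Qed.

(** Dominated convergence, used for the mean in the exponent and then for the whole integrand. Lower
    bounds on such weighted means therefore survive bounded pointwise limits in the exponent. *)
Lemma mean_weight_cvg (F : nat -> euclid R d -> R) psi f M :
  (forall n, bmf (F n)) -> (forall n x, `|F n x| <= M) -> bmf psi ->
  (forall x, cube x -> F n x @[n --> \oo] --> psi x) -> bmf f ->
  mean Tor (fun x => f x * expR (F n x - mean Tor (F n))) @[n --> \oo] -->
  mean Tor (fun x => f x * expR (psi x - mean Tor psi)).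
Proof.
move=> bF hM bpsi Fpsi bf; have [N N0 hN] := bmf_bound bf.
have mF n : `|mean Tor (F n)| <= M.
  have hn x : - M <= F n x <= M by rewrite -ler_norml.
  rewrite ler_norml -{1}(mean_cst Tor (- M)) -{2}(mean_cst Tor M).
  by rewrite !le_mean//; try exact: bmf_cst; move=> x; case/andP: (hn x).
have bG n : bmf (fun x => f x * expR (F n x - mean Tor (F n))).
  by apply: bmfM => //; apply: bmf_expR; apply: bmfB => //; exact: bmf_cst.
apply: (@mean_cvg _ _ _ Tor (@cube R d) _ _ (N * expR (M + M))).
- exact: measurable_cube.
- exact: torus_measure_cube.
- by move=> n; case: (bG n).
- move=> n x; rewrite normrM ler_pM// ger0_norm ?expR_ge0// ler_expR.
  by apply: le_trans (ler_norm _) _; apply: le_trans (ler_normB _ _) _; rewrite lerD.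
- by apply: bmfM => //; apply: bmf_expR; apply: bmfB => //; exact: bmf_cst.
- move=> x cx; apply: cvgM; first exact: cvg_cst.
  apply: continuous_cvg; first exact: continuous_expR.
  apply: cvgB; first exact: Fpsi.
  apply: (@mean_cvg _ _ _ Tor (@cube R d) _ _ M) => //.
  + exact: measurable_cube.
  + exact: torus_measure_cube.
  + by move=> n; case: (bF n).
Qed.

Lemma mean_expRD psi f (M : R) : bmf f -> bmf psi ->
  mean Tor (fun x => f x * expR (psi x - mean Tor psi + M)) =
  expR M * mean Tor (fun x => f x * expR (psi x - mean Tor psi)).
Proof.
move=> bf bpsi; rewrite -meanZ; last first.
  by apply: bmfM => //; apply: bmf_expR; apply: bmfB => //; exact: bmf_cst.
by congr mean; apply/funext => x; rewrite expRD mulrA mulrC.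
Qed.

(** For trigonometric [psi], let [P'] have squared modulus at most about [exp (psi - mean psi)]. The
    product of [P] and [P'] is again a trial function, so its squared modulus has mean at least
    1. *)
Lemma weight_lower psi P : bmf psi -> past_poly P ->
  1 <= mean Tor (fun x => nsq (P x) * expR (psi x - mean Tor psi)).
Proof.
move=> /bmf_trig_limit Lpsi hP; have bP := past_poly_nsq_bmf hP.
elim: Lpsi => [{}psi tpsi|F {}psi M LF IH hM bpsi Fpsi]; last first.
  have c := mean_weight_cvg (fun n => trig_limit_bmf (LF n)) hM bpsi Fpsi bP.
  by apply: cvgr_to_ge c _; apply: nearW.
have [M hM] := trig_exp_approx hPi tpsi.
have bpsi := trig_bmf tpsi.
apply: (@le_expR_lim _ M) => n; have [P' hP' leP'] := hM n.
apply: le_trans (past_poly_nsq_mean hPi (past_polyM hPi hP hP')) _.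
rewrite -mean_expRD//; apply: le_mean.
- exact: past_poly_nsq_bmf (past_polyM hPi hP hP').
- apply: bmfM => //; apply: bmf_expR; apply: bmfD; last exact: bmf_cst.
  by apply: bmfB => //; exact: bmf_cst.
- by move=> x; rewrite nsqM ler_wpM2l ?nsq_ge0.
Qed.

(** Here the multiplier approximating the weight is itself inserted as trial function in the
    hypothesis. *)
Lemma weight_upper psi f (p : R) : bmf psi -> bmf f -> (forall x, 0 <= f x) ->
  (forall P, past_poly P -> p <= mean Tor (fun x => nsq (P x) * f x)) ->
  p <= mean Tor (fun x => f x * expR (psi x - mean Tor psi)).
Proof.
move=> /bmf_trig_limit Lpsi bf f0 hp.
elim: Lpsi => [{}psi tpsi|F {}psi M LF IH hM bpsi Fpsi]; last first.
  have c := mean_weight_cvg (fun n => trig_limit_bmf (LF n)) hM bpsi Fpsi bf.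
  by apply: cvgr_to_ge c _; apply: nearW.
have [M hM] := trig_exp_approx hPi tpsi.
have bpsi := trig_bmf tpsi.
apply: (@le_expR_lim _ M) => n; have [P' hP' leP'] := hM n.
apply: le_trans (hp P' hP') _.
rewrite -mean_expRD//; apply: le_mean.
- by apply: bmfM => //; exact: past_poly_nsq_bmf hP'.
- apply: bmfM => //; apply: bmf_expR; apply: bmfD; last exact: bmf_cst.
  by apply: bmfB => //; exact: bmf_cst.
- by move=> x; rewrite mulrC ler_wpM2l.
Qed.

Section geometric_mean.
Variable f : euclid R d -> R.
Hypotheses (mf : measurable_fun setT f) (f01 : forall x, 0 <= f x <= 1).

Definition trunc (n : nat) x : R := Num.max (f x) n.+1%:R^-1.

Lemma trunc_gt0 n x : 0 < trunc n x.
Proof. by rewrite lt_max invr_gt0 ltr0n orbT. Qed.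

Lemma trunc_le1 n x : trunc n x <= 1.
Proof.
have /andP[_ f1] := f01 x.
by rewrite ge_max f1 invf_le1 ?ltr0n// ler1n.
Qed.

Lemma trunc_itv n x : n.+1%:R^-1 <= trunc n x <= 1.
Proof. by rewrite trunc_le1 andbT le_max lexx orbT. Qed.

Lemma measurable_trunc n : measurable_fun setT (trunc n).
Proof. by apply: measurable_maxr => //; exact: measurable_cst. Qed.

Lemma bmf_trunc n : bmf (trunc n).
Proof. by apply: bmf_itv (measurable_trunc n) _; exact: trunc_itv. Qed.

Lemma bmf_f : bmf f. Proof. exact: bmf_itv mf f01. Qed.

Lemma bmf_ln_trunc n : bmf (fun x => ln (trunc n x)).
Proof.
apply: (@bmf_itv _ _ _ _ (ln n.+1%:R^-1) 0).
  by apply: measurableT_comp; [exact: measurable_ln|exact: measurable_trunc].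
move=> x; have /andP[a b] := trunc_itv n x.
by rewrite ler_ln ?posrE ?trunc_gt0 ?invr_gt0// a ln_le0.
Qed.

Definition log_mean n : R := mean Tor (fun x => ln (trunc n x)).

Local Notation logint := (\int[Tor]_x (- lne (f x)%:E))%E.

Lemma cvg_log_trunc x :
  ((- ln (trunc n x))%:E @[n --> \oo] --> - lne (f x)%:E)%E.
Proof.
have /andP[f0 f1] := f01 x.
have [fE|fN0] := eqVneq (f x) 0.
  rewrite fE le0_lneNy//= /trunc fE.
  apply/cvgeyPge => A; near=> n.
  rewrite max_r ?invr_ge0// lnV ?posrE// opprK lee_fin.
  rewrite -(expRK A) ler_ln ?posrE ?expR_gt0//.
  near: n; exists (Num.truncn (expR A)) => // n /= hn.
  apply: le_trans (ltW (truncnS_gt _)) _; rewrite ler_nat ltnS//.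
have fgt0 : 0 < f x by rewrite lt_def fN0.
rewrite lne_EFin//; apply: cvg_near_cst; near=> n.
rewrite /trunc max_l// invf_ple ?posrE//.
near: n; exists (Num.truncn (f x)^-1) => // n /= hn.
by apply: le_trans (ltW (truncnS_gt _)) _; rewrite ler_nat ltnS.
Unshelve. all: end_near. Qed.

(** The sign is reversed so that the integrands are nonnegative and increase with [n]; monotone
    convergence then also covers an infinite integral. *)
Lemma log_mean_cvg : ((- log_mean n)%:E @[n --> \oo] --> logint)%E.
Proof.
pose g n x : \bar R := (- ln (trunc n x))%:E.
have := @cvg_monotone_convergence _ _ _ Tor setT measurableT g _ _ _.
have -> : (fun x => limn (g ^~ x)) = (fun x => - lne (f x)%:E)%E.
  by apply/funext => x; apply/cvg_lim => //; exact: cvg_log_trunc.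
have -> : (fun n => \int[Tor]_x g n x)%E = (fun n => (- log_mean n)%:E).
  apply/funext => n; rewrite meanE ?meanN//; first exact: bmf_ln_trunc.
  by apply: bmfN; exact: bmf_ln_trunc.
apply.
- move=> n; apply/measurable_EFinP.
  by have [] := bmfN (bmf_ln_trunc n).
- by move=> n x _; rewrite lee_fin oppr_ge0 ln_le0// trunc_le1.
- move=> x _ m n mn; rewrite lee_fin lerN2 ler_ln ?posrE ?trunc_gt0//.
  rewrite /trunc ge_max le_max lexx /= le_max; apply/orP; right.
  by rewrite lef_pV2 ?posrE// ler_nat ltnS.
Qed.

Lemma log_mean_le n : ((- log_mean n)%:E <= logint)%E.
Proof.
have nd : nondecreasing_seq (fun n => (- log_mean n)%:E).
  move=> m k mk; rewrite lee_fin lerN2; apply: le_mean; try exact: bmf_ln_trunc.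
  move=> x; rewrite ler_ln ?posrE ?trunc_gt0//.
  rewrite /trunc ge_max le_max lexx /= le_max; apply/orP; right.
  by rewrite lef_pV2 ?posrE// ler_nat ltnS.
rewrite -(cvg_lim _ log_mean_cvg)//.
apply: lime_ge; first exact: cvgP log_mean_cvg.
by exists n => // m /= nm; exact: nd.
Qed.

Lemma GME : GM f = expeR (- logint)%E.
Proof.
rewrite /GM -integral_ge0N; last first.
  move=> x _; rewrite leeNr oppe0 lne_le0 lee_fin.
  by case/andP: (f01 x).
by under [in RHS]eq_integral do rewrite oppeK.
Qed.

Lemma GM_geP (p : R) : 0 < p ->
  (p%:E <= GM f)%E <-> forall n, p <= expR (log_mean n).
Proof.
move=> p0; have pK : expR (ln p) = p by rewrite lnK// posrE.
have -> : (p%:E <= GM f)%E = (logint <= (- ln p)%:E)%E.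
  rewrite GME -{1}pK -[(expR _)%:E]/(expeR (ln p)%:E) lee_expeR.
  by rewrite EFinN leeNr.
have pe n : (p <= expR (log_mean n)) = (- log_mean n <= - ln p).
  by rewrite -{1}pK ler_expR lerN2.
split=> [h n|h]; first by rewrite pe -lee_fin; exact: le_trans (log_mean_le n) h.
rewrite -(cvg_lim _ log_mean_cvg)//; apply: lime_le; first exact: cvgP log_mean_cvg.
by apply: nearW => n; rewrite lee_fin -pe.
Qed.

(** Szegő's theorem, with the infimum replaced by its lower bounds [p]. *)
Lemma GM_geometric (p : R) : 0 <= p ->
  (p%:E <= GM f)%E <->
  (forall P, past_poly P -> p <= mean Tor (fun x => nsq (P x) * f x)).
Proof.
move=> p_ge0; have [->|pN0] := eqVneq p 0.
  split=> [_ P _|_]; last exact: expeR_ge0.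
  by apply: mean_ge0 => x; rewrite mulr_ge0 ?nsq_ge0//; case/andP: (f01 x).
have p0 : 0 < p by rewrite lt_def pN0.
rewrite GM_geP//; split=> [h P hP|h n].
(* [weight_lower] with exponent [ln (trunc n x)] bounds the mean for the weight [trunc n], which
   exceeds [f] by at most [1 / (n + 1)]. *)
- have bP := past_poly_nsq_bmf hP.
  have bnd n : p <= mean Tor (fun x => nsq (P x) * f x)
      + n.+1%:R^-1 * mean Tor (fun x => nsq (P x)).
    apply: le_trans (h n) _.
    have := weight_lower (bmf_ln_trunc n) hP.
    under eq_fun do rewrite expRD lnK ?posrE ?trunc_gt0// mulrA mulrC.
    have bPt : bmf (fun x => nsq (P x) * trunc n x) by apply: bmfM => //; exact: bmf_trunc.
    rewrite meanZ// expRN -/(log_mean n) -ler_pdivrMl ?invr_gt0 ?expR_gt0// invrK mulr1.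
    move=> le1; apply: le_trans le1 _.
    rewrite -meanZ// -meanD; [|by apply: bmfM => //; exact: bmf_f|exact: bmfZ].
    apply: le_mean => //.
      by apply: bmfD; [apply: bmfM => //; exact: bmf_f|exact: bmfZ].
    move=> x; rewrite [n.+1%:R^-1 * _]mulrC -mulrDr ler_wpM2l ?nsq_ge0//.
    have /andP[f0 _] := f01 x.
    by rewrite ge_max lerDl invr_ge0 ler0n lerDr.
  have c : mean Tor (fun x => nsq (P x) * f x) + n.+1%:R^-1 * mean Tor (fun x => nsq (P x))
      @[n --> \oo] --> mean Tor (fun x => nsq (P x) * f x).
    rewrite -[X in _ --> X]addr0; apply: cvgD; first exact: cvg_cst.
    rewrite -[X in _ --> X](mul0r (mean Tor (fun x => nsq (P x)))).
    by apply: cvgM; [exact: (@cvg_harmonic R)|exact: cvg_cst].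
  by apply: cvgr_to_ge c _; exact: nearW.
(* [weight_upper] with exponent [- ln (trunc n x)]: the integrand is [f / trunc n], at most 1, times
   the exponential of [log_mean n]. *)
- have bN := bmfN (bmf_ln_trunc n).
  have f0 x : 0 <= f x by case/andP: (f01 x).
  apply: le_trans (weight_upper bN bmf_f f0 h) _.
  rewrite meanN ?opprK; last exact: bmf_ln_trunc.
  rewrite -[leRHS](mean_cst Tor); apply: le_mean.
  + apply: bmfM; first exact: bmf_f.
    by apply: bmf_expR; apply: bmfD => //; exact: bmf_cst.
  + exact: bmf_cst.
  + move=> x; rewrite expRD expRN lnK ?posrE ?trunc_gt0// mulrA -/(log_mean n).
    rewrite ler_piMl ?expR_ge0// ler_pdivrMr ?trunc_gt0// mul1r.
    by rewrite le_max lexx.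
Qed.

End geometric_mean.
End weights.

(** * Determinants and determinantal processes *)

Section schur_complement.
Variable F : fieldType.

Lemma det_block_schur (a m : nat) (A : 'M[F]_a) (B : 'M[F]_(a, m)) (C : 'M[F]_(m, a))
    (D : 'M[F]_m) : D \in unitmx ->
  \det (block_mx A B C D) = \det D * \det (A - B *m invmx D *m C).
Proof.
move=> uD.
have : block_mx A B C D *m block_mx 1%:M 0 (- (invmx D *m C)) 1%:M
    = block_mx (A - B *m invmx D *m C) B 0 D.
  rewrite mulmx_block !mulmx1 !mulmx0 !add0r; congr block_mx.
    by rewrite mulmxN mulmxA.
  by rewrite mulmxN mulmxA mulmxV// mul1mx subrr.
move=> /(congr1 determinant); rewrite det_mulmx det_lblock det_ublock !det1 !mulr1.
by rewrite mulrC.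
Qed.

Lemma det_mx2 (A : 'M[F]_2) : \det A = A 0 0 * A 1 1 - A 0 1 * A 1 0.
Proof.
rewrite (expand_det_row _ 0) !big_ord_recl big_ord0 addr0 /cofactor !det_mx11 !mxE.
rewrite /= expr0 expr1 mul1r mulN1r mulrN.
by congr (A _ _ * A _ _ - A _ _ * A _ _); apply/val_inj.
Qed.

End schur_complement.

Section kernel_matrices.
Variables (R : realType) (T : Type) (g : T -> T -> R[i]).
Local Notation C := R[i].

Definition kmx (a b : nat) (u : 'I_a -> T) (v : 'I_b -> T) : 'M[C]_(a, b) :=
  \matrix_(i, j) g (u i) (v j).

Definition kdet (n : nat) (e : 'I_n -> T) : C := \det (kmx e e).

(** An entry of the Schur complement of the block indexed by [w]. As a kernel in [x] and [y] it is
    shared by all matrices that extend this block. *)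
Definition kschur (m : nat) (w : 'I_m -> T) (x y : T) : C :=
  g x y - (kmx (fun=> x : T) w *m invmx (kmx w w) *m kmx w (fun=> y : T))
    (ord0 : 'I_1) (ord0 : 'I_1).

Lemma kdet_schur (a m : nat) (e : 'I_(a + m) -> T) :
  let u := e \o @lshift a m in let w := e \o @rshift a m in
  kmx w w \in unitmx ->
  kdet e = kdet w * \det (\matrix_(i, j) kschur w (u i) (u j)).
Proof.
move=> u w uw; rewrite /kdet.
have -> : kmx e e = block_mx (kmx u u) (kmx u w) (kmx w u) (kmx w w).
  rewrite -[LHS]submxK; congr block_mx; apply/matrixP => i j; rewrite !mxE //.
rewrite (det_block_schur (kmx u u) (kmx u w) (kmx w u) uw).
suff -> : \matrix_(i, j) kschur w (u i) (u j) =
    kmx u u - kmx u w *m invmx (kmx w w) *m kmx w u by [].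
apply/esym/matrixP => i j.
have entry n (M : 'M[C]_(a, n)) (N : 'M[C]_(n, a)) :
    (row i M *m col j N) ord0 ord0 = (M *m N) i j.
  by rewrite !mxE; apply: eq_bigr => k _; rewrite !mxE.
rewrite [RHS]mxE /kschur.
have -> : kmx (fun=> u i : T) w = row i (kmx u w) :> 'M[C]_(1, m).
  by apply/matrixP => i0 k; rewrite !mxE.
have -> : kmx w (fun=> u j : T) = col j (kmx w u) :> 'M[C]_(m, 1).
  by apply/matrixP => k i0; rewrite !mxE.
rewrite -row_mul entry mxE [in LHS]mxE; congr (_ + _); last by rewrite mxE.
Qed.

Hypothesis herm : forall x y, g y x = conjc (g x y).

Lemma kmx_herm (a b : nat) (u : 'I_a -> T) (v : 'I_b -> T) :
  (kmx u v)^T = map_mx conjc (kmx v u).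
Proof. by apply/matrixP => i j; rewrite !mxE herm. Qed.

Lemma kdet_real (n : nat) (e : 'I_n -> T) : conjc (kdet e) = kdet e.
Proof. by rewrite /kdet -det_map_mx -kmx_herm det_tr. Qed.

Lemma kschur_herm (m : nat) (w : 'I_m -> T) x y :
  kschur w y x = conjc (kschur w x y).
Proof.
rewrite /kschur (herm x y) rmorphB; congr (_ - _).
pose X := kmx (fun=> x : T) w *m invmx (kmx w w) *m kmx w (fun=> y : T) : 'M[C]_1.
transitivity ((map_mx conjc X)^T ord0 ord0); last by rewrite !mxE.
pose cj : {rmorphism C -> C} := @conjc R.
have cjK n k (M : 'M[C]_(n, k)) : map_mx cj (map_mx cj M) = M.
  by apply/matrixP => i j; rewrite !mxE /= conjcK.
rewrite map_trmx /X !trmx_mul trmx_inv !kmx_herm -/cj.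
by rewrite (map_mxM cj) (map_mxM cj) -(map_invmx cj) !cjK mulmxA.
Qed.

(* Desnanot-Jacobi for the Hermitian matrix of the kernel [g]. *)
Lemma kdet_neg_corr (m : nat) (w : 'I_m -> T) (x y : T)
    (exy : 'I_(2 + m) -> T) (ex ey : 'I_(1 + m) -> T) :
  exy \o @rshift 2 m = w -> exy (lshift m 0) = x -> exy (lshift m 1) = y ->
  ex \o @rshift 1 m = w -> ex (lshift m 0) = x ->
  ey \o @rshift 1 m = w -> ey (lshift m 0) = y ->
  kmx w w \in unitmx ->
  kdet exy * kdet w <= kdet ex * kdet ey.
Proof.
move=> xyw xy0 xy1 xw x0 yw y0 uw.
rewrite (@kdet_schur 2 m exy) xyw// (@kdet_schur 1 m ex) xw// (@kdet_schur 1 m ey) yw//.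
rewrite det_mx2 !det_mx11 !mxE /= xy0 xy1 x0 y0.
(* Both sides carry the factor [d0 ^ 2], and the diagonal products cancel; what remains is the
   squared modulus of [d0 * Sxy]. *)
set d0 := kdet w; set Sxx := kschur w x x; set Syy := kschur w y y.
rewrite -subr_ge0 (kschur_herm w x y); set Sxy := kschur w x y.
rewrite (_ : _ - _ = (d0 * Sxy) * conjc (d0 * Sxy)); first exact: mulcJ_ge0.
have d0r : conjc d0 = d0 := kdet_real w.
by rewrite rmorphM /= d0r; ring.
Qed.

End kernel_matrices.

Section determinantal.
Variables (R : realType) (d : nat) (f : euclid R d -> R).
Hypotheses (mf : measurable_fun setT f) (f01 : forall x, 0 <= f x <= 1).
Local Notation Tor := (torus_measure R d).
Local Notation C := R[i].

Lemma fourierN k : fourier f (- k) = conjc (fourier f k).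
Proof.
rewrite /fourier; apply/eqP; rewrite eq_complex /=; apply/andP; split; apply/eqP.
  by congr Rintegral; apply/funext => x; rewrite dotpN mulrN cosN.
congr (- _); have bs : bmf (fun x => f x * sin (2 * pi * dotp k x)).
  by apply: bmfM; [exact: bmf_itv mf f01|exact: bmf_sink].
rewrite -[RHS](meanN Tor bs); congr Rintegral; apply/funext => x.
by rewrite dotpN mulrN sinN mulrN.
Qed.

(** Lowering the diagonal by 1 at the sites of [Z] makes the determinant give, up to sign, the
    probability of zeros on [Z] and ones elsewhere. *)
Definition kern (Z : pred (lattice d)) (k l : lattice d) : C :=
  fourier f (l - k) - ((k == l) && Z k)%:R.

Lemma kern_herm Z k l : kern Z l k = conjc (kern Z k l).
Proof.
rewrite /kern rmorphB -[k - l]opprB fourierN.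
by congr (_ - _); rewrite rmorph_nat eq_sym; case: eqP => // ->.
Qed.

Variable P : probability (config d) R.
Hypothesis hP : is_determinantal f P.

Definition pattern n (e : 'I_n -> lattice d) (Z : pred (lattice d)) : set (config d) :=
  [set eta : config d | forall i, eta (e i) = ~~ Z (e i)].

Lemma measurable_pattern n (e : 'I_n -> lattice d) Z : measurable (pattern e Z).
Proof.
apply: past_field_measurable; apply: (@determined_by_measurable _ setT (codom e)) => //.
by move=> eta zeta ez he i; rewrite -ez ?he// codom_f.
Qed.

(** Induction on the number of zeros: a zero at one site is the event with that site ignored minus
    the event with a one there, and the determinant is linear in the corresponding row. *)
Lemma pattern_det m n (e : 'I_n -> lattice d) (Z : pred (lattice d)) :
  injective e -> (\sum_(i < n) Z (e i) = m)%N ->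
  ((pr P (pattern e Z))%:C)%C = (-1) ^+ m * kdet (kern Z) e.
Proof.
elim: m n e Z => [|m IH] n e Z ei hm.
  have Z0 i : Z (e i) = false.
    by move/eqP: hm; rewrite sum_nat_eq0 => /forallP /(_ i)/=; case: (Z _).
  rewrite expr0 mul1r; case: n e ei hm Z0 => [|n] e ei hm Z0.
    rewrite /kdet det_mx00 (_ : pattern e Z = setT) ?/pr ?probability_setT//.
    by apply/seteqP; split => // eta _ [].
  rewrite /pr (_ : pattern e Z = [set eta : config d | forall i, eta (e i) = true]).
    rewrite hP//; congr (\det _); apply/matrixP => i j.
    by rewrite !mxE /kern Z0 andbF subr0.
  by apply/seteqP; split => eta /= h i; have := h i; rewrite Z0.
have [i0 Zi0] : exists i0, Z (e i0).
  apply: contrapT => /forallNP h; move: hm; rewrite big1// => i _.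
  by have /negP/negbTE -> := h i.
case: n e ei hm i0 Zi0 => [|n] e ei hm i0 Zi0; first by case: i0 Zi0.
pose Z' : pred (lattice d) := fun k => Z k && (k != e i0).
pose e' := e \o lift i0.
have ei' : injective e' by move=> i j /ei/lift_inj.
have lne i : (e (lift i0 i) == e i0) = false.
  by apply/eqP => /ei /eqP; rewrite eq_sym (negbTE (neq_lift _ _)).
have hm1 : (\sum_(i < n) Z (e' i) = m)%N.
  by move: hm; rewrite (bigD1_ord i0)//= Zi0 => -[].
have hm2 : (\sum_(i < n.+1) Z' (e i) = m)%N.
  rewrite (bigD1_ord i0)//= /Z' eqxx andbF add0n -hm1; apply: eq_bigr => i _.
  by rewrite lne andbT.
have := IH _ _ _ ei' hm1; have := IH _ _ _ ei hm2.
have mocc := measurable_occT (e i0).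
have -> : pr P (pattern e' Z) = pr P (pattern e Z') + pr P (pattern e Z).
  rewrite (pr_split P (measurable_pattern e' Z) mocc); congr (pr P _ + pr P _).
    apply/seteqP; split => eta.
      move=> [h oe] i; case: (unliftP i0 i) => [j ->|->]; last by rewrite /Z' eqxx andbF.
      by rewrite /Z' lne andbT; exact: h.
    move=> h; split; last by have := h i0; rewrite /Z' eqxx andbF.
    by move=> i; have := h (lift i0 i); rewrite /Z' lne andbT.
  apply/seteqP; split => eta.
    move=> [h oe] i; case: (unliftP i0 i) => [j ->|->]; first exact: h.
    by rewrite Zi0; apply/negbTE/negP.
  move=> h; split; first by move=> i; exact: h.
  by have := h i0; rewrite Zi0 /occ /= => ->.
have dE : kdet (kern Z) e = kdet (kern Z') e - kdet (kern Z) e'.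
  pose M := kmx (kern Z) e e; pose M' := kmx (kern Z') e e.
  (* Row [i0] of [M] is that of [M'] minus a unit row. Putting the unit row in its place leaves the
     minor that omits site [e i0]. *)
  pose D : 'M[C]_n.+1 := \matrix_(i, j) if i == i0 then (j == i0)%:R else M i j.
  have kE i j : i != i0 -> kern Z (e i) (e j) = kern Z' (e i) (e j).
    by move=> ii0; rewrite /kern /Z' (inj_eq ei i i0) ii0 andbT.
  have -> : kdet (kern Z) e' = \det D.
    rewrite (expand_det_row _ i0) (bigD1 i0)//= big1 ?addr0; last first.
      by move=> j ji; rewrite mxE eqxx (negbTE ji) mul0r.
    rewrite mxE !eqxx mul1r /cofactor addnn -signr_odd odd_double expr0 mul1r.
    congr (\det _); apply/matrixP => i j; rewrite !mxE.
    by rewrite eq_sym (negbTE (neq_lift _ _)).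
  rewrite /kdet (determinant_multilinear (A := M) (B := M') (C := D) (i0 := i0) (b := 1) (c := -1)).
  - by rewrite mul1r mulN1r.
  - apply/rowP => j; rewrite !mxE eqxx mul1r mulN1r /kern /Z' eqxx andbF !andbF subr0.
    by rewrite Zi0 andbT (inj_eq ei) eq_sym.
  - by apply/matrixP => i j; rewrite !mxE kE// eq_sym neq_lift.
  - by apply/matrixP => i j; rewrite !mxE eq_sym (negbTE (neq_lift _ _)).
rewrite dE rmorphD /= => h1; rewrite h1 => h2.
by rewrite exprS mulN1r mulNr mulrBr -h2; ring.
Qed.

Lemma cyl_pattern (t A B : seq (lattice d)) : uniq t -> perm_eq t (A ++ B) ->
  cyl A B = pattern (fun i : 'I_(size t) => nth 0 t i) (mem B).
Proof.
move=> ut tAB; have uAB : uniq (A ++ B) by rewrite -(perm_uniq tAB).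
have dj k : k \in A -> k \notin B.
  move=> kA; apply/negP => kB; move: uAB; rewrite cat_uniq => /and3P[_ /hasP h _].
  by apply: h; exists k.
apply/seteqP; split => eta.
  move=> /andP[/allP hA /allP hB] i.
  have : nth 0 t i \in A ++ B by rewrite -(perm_mem tAB) mem_nth.
  rewrite mem_cat => /orP[kA|kB]; first by rewrite hA//= dj.
  by rewrite (negbTE (hB _ kB)) /= kB.
move=> h; have h' k : k \in A ++ B -> eta k = (k \notin B).
  rewrite -(perm_mem tAB) => kt; have it : (index k t < size t)%N by rewrite index_mem.
  by have := h (Ordinal it); rewrite /= nth_index.
apply/andP; split; apply/allP => k kA; rewrite h' ?mem_cat ?kA ?orbT//.
by rewrite dj.
Qed.

Lemma nth_ord_inj (t : seq (lattice d)) : uniq t ->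
  injective (fun i : 'I_(size t) => nth 0 t i).
Proof. by move=> ut i j /eqP; rewrite nth_uniq// => /eqP/val_inj. Qed.

Lemma pr_cyl_det (t A B : seq (lattice d)) : uniq t -> perm_eq t (A ++ B) ->
  ((pr P (cyl A B))%:C)%C = (-1) ^+ size B *
    kdet (kern (mem B)) (fun i : 'I_(size t) => nth 0 t i).
Proof.
move=> ut tAB; rewrite (cyl_pattern ut tAB).
apply: pattern_det; first exact: nth_ord_inj.
transitivity (count (mem B) t).
  rewrite -sum1_count [RHS]big_mkcond [RHS](big_nth 0) [RHS]big_mkord; apply: eq_bigr => i _.
  by rewrite /=; case: (_ \in B).
rewrite (permP tAB) count_cat (_ : count (mem B) A = 0%N) ?add0n.
  by apply/eqP; rewrite -all_count; apply/allP.
apply/eqP; rewrite -leqn0 leqNgt -has_count; apply/hasP => -[k kA kB].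
move: ut; rewrite (perm_uniq tAB) cat_uniq => /and3P[_ /hasP h _].
by apply: h; exists k.
Qed.

Lemma determinantal_neg_corr : neg_corr P.
Proof.
move=> x y A B u.
have uyAB : uniq (y :: A ++ B) by case/andP: u.
have uAB : uniq (A ++ B) by case/andP: uyAB.
have uxAB : uniq (x :: A ++ B).
  by move: u; rewrite /= inE negb_or => /andP[/andP[_ ->] /andP[_ ->]].
have dxy := @pr_cyl_det (x :: y :: A ++ B) (x :: y :: A) B u (perm_refl _).
have dx := @pr_cyl_det (x :: A ++ B) (x :: A) B uxAB (perm_refl _).
have dy := @pr_cyl_det (y :: A ++ B) (y :: A) B uyAB (perm_refl _).
have d0 := @pr_cyl_det (A ++ B) A B uAB (perm_refl _).
pose w (i : 'I_(size (A ++ B))) := nth 0 (A ++ B) i.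
(* If the block is singular, the conditioning cylinder is null and the left-hand side vanishes. *)
have [uw|nuw] := boolP (kmx (kern (mem B)) w w \in unitmx); last first.
  have : ((pr P (cyl A B))%:C)%C = 0.
    rewrite d0; move: nuw; rewrite unitmxE unitfE negbK => /eqP h.
    by rewrite /kdet h mulr0.
  by case=> ->; rewrite mulr0 mulr_ge0 ?pr_ge0.
rewrite -lecR !rmorphM /= dxy dx dy d0 ![_ * _ * ((-1) ^+ _ * _)]mulrACA.
rewrite -expr2 -exprM mulnC exprM sqrrN expr1n expr1n !mul1r.
exact: (@kdet_neg_corr R _ _ (kern_herm (mem B)) _ w x y).
Qed.

Lemma determinantal_cyl_stationary : cyl_stationary P.
Proof.
move=> k A B; have ik : injective (+%R^~ k : lattice d -> lattice d) by exact: addIr.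
(* The determinant formula needs distinct sites. Overlapping lists give empty cylinders; otherwise
   repetitions are removed first. *)
have [/hasP[z zB zA]|nAB] := boolP (has (mem A) B).
  have e0 (A' B' : seq (lattice d)) z' : z' \in A' -> z' \in B' -> cyl A' B' = set0.
    move=> zA' zB'; rewrite -subset0 => eta /andP[/allP hA /allP hB].
    by have := hB _ zB'; rewrite hA.
  rewrite (e0 _ _ z zA zB) (e0 _ _ (z + k)) ?pr0//; exact: map_f.
rewrite -(@cyl_perm _ (undup A) A (undup B) B); [|exact: mem_undup|exact: mem_undup].
rewrite -(@cyl_perm _ (map (+%R^~ k) (undup A)) (map (+%R^~ k) A)
  (map (+%R^~ k) (undup B)) (map (+%R^~ k) B)); last 2 first.
- by apply: eq_mem_map; exact: mem_undup.
- by apply: eq_mem_map; exact: mem_undup.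
set A' := undup A; set B' := undup B.
have u : uniq (A' ++ B').
  rewrite cat_uniq !undup_uniq andbT /=; apply: contra nAB => /hasP[z].
  by rewrite /= !mem_undup => zB zA; apply/hasP; exists z.
have uk : uniq (map (+%R^~ k) (A' ++ B')) by rewrite map_inj_uniq.
apply: complexI; rewrite (pr_cyl_det u (perm_refl _)).
have pk : perm_eq (map (+%R^~ k) (A' ++ B')) (map (+%R^~ k) A' ++ map (+%R^~ k) B').
  by rewrite map_cat.
rewrite (@pr_cyl_det [seq z + k | z <- A' ++ B'] _ _ uk pk) size_map.
congr (_ * _).
pose e (n : nat) (i : 'I_n) := nth 0 (A' ++ B') i.
(* The bound [n] is left free so that [size_map] can be rewritten inside the index type. *)
pose ek (n : nat) (i : 'I_n) := nth 0 [seq z + k | z <- A' ++ B'] i.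
have -> : kdet (kern (mem [seq z + k | z <- B'])) (ek (size [seq z + k | z <- A' ++ B'])) =
    kdet (kern (mem [seq z + k | z <- B'])) (ek (size (A' ++ B'))).
  by rewrite size_map.
congr (\det _); apply/matrixP => i j; rewrite !mxE /ek.
rewrite !(nth_map 0)// /kern opprD addrACA subrr addr0 (inj_eq ik).
by rewrite /= (mem_map ik).
Qed.

End determinantal.

(** * The Schur complement as a minimum *)

Section hermitian_square.
Variables (R : realType) (m : nat).
Local Notation C := R[i].
Local Notation conjT M := ((map_mx (@conjc R) M)^T).

(* Completing the square in the last [m] variables. *)
Lemma complete_square (a : 'M[C]_1) (r : 'rV[C]_m) (D : 'M[C]_m) (v : 'rV[C]_m) :
  conjT D = D -> D \in unitmx ->
  row_mx 1%:M v *m block_mx a r (conjT r) D *m conjT (row_mx 1%:M v) =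
  (a - r *m invmx D *m conjT r)
  + (v + r *m invmx D) *m D *m conjT (v + r *m invmx D).
Proof.
move=> hD uD; pose cj : {rmorphism C -> C} := @conjc R.
have cD : conjT (invmx D) = invmx D.
  by rewrite (map_invmx cj) trmx_inv hD.
rewrite map_row_mx tr_row_mx mul_row_block mul_row_col.
have -> : conjT (v + r *m invmx D) = conjT v + invmx D *m conjT r.
  by rewrite (map_mxD cj) (map_mxM cj) [LHS]linearD /= trmx_mul; congr (_ + _ *m _).
have -> : conjT (1%:M : 'M[C]_1) = 1%:M by rewrite (map_mx1 cj) trmx1.
rewrite !mul1mx mulmx1.
have e1 : (v + r *m invmx D) *m D = v *m D + r by rewrite mulmxDl mulmxKV.
rewrite e1 mulmxDl mulmxDr [(_ + r) *m (invmx D *m _)]mulmxDl.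
rewrite -[v *m D *m (invmx D *m _)]mulmxA mulKVmx//.
rewrite [r *m (_ *m _)]mulmxA mulmxDl.
rewrite [X in _ = _ + X]addrC [RHS]addrA [X in _ = X + _]addrACA addNr addr0.
by rewrite [r *m _ + _]addrC.
Qed.

End hermitian_square.

Section quadratic_form.
Variables (R : realType) (d : nat) (f : euclid R d -> R).
Hypotheses (mf : measurable_fun setT f) (f01 : forall x, 0 <= f x <= 1).
Local Notation Tor := (torus_measure R d).
Local Notation C := R[i].
Local Notation conjT M := ((map_mx (@conjc R) M)^T).
Local Notation g := (kern f pred0).

Definition csum (m : nat) (w : 'I_m -> lattice d) (u : 'rV[C]_m) (x : euclid R d) : C :=
  \sum_i u 0 i * chi (w i) x.

Lemma nsqE (z : C) : ((nsq z)%:C)%C = z * conjc z.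
Proof.
case: z => [a b]; apply/eqP; rewrite eq_complex /nsq /=; apply/andP; split; apply/eqP.
  by ring.
by rewrite mulrN [b * a]mulrC addNr.
Qed.

Definition cmean (h : euclid R d -> C) : C :=
  (mean Tor (fun x => complex.Re (h x)) +i* mean Tor (fun x => complex.Im (h x)))%C.

Definition cbmf (h : euclid R d -> C) :=
  bmf (fun x => complex.Re (h x)) /\ bmf (fun x => complex.Im (h x)).

Lemma cbmfZ c h : cbmf h -> cbmf (fun x => c * h x).
Proof.
move=> [bR bI]; split.
  by under eq_fun do rewrite Re_mul; apply: bmfB; exact: bmfZ.
by under eq_fun do rewrite Im_mul; apply: bmfD; exact: bmfZ.
Qed.

Lemma cbmfD h k : cbmf h -> cbmf k -> cbmf (fun x => h x + k x).
Proof.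
move=> [bR bI] [bR' bI']; split.
  by under eq_fun do rewrite Re_add; exact: bmfD.
by under eq_fun do rewrite Im_add; exact: bmfD.
Qed.

Lemma cbmf_sum (I : Type) (s : seq I) (h : I -> euclid R d -> C) :
  (forall i, cbmf (h i)) -> cbmf (fun x => \sum_(i <- s) h i x).
Proof.
move=> bh; elim: s => [|i s IH].
  by under eq_fun do rewrite big_nil; split; exact: bmf_cst.
by under eq_fun do rewrite big_cons; exact: cbmfD.
Qed.

Lemma cmeanZ c h : cbmf h -> cmean (fun x => c * h x) = c * cmean h.
Proof.
move=> [bR bI]; case: c => [a b]; rewrite /cmean.
apply/eqP; rewrite eq_complex /=; apply/andP; split; apply/eqP.
  under eq_fun do rewrite Re_mul /=.
  by rewrite meanB ?meanZ//; exact: bmfZ.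
under eq_fun do rewrite Im_mul /=.
by rewrite meanD ?meanZ//; exact: bmfZ.
Qed.

Lemma cmeanD h k : cbmf h -> cbmf k -> cmean (fun x => h x + k x) = cmean h + cmean k.
Proof.
move=> [bR bI] [bR' bI']; rewrite /cmean.
apply/eqP; rewrite eq_complex /=; apply/andP; split; apply/eqP.
  by under eq_fun do rewrite Re_add; rewrite meanD.
by under eq_fun do rewrite Im_add; rewrite meanD.
Qed.

Lemma cmean_sum (I : Type) (s : seq I) (h : I -> euclid R d -> C) :
  (forall i, cbmf (h i)) ->
  cmean (fun x => \sum_(i <- s) h i x) = \sum_(i <- s) cmean (h i).
Proof.
move=> bh; elim: s => [|i s IH].
  by under eq_fun do rewrite big_nil; rewrite /cmean !mean_cst big_nil.
under eq_fun do rewrite big_cons.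
by rewrite cmeanD ?IH ?big_cons//; exact: cbmf_sum.
Qed.

Lemma cmean_fourier k :
  cbmf (fun x => ((f x)%:C)%C * chi k x) /\
  cmean (fun x => ((f x)%:C)%C * chi k x) = fourier f (- k).
Proof.
have bff : bmf f := bmf_itv mf f01.
split.
  split.
    under eq_fun do rewrite Re_mul /= mul0r subr0.
    by apply: bmfM => //; exact: bmf_cosk.
  under eq_fun do rewrite Im_mul /= mul0r addr0.
  by apply: bmfM => //; exact: bmf_sink.
rewrite (fourierN mf f01) /cmean /fourier /= opprK.
congr (_ +i* _)%C; congr Rintegral; apply/funext => x.
  by rewrite mul0r subr0.
by rewrite mul0r addr0.
Qed.

Lemma mean_quadratic_form m (w : 'I_m -> lattice d) (u : 'rV[C]_m) :
  ((mean Tor (fun x => nsq (csum w u x) * f x))%:C)%C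
  = (u *m kmx g w w *m conjT u) 0 0.
Proof.
transitivity (cmean (fun x => \sum_i \sum_j (u 0 i * conjc (u 0 j)) *
    (((f x)%:C)%C * chi (w i - w j) x))).
  have e x : \sum_i \sum_j (u 0 i * conjc (u 0 j)) * (((f x)%:C)%C * chi (w i - w j) x)
      = ((nsq (csum w u x) * f x)%:C)%C.
    rewrite rmorphM /= nsqE /csum rmorph_sum mulr_suml mulr_suml; apply: eq_bigr => i _.
    rewrite mulr_sumr mulr_suml; apply: eq_bigr => j _.
    rewrite chiD chiN rmorphM /=.
    by move: (u 0 i) (chi (w i) x) (conjc (u 0 j)) (conjc (chi (w j) x)) => p q r s; ring.
  by rewrite (funext e) /cmean /= mean_cst.
rewrite cmean_sum; last first.
  by move=> i; apply: cbmf_sum => j; apply: cbmfZ; case: (cmean_fourier (w i - w j)).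
have -> : \sum_i cmean (fun x => \sum_j u 0 i * conjc (u 0 j) *
    (((f x)%:C)%C * chi (w i - w j) x)) =
    \sum_i \sum_j u 0 i * conjc (u 0 j) * g (w i) (w j).
  apply: eq_bigr => i _; rewrite cmean_sum; last first.
    by move=> j; apply: cbmfZ; case: (cmean_fourier (w i - w j)).
  apply: eq_bigr => j _; have [b e] := cmean_fourier (w i - w j).
  by rewrite cmeanZ// e opprB /kern andbF subr0.
rewrite mxE exchange_big; apply: eq_bigr => j _.
rewrite !mxE mulr_suml; apply: eq_bigr => i _.
by rewrite !mxE mulrAC.
Qed.

End quadratic_form.

Section szego.
Variables (R : realType) (d : nat) (Pi : set (lattice d)) (f : euclid R d -> R).
Hypothesis hPi : is_ordering Pi.
Hypotheses (mf : measurable_fun setT f) (f01 : forall x, 0 <= f x <= 1).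
Variable P : probability (config d) R.
Hypothesis hP : is_determinantal f P.
Local Notation Tor := (torus_measure R d).
Local Notation C := R[i].
Local Notation Q := (past0 Pi).
Local Notation g := (kern f pred0).
Local Notation conjT M := ((map_mx (@conjc R) M)^T).

Lemma pr_ones_det (t : seq (lattice d)) : uniq t ->
  ((pr P (cyl t [::]))%:C)%C = kdet g (fun i : 'I_(size t) => nth 0 t i).
Proof.
move=> ut; rewrite (@pr_cyl_det _ _ _ _ hP t) ?cats0// expr0 mul1r.
by congr kdet; apply/funext => k; apply/funext => l; rewrite /kern /= in_nil.
Qed.

Section finite_past.
Variable A : seq (lattice d).
Hypotheses (uA : uniq A) (nA : 0 \notin A).
Let m := size A.
Let w (i : 'I_m) : lattice d := nth 0 A i.
Let z0 (i : 'I_1) : lattice d := 0.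
Let D := kmx g w w.
Let r := kmx g z0 w.
Let S := kschur g w 0 0.
Hypothesis uD : D \in unitmx.

Lemma ones_schur : ((pr P (cyl (0 :: A) [::]))%:C)%C = ((pr P (cyl A [::]))%:C)%C * S.
Proof.
rewrite !pr_ones_det//; last by rewrite /= nA.
rewrite (@kdet_schur _ _ g 1 m (fun i : 'I_(1 + m) => nth 0 (0 :: A) i))//.
by rewrite det_mx11 mxE.
Qed.

(** An identity rather than an inequality, as both directions are used: the last mean is
    nonnegative, and it vanishes for a suitable [v]. *)
Lemma poly_square (v : 'rV[C]_m) :
  ((mean Tor (fun x => nsq (1 + csum w v x) * f x))%:C)%C
  = S + ((mean Tor (fun x => nsq (csum w (v + r *m invmx D) x) * f x))%:C)%C.
Proof.
have hg := kern_herm mf f01 pred0.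
pose cj : {rmorphism C -> C} := @conjc R.
have kT n k (a : 'I_n -> lattice d) (b : 'I_k -> lattice d) :
    conjT (kmx g a b) = kmx g b a.
  by rewrite -(kmx_herm hg b a) trmxK.
pose e (i : 'I_(1 + m)) : lattice d := nth 0 (0 :: A) i.
have eE x : csum e (row_mx 1%:M v) x = 1 + csum w v x.
  rewrite /csum big_split_ord big_ord1 /= row_mxEl mxE eqxx chi0 mulr1.
  congr (_ + _); apply: eq_bigr => i _.
  by rewrite row_mxEr.
have := mean_quadratic_form mf f01 e (row_mx 1%:M v).
under eq_fun do rewrite eE; move=> ->.
have -> : kmx g e e = block_mx (kmx g z0 z0) r (conjT r) D.
  rewrite /r kT -[LHS]submxK.
  by congr block_mx; apply/matrixP => i j; rewrite !mxE /e ?(ord1 i) ?(ord1 j).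
rewrite complete_square//; last exact: kT.
rewrite mxE (mean_quadratic_form mf f01) /S /kschur mxE; congr (_ + _).
rewrite /r kT [kmx g z0 z0 0 0]mxE; congr (_ + _).
by rewrite mxE.
Qed.

Lemma csum_past_poly (v : 'rV[C]_m) : (forall k, k \in A -> Q k) ->
  past_poly Pi (fun x => 1 + csum w v x).
Proof.
move=> QA; exists [seq (v 0 i, w i) | i <- enum 'I_m].
  by move=> _ /mapP[i _ ->]; apply: QA; exact: mem_nth.
by move=> x; rewrite /csum /tsum big_map big_enum.
Qed.

End finite_past.

Lemma poly_ones_bound (p : R) :
  (forall T, past_poly Pi T -> p <= mean Tor (fun x => nsq (T x) * f x)) -> ones_bound Q P p.
Proof.
move=> hp A uA QA.
have nA : 0 \notin A by apply/negP => /QA; exact: past_neq0.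
pose w (i : 'I_(size A)) : lattice d := nth 0 A i.
have [uD|nuD] := boolP (kmx g w w \in unitmx); last first.
  have : ((pr P (cyl A [::]))%:C)%C = 0.
    rewrite (pr_ones_det uA); move: nuD; rewrite unitmxE unitfE negbK => /eqP h.
    by rewrite /kdet h.
  by case=> ->; rewrite mulr0 pr_ge0.
(* The minimiser, which cancels the completed square. *)
pose v := - (kmx g (fun i : 'I_1 => 0 : lattice d) w *m invmx (kmx g w w)).
have := poly_square uD v; rewrite addNr.
have -> : (fun x => nsq (csum w 0 x) * f x) = (fun=> 0).
  apply/funext => x; rewrite /csum big1 => [|i _]; last by rewrite mxE mul0r.
  by rewrite /nsq /= expr0n addr0 mul0r.
rewrite mean_cst addr0 => hS.
have := ones_schur uA nA uD; rewrite -hS -rmorphM => -[->].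
rewrite mulrC ler_wpM2l ?pr_ge0//; apply: hp.
exact: csum_past_poly.
Qed.

Lemma ones_bound_poly (p : R) (T : euclid R d -> C) :
  (forall A, uniq A -> 0 < pr P (cyl A [::])) -> ones_bound Q P p ->
  past_poly Pi T -> p <= mean Tor (fun x => nsq (T x) * f x).
Proof.
move=> pos kp [s Qs Ts].
pose A := undup (map snd s).
have uA : uniq A by exact: undup_uniq.
have QA k : k \in A -> Q k by rewrite mem_undup => /mapP[q /Qs Qq ->].
have nA : 0 \notin A by apply/negP => /QA; exact: past_neq0.
pose w (i : 'I_(size A)) : lattice d := nth 0 A i.
(* Frequencies may repeat in [s], so the coefficients belonging to each site of [A] are summed. *)
pose v : 'rV[C]_(size A) := \row_i \sum_(q <- s | q.2 == w i) q.1.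
have TE : T = fun x => 1 + csum w v x.
  apply/funext => x; rewrite Ts; congr (_ + _); rewrite /csum /tsum.
  transitivity (\sum_(k <- A) (\sum_(q <- s | q.2 == k) q.1) * chi k x); last first.
    by rewrite (big_nth 0) big_mkord; apply: eq_bigr => i _; rewrite mxE.
  under [RHS]eq_bigr do rewrite mulr_suml big_mkcond.
  rewrite [RHS]exchange_big [LHS]big_seq [RHS]big_seq; apply: eq_bigr => q qs.
  have qA : q.2 \in A by rewrite mem_undup map_f.
  rewrite (bigD1_seq q.2)//= eqxx big1 ?addr0// => k kq.
  by rewrite eq_sym (negbTE kq).
have uD : kmx g w w \in unitmx.
  rewrite unitmxE unitfE; apply/eqP => h.
  have := pr_ones_det uA; rewrite /kdet h => -[h'].
  by have := pos A uA; rewrite h' ltxx.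
rewrite TE -lecR (poly_square uD v).
have := ones_schur uA nA uD; set S := kschur _ _ _ _ => hS.
have Ap := pos A uA.
have SE : S = ((pr P (cyl (0 :: A) [::]) / pr P (cyl A [::]))%:C)%C.
  apply: (@mulfI _ ((pr P (cyl A [::]))%:C)%C).
    by apply/eqP => -[h]; rewrite h ltxx in Ap.
  by rewrite -hS -rmorphM mulrCA divff ?mulr1// gt_eqF.
rewrite SE -rmorphD lecR.
apply: le_trans (_ : _ <= pr P (cyl (0 :: A) [::]) / pr P (cyl A [::])) _.
  by rewrite ler_pdivlMr//; exact: kp.
rewrite lerDl; apply: mean_ge0 => x; rewrite mulr_ge0 ?nsq_ge0//.
by case/andP: (f01 x).
Qed.

Lemma GM_ones_bound (p : R) (mup : probability (config d) R) : 0 <= p <= 1 ->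
  is_product_measure p mup -> (p%:E <= GM f)%E <-> ones_bound Q P p.
Proof.
move=> p01 hmup; have [p_ge0 _] := andP p01.
split=> [/(GM_geometric hPi mf f01 p_ge0)|kp]; first exact: poly_ones_bound.
have [->|pN0] := eqVneq p 0; first exact: expeR_ge0.
(* The bound with [p > 0] makes the kernel matrices invertible: it implies
   domination of a product measure, which charges every finite set of ones. *)
have st := determinantal_cyl_stationary hP.
have nc := determinantal_neg_corr mf f01 hP.
have [[_ /(_ kp) dom] _] := dom_strong_ones_bound hPi p01 hmup st nc.
apply/(GM_geometric hPi mf f01 p_ge0) => T hT; apply: ones_bound_poly => // A uA.
apply: lt_le_trans (stoch_dom_ones hmup dom uA).
by rewrite exprn_gt0// lt_def pN0.
Qed.

End szego.

(** * Exchanging zeros and ones *)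

Section flip.
Variables (R : realType) (d : nat).
Implicit Types (mu nu P : probability (config d) R) (E : set (config d)).

Definition flip (eta : config d) : config d := fun k => ~~ eta k.

Lemma flipK : involutive flip.
Proof. by move=> eta; apply/funext => k; rewrite /flip negbK. Qed.

Lemma flip_past_measurable Q E : measurable (E : set (past_field Q)) ->
  measurable (flip @^-1` E : set (past_field Q)).
Proof.
move=> mE; move: E mE; apply: smallest_sub; last first.
  move=> _ [k Qk <-] /=; rewrite (_ : _ @^-1` _ = ~` occ k).
    by apply: (@measurableC _ (past_field Q)); exact: measurable_occ.
  by apply/seteqP; split => eta /negP.
split.
- by rewrite /= preimage_set0; exact: (@measurable0 _ (past_field Q)).
- by move=> A mA; rewrite setTD /= preimage_setC; exact: (@measurableC _ (past_field Q)).
- by move=> A mA; rewrite /= preimage_bigcup; apply: (@bigcup_measurable _ (past_field Q)).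
Qed.

Lemma measurable_flip : measurable_fun setT flip.
Proof. by move=> _ E mE; rewrite setTI; exact: (@flip_past_measurable setT). Qed.

HB.instance Definition _ := isMeasurableFun.Build _ _ _ _ flip measurable_flip.

Definition flip_law mu : probability (config d) R := distribution mu flip.

Lemma flip_lawE mu E : flip_law mu E = mu (flip @^-1` E).
Proof. by []. Qed.

Lemma flip_law_product (q : R) mu :
  is_product_measure q mu -> is_product_measure (1 - q) (flip_law mu).
Proof.
move=> h n e b ei; rewrite flip_lawE.
rewrite (_ : _ @^-1` _ = [set eta : config d | forall i, eta (e i) = ~~ b i]).
  by rewrite h//; congr EFin; apply: eq_bigr => i _; case: (b i); rewrite /= ?subKr.
by apply/seteqP; split => eta /= he i; have := he i; rewrite /flip;
  case: (eta (e i)); case: (b i).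
Qed.

Lemma flip_increasing E : increasing_event E -> increasing_event (~` (flip @^-1` E)).
Proof.
move=> iE eta delta ed nE Ed; apply: nE; apply: iE Ed => k.
by rewrite /flip; apply: contra; exact: ed.
Qed.

(** The flipped image of an increasing event is decreasing, so domination is applied to its
    complement, and the inequality is reversed. *)
Lemma flip_stoch_dom nu mu :
  stoch_dom nu mu <-> stoch_dom (flip_law mu) (flip_law nu).
Proof.
have mC E : measurable E -> measurable (~` (flip @^-1` E)).
  by move=> mE; apply: measurableC; exact: (@flip_past_measurable setT).
split=> dom E mE iE.
  have := dom _ (mC _ mE) (flip_increasing iE).
  have mF : measurable (flip @^-1` E) by exact: (@flip_past_measurable setT).
  rewrite !flip_lawE !probability_setC// !prE// -!EFinB !lee_fin; lra.
have := dom _ (mC _ mE) (flip_increasing iE).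
have ff : flip @^-1` (~` (flip @^-1` E)) = ~` E.
  by apply/seteqP; split => eta; rewrite /= flipK.
rewrite !flip_lawE ff.
by rewrite !probability_setC// !prE// -!EFinB !lee_fin; lra.
Qed.

Lemma flip_strong_dom Pi mu (q : R) :
  strong_dom_le Pi mu q <-> strong_dom_ge Pi (1 - q) (flip_law mu).
Proof.
rewrite strong_dom_leP strong_dom_geP.
have m0 := @measurable_occT d 0.
have prF E : pr (flip_law mu) E = pr mu (flip @^-1` E) by [].
have split0 E : measurable (E : set (past_field (past0 Pi))) ->
    pr mu (flip @^-1` (occ 0 `&` E)) =
    pr mu (flip @^-1` E) - pr mu (occ 0 `&` flip @^-1` E).
  move=> mE; have mF := past_field_measurable (flip_past_measurable mE).
  rewrite (pr_split mu mF m0) [occ 0 `&` flip @^-1` E]setIC [X in _ = X - _]addrC addrK; congr (pr mu _).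
  by apply/seteqP; split => eta /= [a b]; split => //; [exact/negP|exact/negP].
split=> h E mE.
  by rewrite !prF split0//; have := h _ (flip_past_measurable mE); lra.
have := h _ (flip_past_measurable mE); rewrite !prF split0; last exact: flip_past_measurable.
have -> : flip @^-1` (flip @^-1` E) = E.
  by apply/seteqP; split => eta; rewrite /= flipK.
lra.
Qed.

Lemma fourier_compl (f : euclid R d -> R) k : measurable_fun setT f ->
  (forall x, 0 <= f x <= 1) ->
  fourier (fun x => 1 - f x) k = (k == 0)%:R - fourier f k.
Proof.
move=> mf f01; have bf : bmf f := bmf_itv mf f01.
have bc := bmf_cosk R k; have bs := bmf_sink R k.
have bfc := bmfM bf bc; have bfs := bmfM bf bs.
have mc : mean (torus_measure R d) (fun x => cos (2 * pi * dotp k x)) = (k == 0)%:R.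
  case: eqP => [->|/eqP k0].
    by under eq_fun do rewrite dotp0 mulr0 cos0; rewrite mean_cst.
  by have := mean_cos (0 : R) k0; under eq_fun do rewrite addr0.
have ms : mean (torus_measure R d) (fun x => sin (2 * pi * dotp k x)) = 0.
  case: (eqVneq k 0) => [->|k0].
    by under eq_fun do rewrite dotp0 mulr0 sin0; rewrite mean_cst.
  by under eq_fun do rewrite sin_cos; rewrite mean_cos.
have e1 : mean (torus_measure R d) (fun x => (1 - f x) * cos (2 * pi * dotp k x)) =
    (k == 0)%:R - mean (torus_measure R d) (fun x => f x * cos (2 * pi * dotp k x)).
  by under eq_fun do rewrite mulrBl mul1r; rewrite meanB// mc.
have e2 : mean (torus_measure R d) (fun x => (1 - f x) * sin (2 * pi * dotp k x)) =
    - mean (torus_measure R d) (fun x => f x * sin (2 * pi * dotp k x)).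
  by under eq_fun do rewrite mulrBl mul1r; rewrite meanB// ms sub0r.
rewrite /fourier -/(mean _ _) -/(mean _ _) e1 e2.
apply/eqP; rewrite eq_complex; case: (k == 0);
  by rewrite /= ?mulr1n ?mulr0n ?sub0r ?opprK ?eqxx ?add0r ?eqxx.
Qed.

(** All ones after flipping means all zeros before, whose probability is [(-1) ^ n] times the
    determinant of the kernel minus the identity, that is the determinant of the complementary
    kernel. *)
Lemma flip_determinantal (f : euclid R d -> R) P : measurable_fun setT f ->
  (forall x, 0 <= f x <= 1) -> is_determinantal f P ->
  is_determinantal (fun x => 1 - f x) (flip_law P).
Proof.
move=> mf f01 hP n e n0 ei; rewrite flip_lawE.
have -> : flip @^-1` [set eta : config d | forall i, eta (e i) = true] = pattern e predT.
  by apply/seteqP; split => eta /= h i; have := h i; rewrite /flip /=; case: (eta (e i)).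
have hm : (\sum_(i < n) predT (e i) = n)%N by rewrite sum1_card card_ord.
rewrite -/(pr P _) (pattern_det hP ei hm) /kdet -[(-1) ^+ n * _]detZ.
congr (\det _); apply/matrixP => i j; rewrite !mxE mulN1r opprB fourier_compl//.
by rewrite /= andbT subr_eq0 eq_sym.
Qed.

End flip.

Theorem theorem5p11 (R : realType) (d : nat) (hd : (0 < d)%N)
    (Pi : set (lattice d)) (hPi : is_ordering Pi) :
  (forall (f : euclid R d -> R) (p q : R)
      (Pf mup muq : probability (config d) R),
    measurable_fun setT f -> periodic_fun f -> (forall x, 0 <= f x <= 1) ->
    0 <= p <= 1 -> 0 <= q <= 1 ->
    is_determinantal f Pf -> is_product_measure p mup ->
    is_product_measure q muq ->
    ((stoch_dom mup Pf <-> (p%:E <= GM f)%E) /\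
     ((p%:E <= GM f)%E <-> strong_dom_ge Pi p Pf)) /\
    ((stoch_dom Pf muq <-> (1 - GM (fun x => 1 - f x)%R <= q%:E)%E) /\
     ((1 - GM (fun x => 1 - f x)%R <= q%:E)%E <-> strong_dom_le Pi Pf q))) /\
  (forall (mu : probability (config d) R), stationary mu ->
    cond_neg_assoc mu ->
    forall (p : R) (mup : probability (config d) R),
      0 <= p <= 1 -> is_product_measure p mup ->
      (stoch_dom mup mu <-> strong_dom_ge Pi p mu)).
Proof.
have lower (f : euclid R d -> R) (p : R) (Pf mup : probability (config d) R) :
    measurable_fun setT f -> (forall x, 0 <= f x <= 1) -> 0 <= p <= 1 ->
    is_determinantal f Pf -> is_product_measure p mup ->
    (stoch_dom mup Pf <-> (p%:E <= GM f)%E) /\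
    ((p%:E <= GM f)%E <-> strong_dom_ge Pi p Pf).
  move=> mf f01 p01 hPf hmup.
  have st := determinantal_cyl_stationary hPf.
  have nc := determinantal_neg_corr mf f01 hPf.
  have [dk sk] := dom_strong_ones_bound hPi p01 hmup st nc.
  have gk := GM_ones_bound hPi mf f01 hPf p01 hmup.
  by rewrite dk sk gk.
split; last first.
  move=> mu /stationary_cyl st /cond_neg_assoc_neg_corr nc p mup p01 hmup.
  by have [-> ->] := dom_strong_ones_bound hPi p01 hmup st nc.
move=> f p q Pf mup muq mf _ f01 p01 q01 hPf hmup hmuq; split; first exact: lower.
have f01' x : 0 <= 1 - f x <= 1.
  by have /andP[a b] := f01 x; rewrite subr_ge0 b gerBl a.
have mf' : measurable_fun setT (fun x => 1 - f x).
  by apply: measurable_funB => //; exact: measurable_cst.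
have q01' : 0 <= 1 - q <= 1 by have /andP[a b] := q01; rewrite subr_ge0 b gerBl a.
have := lower _ _ _ _ mf' f01' q01' (flip_determinantal mf f01 hPf) (flip_law_product hmuq).
rewrite -flip_stoch_dom -flip_strong_dom.
suff -> : (1 - GM (fun x => 1 - f x)%R <= q%:E)%E
  = ((1 - q)%:E <= GM (fun x => 1 - f x)%R)%E by [].
(* [GM] is an extended real, so moving it across the inequality is checked for a real, an infinite
   positive and an infinite negative exponent. *)
rewrite /GM; case: (\int[_]_x _)%E => [s| |] /=; rewrite ?lee_fin ?leey ?leNye//.
  by rewrite lerBlDr lerBlDl addrC.
by rewrite subr0 lerBlDr add0r.
Qed.
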